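(* Let $F=(F_1,\ldots,F_m)$ be a contractive free holomorphic function with coefficients in $B(\mathcal E)$ (on $[B(\mathcal H)^n]_1$). If $z,\xi\in\mathbb B_n$, then $F(z)\overset{H}{\sim}F(\xi)$ and $$\|L_{F(z),F(\xi)}\|\le\|L_{z,\xi}\|=\left(\frac{1+\|\varphi_z(\xi)\|_2}{1-\|\varphi_z(\xi)\|_2}\right)^{1/2},$$ where $\varphi_z$ is the involutive automorphism of $\mathbb B_n$ which takes $0$ into $z$. Moreover, $$\delta(F(z),F(\xi))\le\delta(z,\xi)$$ for any $z,\xi\in\mathbb B_n$, where $\delta$ is the hyperbolic metric.
   Context: $n,m$ are positive integers, $\mathcal H,\mathcal E$ are complex Hilbert spaces. For a Hilbert space $\mathcal G$ and a positive integer $k$, $[B(\mathcal G)^k]_1^-$ (resp. $[B(\mathcal G)^k]_1$) is the set of $(X_1,\ldots,X_k)\in B(\mathcal G)^k$ with $\|X_1X_1^*+\cdots+X_kX_k^*\|^{1/2}\le1$ (resp. $<1$). $\mathbb B_n$ is the open unit ball of $\mathbb C^n$; a point $z=(z_1,\ldots,z_n)\in\mathbb B_n$ is identified with $(z_1I_{\mathcal H},\ldots,z_nI_{\mathcal H})\in[B(\mathcal H)^n]_1$. $\mathbb F_k^+$ is the unital free semigroup on generators $g_1,\ldots,g_k$ with identity $g_0$; $|\alpha|$ is the word length; $X_\alpha:=X_{i_1}\cdots X_{i_q}$ if $\alpha=g_{i_1}\cdots g_{i_q}$, $X_{g_0}:=I$. A free holomorphic function on $[B(\mathcal H)^n]_1$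 with coefficients in $B(\mathcal E)$ is a map $G:[B(\mathcal H)^n]_1\to B(\mathcal H)\otimes_{min}B(\mathcal E)$ of the form $G(X)=\sum_{q=0}^\infty\sum_{|\alpha|=q}X_\alpha\otimes A_{(\alpha)}$, with $A_{(\alpha)}\in B(\mathcal E)$ and $\limsup_{q\to\infty}\|\sum_{|\alpha|=q}A_{(\alpha)}^*A_{(\alpha)}\|^{1/2q}\le1$ (the series converges in operator norm, and the same series defines $G$ on $[B(\mathcal K)^n]_1$ for any $\mathcal K$). $F=(F_1,\ldots,F_m)$ (each $F_j$ free holomorphic with coefficients in $B(\mathcal E)$) is contractive if $\|F\|_\infty:=\sup\|\sum_{j}F_j(X)F_j(X)^*\|^{1/2}\le1$, the supremum being over all $X\in[B(\mathcal K)^n]_1$ with $\mathcal K$ an infinite-dimensional Hilbert space. $F(z)$ is the $m$-tuple $(F_1(z),\ldots,F_m(z))\in[B(\mathcal H\otimes\mathcal E)^m]_1^-$. Harnack relations: for $A,B\in[B(\mathcal G)^k]_1^-$ and $c>0$, $A\overset{H}{\prec}_cB$ means $\mathrm{Re}\,p(A)\le c^2\,\mathrm{Re}\,p(B)$ for every $q\in\mathbb N$ and every noncommutative polynomial $p\in\mathbb C[X_1,\ldots,X_k]\otimes M_q$ such that $\mathrm{Re}\,p(X)\ge0$ for all $X\in[B(\mathcal K)^k]_1$, $\mathcal K$ an infinite-dimensional Hilbert space. $A\overset{H}{\prec}B$ means $A\overset{H}{\prec}_cB$ for some $c>0$; $A\overset{H}{\sim}_cB$ means $A\overset{H}{\prec}_cB$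 and $B\overset{H}{\prec}_cA$; $A\overset{H}{\sim}B$ means $A\overset{H}{\sim}_cB$ for some $c\ge1$. For $A\overset{H}{\sim}B$, $\delta(A,B):=\ln\inf\{c\ge1:\ A\overset{H}{\sim}_cB\}$. A minimal isometric dilation of $T\in[B(\mathcal G)^k]_1^-$ is a $k$-tuple $V$ of isometries on $\mathcal K_T\supseteq\mathcal G$ with $\sum_iV_iV_i^*\le I$, $V_i^*|_{\mathcal G}=T_i^*$, $\mathcal K_T=\bigvee_{\alpha\in\mathbb F_k^+}V_\alpha\mathcal G$ (unique up to an isomorphism). If $V$ on $\mathcal K_A$, $W$ on $\mathcal K_B$ are the minimal isometric dilations of $A$, $B$ and $A\overset{H}{\prec}B$, then $L_{B,A}:\mathcal K_B\to\mathcal K_A$ is the unique bounded operator with $L_{B,A}|_{\mathcal G}=I_{\mathcal G}$ and $L_{B,A}W_i=V_iL_{B,A}$ for all $i$. (Any two elements of $[B(\mathcal H)^n]_1$ are known to be Harnack equivalent, so $L_{z,\xi}$ and $\delta(z,\xi)$ are defined.) For $a\in\mathbb B_n$, $\varphi_a(w):=\dfrac{a-Q_aw-s_a(I-Q_a)w}{1-\langle w,a\rangle}$, $w\in\mathbb B_n$, where $Q_0=0$, $Q_aw:=\frac{\langle w,a\rangle}{\langle a,a\rangle}a$ if $a\ne0$, and $s_a:=(1-\langle a,a\rangle)^{1/2}$. $\|\cdot\|_2$ is the Euclidean norm. *)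

(* Defs.v *)
From HB Require Import structures.
From mathcomp Require Import all_boot all_order all_algebra.
From mathcomp Require Export finmap.
From mathcomp Require Export all_classical all_reals all_analysis.
From mathcomp Require Export complex.

Set Implicit Arguments.
Unset Strict Implicit.
Unset Printing Implicit Defensive.

Import Order.TTheory GRing.Theory Num.Theory.
Import numFieldNormedType.Exports.

Local Open Scope classical_set_scope.
Local Open Scope ring_scope.
Local Open Scope complex_scope.

(* The norm of a complete normed module over R[i] takes its values in R[i].
   The inner product is linear in its first argument. *)
HB.mixin Record CompleteNormedModule_isHilbert (R : realType) H
    of CompleteNormedModule R[i] H := {
  hdot : {dot H for (@Num.conj R[i])};
  hdot_norm : forall x : H, `|x| ^+ 2 = hdot x x }.

#[short(type="hilbertType")]
HB.structure Definition Hilbert (R : realType) :=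
  {H of CompleteNormedModule R[i] H & CompleteNormedModule_isHilbert R H}.

Notation "''[' x , y ]" := (hdot x y)
  (format "''[' x ,  y ]") : ring_scope.

Definition rnorm (R : realType) (H : hilbertType R) (x : H) : R :=
  complex.Re `|x|.

Section BoundedOperators.
Context {R : realType}.
Implicit Types G H K : hilbertType R.

Lemma rnormE H (x : H) : `|x| = (rnorm x)%:C.
Proof.
have := normr_ge0 x; rewrite /rnorm lecE /= => /andP[/eqP im0 _].
by apply/eqP; rewrite eq_complex /= im0 !eqxx.
Qed.

Lemma normcRe (a : R[i]) : `|a| = (complex.Re `|a|)%:C.
Proof.
have := normr_ge0 a; rewrite lecE /= => /andP[/eqP im0 _].
by apply/eqP; rewrite eq_complex /= im0 !eqxx.
Qed.

Lemma rnorm_ge0 H (x : H) : 0 <= rnorm x.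
Proof. by rewrite -ler0c -rnormE. Qed.

Lemma rnormD H (x y : H) : rnorm (x + y) <= rnorm x + rnorm y.
Proof. by rewrite -lecR rmorphD /= -!rnormE ler_normD. Qed.

Lemma rnormZ H (a : R[i]) (x : H) :
  rnorm (a *: x) = complex.Re `|a| * rnorm x.
Proof.
have : (rnorm (a *: x))%:C = (complex.Re `|a| * rnorm x)%:C.
  by rewrite rmorphM /= -!rnormE normrZ -normcRe.
by case.
Qed.

Lemma rnorm0 H : rnorm (0 : H) = 0.
Proof. by rewrite /rnorm normr0. Qed.

Lemma rnorm_eq0 H (x : H) : rnorm x = 0 -> x = 0.
Proof. by move=> x0; apply/eqP; rewrite -normr_eq0 rnormE x0. Qed.

Record bop H K := Bop {
  bop_fun :> H -> K;
  bop_linear : linear bop_fun;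
  bop_bounded : exists M : R, forall x, rnorm (bop_fun x) <= M * rnorm x }.

HB.instance Definition _ H K (T : bop H K) :=
  GRing.isLinear.Build R[i] H K *:%R (bop_fun T) (bop_linear T).

Lemma bopP H K (S T : bop H K) : (forall x, S x = T x) -> S = T.
Proof.
case: S => f fl fb; case: T => g gl gb /= fg.
have {}fg : f = g by exact: funext.
by subst g; congr Bop; exact: Prop_irrelevance.
Qed.

Lemma bop_bounded_ge0 H K (T : bop H K) :
  exists2 M : R, 0 <= M & forall x, rnorm (T x) <= M * rnorm x.
Proof.
have [M TM] := bop_bounded T; exists `|M| => // x.
by rewrite (le_trans (TM x)) // ler_wpM2r ?rnorm_ge0 // ler_norm.
Qed.

Lemma bop0_linear H K : linear (fun _ : H => 0 : K).
Proof. by move=> a x y; rewrite scaler0 addr0. Qed.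

Lemma bop0_bounded H K :
  exists M : R, forall x : H, rnorm (0 : K) <= M * rnorm x.
Proof. by exists 0 => x; rewrite mul0r rnorm0. Qed.

Definition bop0 H K : bop H K := Bop (@bop0_linear H K) (@bop0_bounded H K).

Lemma bopD_linear H K (S T : bop H K) : linear (fun x => S x + T x).
Proof. by move=> a x y; rewrite !linearP scalerDr addrACA. Qed.

Lemma bopD_bounded H K (S T : bop H K) :
  exists M : R, forall x, rnorm (S x + T x) <= M * rnorm x.
Proof.
have [[M SM] [N TN]] := (bop_bounded S, bop_bounded T).
exists (M + N) => x; rewrite mulrDl.
by rewrite (le_trans (rnormD _ _)) // lerD.
Qed.

Definition bopD H K (S T : bop H K) : bop H K :=
  Bop (bopD_linear S T) (bopD_bounded S T).

Lemma bopZ_linear H K (a : R[i]) (T : bop H K) : linear (fun x => a *: T x).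
Proof. by move=> b x y; rewrite linearP scalerDr !scalerA mulrC. Qed.

Lemma bopZ_bounded H K (a : R[i]) (T : bop H K) :
  exists M : R, forall x, rnorm (a *: T x) <= M * rnorm x.
Proof.
have [M TM] := bop_bounded T; exists (complex.Re `|a| * M) => x.
by rewrite rnormZ -mulrA ler_wpM2l // -ler0c -normcRe.
Qed.

Definition bopZ H K (a : R[i]) (T : bop H K) : bop H K :=
  Bop (bopZ_linear a T) (bopZ_bounded a T).

HB.instance Definition _ H K := gen_eqMixin (bop H K).
HB.instance Definition _ H K := gen_choiceMixin (bop H K).

Lemma bop_addA H K : associative (@bopD H K).
Proof. by move=> S T U; apply: bopP => x /=; rewrite addrA. Qed.

Lemma bop_addC H K : commutative (@bopD H K).
Proof. by move=> S T; apply: bopP => x /=; rewrite addrC. Qed.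

Lemma bop_add0 H K : left_id (bop0 H K) (@bopD H K).
Proof. by move=> S; apply: bopP => x /=; rewrite add0r. Qed.

Lemma bop_addN H K : left_inverse (bop0 H K) (bopZ (-1)) (@bopD H K).
Proof. by move=> S; apply: bopP => x /=; rewrite scaleN1r addNr. Qed.

HB.instance Definition _ H K := GRing.isZmodule.Build (bop H K)
  (@bop_addA H K) (@bop_addC H K) (@bop_add0 H K) (@bop_addN H K).

Lemma bop_scaleA H K (a b : R[i]) (T : bop H K) :
  bopZ a (bopZ b T) = bopZ (a * b) T.
Proof. by apply: bopP => x /=; rewrite scalerA. Qed.

Lemma bop_scale1 H K : left_id 1 (@bopZ H K).
Proof. by move=> T; apply: bopP => x /=; rewrite scale1r. Qed.

Lemma bop_scaleDr H K : right_distributive (@bopZ H K) +%R.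
Proof. by move=> a S T; apply: bopP => x /=; rewrite scalerDr. Qed.

Lemma bop_scaleDl H K (T : bop H K) : {morph (@bopZ H K)^~ T : a b / a + b}.
Proof. by move=> a b; apply: bopP => x /=; rewrite scalerDl. Qed.

HB.instance Definition _ H K := GRing.Zmodule_isLmodule.Build R[i] (bop H K)
  (@bop_scaleA H K) (@bop_scale1 H K) (@bop_scaleDr H K) (@bop_scaleDl H K).

Definition opnorm H K (T : bop H K) : R :=
  sup [set rnorm (T x) | x in [set x | rnorm x <= 1]].

Lemma opnorm_ub H K (T : bop H K) x : rnorm x <= 1 -> rnorm (T x) <= opnorm T.
Proof.
move=> x1; apply: ub_le_sup; last by exists x.
have [M M0 TM] := bop_bounded_ge0 T; exists M => _ [y /= y1 <-].
by rewrite (le_trans (TM y)) // ler_piMr.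
Qed.

Lemma opnorm_ge0 H K (T : bop H K) : 0 <= opnorm T.
Proof.
apply: le_trans (opnorm_ub T (x := 0) _); first exact: rnorm_ge0.
by rewrite rnorm0.
Qed.

Lemma opnormP H K (T : bop H K) x : rnorm (T x) <= opnorm T * rnorm x.
Proof.
have [/rnorm_eq0->|x0] := eqVneq (rnorm x) 0.
  by rewrite linear0 !rnorm0 mulr0.
have xp : 0 < rnorm x by rewrite lt_neqAle eq_sym x0 rnorm_ge0.
have nE : complex.Re `|((rnorm x)^-1)%:C| = (rnorm x)^-1.
  by rewrite ger0_norm // ler0c invr_ge0 ltW.
rewrite -ler_pdivrMr // mulrC -{1}nE -rnormZ -linearZ.
by apply: opnorm_ub; rewrite rnormZ nE mulVf.
Qed.

Lemma opnorm_le H K (T : bop H K) M : 0 <= M ->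
  (forall x, rnorm (T x) <= M * rnorm x) -> opnorm T <= M.
Proof.
move=> M0 TM; apply: ge_sup.
  by exists (rnorm (T 0)), 0 => //=; rewrite rnorm0.
by move=> _ [x /= x1 <-]; rewrite (le_trans (TM x)) // ler_piMr.
Qed.

Definition bop_norm H K (T : bop H K) : R[i] := (opnorm T)%:C.

Lemma bop_normD H K (S T : bop H K) :
  bop_norm (S + T) <= bop_norm S + bop_norm T.
Proof.
rewrite /bop_norm -rmorphD lecR opnorm_le ?addr_ge0 ?opnorm_ge0 // => x.
by rewrite mulrDl (le_trans (rnormD _ _)) // lerD // opnormP.
Qed.

Lemma bop_normZ H K (a : R[i]) (T : bop H K) :
  bop_norm (a *: T) = `|a| * bop_norm T.
Proof.
have le b (S : bop H K) : bop_norm (b *: S) <= `|b| * bop_norm S.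
  have b0 : 0 <= complex.Re `|b| by rewrite -ler0c -normcRe.
  rewrite /bop_norm normcRe -rmorphM lecR.
  apply: opnorm_le => [|x]; first by rewrite mulr_ge0 ?opnorm_ge0.
  by rewrite rnormZ -mulrA ler_wpM2l // opnormP.
apply/eqP; rewrite eq_le le /=; have [->|a0] := eqVneq a 0.
  by rewrite normr0 mul0r ler0c opnorm_ge0.
rewrite -ler_pdivlMl ?normr_gt0 // -normfV (le_trans _ (le _ _)) //.
by rewrite scalerA mulVf // scale1r.
Qed.

Lemma bop_norm_eq0 H K (T : bop H K) : bop_norm T = 0 -> T = 0.
Proof.
case=> T0; apply: bopP => x; apply/rnorm_eq0/eqP.
by rewrite eq_le rnorm_ge0 (le_trans (opnormP T x)) // T0 mul0r.
Qed.

HB.instance Definition _ H K := Lmodule_isNormed.Build R[i] (bop H K)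
  (@bop_normD H K) (@bop_normZ H K) (@bop_norm_eq0 H K).

Lemma bid_linear H : linear (@idfun H). Proof. by []. Qed.

Lemma bid_bounded H : exists M : R, forall x : H, rnorm (idfun x) <= M * rnorm x.
Proof. by exists 1 => x; rewrite mul1r. Qed.

Definition bid H : bop H H := Bop (@bid_linear H) (@bid_bounded H).

Lemma bcomp_linear G H K (S : bop H K) (T : bop G H) : linear (S \o T).
Proof. by move=> a x y; rewrite /= !linearP. Qed.

Lemma bcomp_bounded G H K (S : bop H K) (T : bop G H) :
  exists M : R, forall x, rnorm ((S \o T) x) <= M * rnorm x.
Proof.
exists (opnorm S * opnorm T) => x.
rewrite (le_trans (opnormP _ _)) // -mulrA ler_wpM2l ?opnorm_ge0 //.
exact: opnormP.
Qed.

Definition bcomp G H K (S : bop H K) (T : bop G H) : bop G K :=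
  Bop (bcomp_linear S T) (bcomp_bounded S T).

(* By the Riesz representation theorem, the set below is a singleton. *)
Definition adj H K (T : bop H K) : bop K H :=
  xget 0 [set S : bop K H | forall x y, '[T x, y] = '[x, S y]].

(* The order on selfadjoint operators: [0 <= z] in R[i] forces z to be real. *)
Definition op_le H (S T : bop H H) := forall x, 0 <= '[(T - S) x, x].

Definition isometric H K (T : bop H K) := forall x, rnorm (T x) = rnorm x.

Definition lin_span H (A : set H) : set H :=
  [set x | exists N (c : 'I_N -> R[i]) (v : 'I_N -> H),
     (forall i, A (v i)) /\ x = \sum_i c i *: v i].

Definition dense_span H (A : set H) := closure (lin_span A) = setT.

Definition infinite_dim H :=
  ~ exists N (v : 'I_N -> H), lin_span (range v) = setT.

End BoundedOperators.

Infix "*B" := bcomp (at level 40, left associativity) : ring_scope.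

(* A Hilbert space tensor product of H and K: such a space exists and is
   unique up to a unitary compatible with the elementary tensors. *)
Record hilbert_tensor (R : realType) (H K : hilbertType R) := HilbertTensor {
  ht_space :> hilbertType R;
  ht_ten : {bilinear H -> K -> ht_space};
  ht_dot : forall h k h' k',
    '[ht_ten h k, ht_ten h' k'] = '[h, h'] * '[k, k'];
  ht_total : dense_span [set ht_ten p.1 p.2 | p in [set: H * K]] }.

Section Tuples.
Context {R : realType}.
Implicit Types G H K E : hilbertType R.

(* The set below is a singleton: the bounded operator S (x) T exists, and it is
   determined by its values on elementary tensors. *)
Definition op_tensor H K (HK : hilbert_tensor H K) (S : bop H H) (T : bop K K) :
    bop HK HK :=
  xget 0 [set U : bop HK HK |
    forall h k, U (ht_ten HK h k) = ht_ten HK (S h) (T k)].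

Definition op_tuple k H := 'I_k -> bop H H.

Definition word_op k H (X : op_tuple k H) (a : seq 'I_k) : bop H H :=
  foldr (fun i T => X i *B T) (bid H) a.

Definition row_norm k H (X : op_tuple k H) : R :=
  Num.sqrt (opnorm (\sum_i X i *B adj (X i))).

Definition closed_ball_op k H : set (op_tuple k H) := [set X | row_norm X <= 1].

Definition open_ball_op k H : set (op_tuple k H) := [set X | row_norm X < 1].

(* A free holomorphic function is given by its coefficients, since the same
   series defines it on every Hilbert space. The exponent for q = 0 is 0^-1 = 0,
   which does not affect the upper limit. *)
Record free_hol n E := FreeHol {
  fh_coef :> seq 'I_n -> bop E E;
  fh_radius : (limn_esup (fun q : nat =>
    (opnorm (\sum_(a : q.-tuple 'I_n) adj (fh_coef a) *B fh_coef a)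
       `^ ((2 * q)%:R^-1))%:E) <= 1)%E }.

Definition fh_eval n H E (HE : hilbert_tensor H E) (A : free_hol n E)
    (X : op_tuple n H) : bop HE HE :=
  limn (series (fun q : nat =>
    \sum_(a : q.-tuple 'I_n) op_tensor HE (word_op X a) (A a))).

Definition fh_eval_tuple n m H E (HE : hilbert_tensor H E)
    (F : 'I_m -> free_hol n E) (X : op_tuple n H) : op_tuple m HE :=
  fun j => fh_eval HE (F j) X.

Definition fh_norm n m E (F : 'I_m -> free_hol n E) : \bar R :=
  ereal_sup [set r | exists (K : hilbertType R) (KE : hilbert_tensor K E)
    (X : op_tuple n K),
    [/\ infinite_dim K, open_ball_op X &
        r = (row_norm (fh_eval_tuple KE F X))%:E]].

Definition contractive n m E (F : 'I_m -> free_hol n E) := (fh_norm F <= 1)%E.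

(* C[X_1, ..., X_k] (x) M_q, as finitely supported families of matrices indexed
   by words; B(K) (x) M_q is identified with the matrices over B(K), acting on
   the direct sum of q copies of K. *)
Definition ncpoly k q := {fsfun seq 'I_k -> 'M[R[i]]_q with 0}.

Definition nc_eval k q (p : ncpoly k q) K (X : op_tuple k K) :
    'M[bop K K]_q :=
  \sum_(a <- finsupp p) map_mx (fun c => c *: word_op X a) (p a).

Definition mxop_re q K (P : 'M[bop K K]_q) : 'M[bop K K]_q :=
  \matrix_(i, j) (2^-1 *: (P i j + adj (P j i))).

Definition mxop_le q K (P Q : 'M[bop K K]_q) :=
  forall x : 'I_q -> K, 0 <= \sum_i \sum_j '[(Q - P) i j (x j), x i].

Definition nc_re_nonneg k q (p : ncpoly k q) :=
  forall (K : hilbertType R) (X : op_tuple k K),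
    infinite_dim K -> open_ball_op X -> mxop_le 0 (mxop_re (nc_eval p X)).

Definition harnack_le k G (c : R) (A B : op_tuple k G) :=
  [/\ closed_ball_op A, closed_ball_op B, 0 < c &
      forall q (p : ncpoly k q), nc_re_nonneg p ->
        mxop_le (mxop_re (nc_eval p A))
          (map_mx (fun T => (c ^+ 2)%:C *: T) (mxop_re (nc_eval p B)))].

Definition harnack_equiv_with k G (c : R) (A B : op_tuple k G) :=
  harnack_le c A B /\ harnack_le c B A.

Definition harnack_equiv k G (A B : op_tuple k G) :=
  exists c : R, 1 <= c /\ harnack_equiv_with c A B.

Definition hyperbolic_dist k G (A B : op_tuple k G) : R :=
  ln (inf [set c : R | 1 <= c /\ harnack_equiv_with c A B]).

(* The inclusion of G in the dilation space is an isometric embedding. *)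
Record min_iso_dilation k G (T : op_tuple k G) := MinIsoDilation {
  mid_space : hilbertType R;
  mid_emb : bop G mid_space;
  mid_op : op_tuple k mid_space;
  mid_emb_isometric : isometric mid_emb;
  mid_isometric : forall i, isometric (mid_op i);
  mid_row : op_le (\sum_i mid_op i *B adj (mid_op i)) (bid mid_space);
  mid_coext : forall i, adj (mid_op i) *B mid_emb = mid_emb *B adj (T i);
  mid_total : dense_span [set word_op mid_op p.1 (mid_emb p.2)
                    | p in [set: seq 'I_k * G]] }.

(* L is L_{B,A}, for the minimal isometric dilations VA of A and WB of B. *)
Definition is_harnack_op k G (A B : op_tuple k G) (WB : min_iso_dilation B)
    (VA : min_iso_dilation A) (L : bop (mid_space WB) (mid_space VA)) :=
  L *B mid_emb WB = mid_emb VA /\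
  forall i, L *B mid_op WB i = mid_op VA i *B L.

End Tuples.

Section Ball.
Context {R : realType} {n : nat}.
Implicit Types w a : 'rV[R[i]]_n.

Definition cdot w a : R[i] := \sum_i w 0 i * Num.conj (a 0 i).

Definition norm2 w : R := Num.sqrt (\sum_i complex.Re `|w 0 i| ^+ 2).

Definition unit_ball : set 'rV[R[i]]_n := [set w | norm2 w < 1].

Definition proj_line a w : 'rV[R[i]]_n :=
  if a == 0 then 0 else (cdot w a / cdot a a) *: a.

Definition defect a : R[i] := (Num.sqrt (1 - complex.Re (cdot a a)))%:C.

Definition ball_aut a w : 'rV[R[i]]_n :=
  (1 - cdot w a)^-1 *:
    (a - proj_line a w - defect a *: (w - proj_line a w)).

Definition scalar_tuple (H : hilbertType R) w : op_tuple n H :=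
  fun i => w 0 i *: bid H.

End Ball.

(* Main.v *)
(* On l^2(N; G) the idempotent P y = (0, t y_0 + y_1, 0, ...) commutes with all
   diagonal operators, so (A, B) |-> T(A, B) = D(A) (1 - P) + D(B) P, with D the
   diagonal ampliation, is a homomorphism. The tuple of the T(z_i, xi_i) is a
   strict row contraction exactly for small t, the threshold being governed by
   rho = |phi_z(xi)|, and F maps it to the row contraction of the
   T(F_j(z), F_j(xi)). Testing the positivity of Re p at a row contraction Y of
   this shape on M = M_1 + M_2, where Y_i M_1 = M_1 A_i and Y_i M_2 = M_2 B_i,
   gives Re p(B) <= C Re p(A) with C tending to (1 + rho) / (1 - rho) at the
   threshold; the same test on the Gram form of the minimal isometric dilation
   gives the operator L, with |L|^2 <= C. Hence both Harnack constants are at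
   most the explicit one. For the scalar tuples it is attained, in the limit, by
   explicit polynomials attached to points w of the complex line through z and xi. *)
Require Import Defs.
From HB Require Import structures.
From mathcomp Require Import all_boot all_order all_algebra.
From mathcomp Require Import finmap.
From mathcomp Require Import all_classical all_reals all_analysis.
From mathcomp Require Import complex.
From mathcomp Require Import ring lra.

Set Implicit Arguments.
Unset Strict Implicit.
Unset Printing Implicit Defensive.

Import Order.TTheory GRing.Theory Num.Theory.
Import numFieldNormedType.Exports.

Local Open Scope classical_set_scope.
Local Open Scope ring_scope.
Local Open Scope complex_scope.

(** Contractivity of F is known only through its values at strict row contractions on
    infinite-dimensional spaces, so comparing F(z) with F(xi) needs one such tuple whose image under
    F still contains both values. The idempotent P provides it, and its obliquity is what matters: a
    selfadjoint P would give an orthogonal direct sum, in which nothing links the two points. Let s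
    = (1 + t^2)^(1/2) be the norm of P. Strictness follows from s rho < 1, and the test on the
    kernel and the range of P gives C = (s + 1) / (s - 1), hence the limit value as s tends to 1 /
    rho. Only two coordinates of l^2 are coupled; the others make the space infinite-dimensional
    even if H is not, and there the tuple is the plain ampliation of the first point. The lower
    bound comes from the vectors (I - \sum_i conj(w_i) V_i)^{-1} (I - \sum_i conj(z_i) V_i) h, with
    V the dilation of a scalar tuple v. The squared norms of their truncations are, up to |h|^2, the
    real parts at v of polynomials with nonnegative real part, so the same numbers bound both |L|
    and the Harnack constant from below. *)

(** * Calculus of the complex inner product and of its real part *)

Section InnerProduct.
Context {R : realType}.
Implicit Types H K : hilbertType R.

Lemma ReD (a b : R[i]) : complex.Re (a + b) = complex.Re a + complex.Re b.
Proof. by case: a b => [a1 a2] [b1 b2]. Qed.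

Lemma ReN (a : R[i]) : complex.Re (- a) = - complex.Re a.
Proof. by case: a. Qed.

Lemma ReM (a b : R[i]) : complex.Re (a * b) =
  complex.Re a * complex.Re b - complex.Im a * complex.Im b.
Proof. by case: a b => [a1 a2] [b1 b2]. Qed.

Lemma ReMl (c : R) (a : R[i]) : complex.Re (c%:C * a) = c * complex.Re a.
Proof. by rewrite ReM /= mul0r subr0. Qed.

Lemma Re_conj (a : R[i]) : complex.Re (Num.conj a) = complex.Re a.
Proof. by case: a. Qed.

Lemma Re_sum I (r : seq I) (P : pred I) (F : I -> R[i]) :
  complex.Re (\sum_(i <- r | P i) F i) = \sum_(i <- r | P i) complex.Re (F i).
Proof. by apply: (big_morph (@complex.Re R)) => //; apply: ReD. Qed.

Lemma conj_real (c : R) : Num.conj (c%:C) = c%:C :> R[i].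
Proof. by apply/eqP; rewrite eq_complex /= oppr0 !eqxx. Qed.

Lemma normc2 (a : R[i]) : a * Num.conj a = ((complex.Re `|a|) ^+ 2)%:C.
Proof. by rewrite -normCK normcRe /= -rmorphXn. Qed.

Lemma hdotDl H (x y z : H) : '[x + y, z] = '[x, z] + '[y, z].
Proof. exact: linearDl. Qed.

Lemma hdotDr H (x y z : H) : '[x, y + z] = '[x, y] + '[x, z].
Proof. exact: linearDr. Qed.

Lemma hdotZl H a (x y : H) : '[a *: x, y] = a * '[x, y].
Proof. exact: linearZl_LR. Qed.

Lemma hdotZr H a (x y : H) : '[x, a *: y] = Num.conj a * '[x, y].
Proof. exact: linearZr_LR. Qed.

Lemma hdotNl H (x y : H) : '[- x, y] = - '[x, y].
Proof. exact: linearNl. Qed.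

Lemma hdotNr H (x y : H) : '[x, - y] = - '[x, y].
Proof. exact: linearNr. Qed.

Lemma hdot0l H (x : H) : '[0, x] = 0.
Proof. exact: linear0l. Qed.

Lemma hdot0r H (x : H) : '[x, 0] = 0.
Proof. exact: linear0r. Qed.

Lemma hdot_suml H I (r : seq I) (P : pred I) (F : I -> H) (y : H) :
  '[\sum_(i <- r | P i) F i, y] = \sum_(i <- r | P i) '[F i, y].
Proof. exact: linear_sumlz. Qed.

Lemma hdot_sumr H I (r : seq I) (P : pred I) (F : I -> H) (y : H) :
  '[y, \sum_(i <- r | P i) F i] = \sum_(i <- r | P i) '[y, F i].
Proof. exact: linear_sumr. Qed.

Lemma hdotC H (x y : H) : '[x, y] = Num.conj '[y, x].
Proof. by rewrite hermC expr0 mul1r. Qed.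

Lemma hdotxx H (x : H) : '[x, x] = (rnorm x ^+ 2)%:C.
Proof. by rewrite -hdot_norm rnormE -rmorphXn. Qed.

Definition rdot H (x y : H) : R := complex.Re '[x, y].

Lemma rdotC H (x y : H) : rdot x y = rdot y x.
Proof. by rewrite /rdot hdotC Re_conj. Qed.

Lemma rdotDl H (x y z : H) : rdot (x + y) z = rdot x z + rdot y z.
Proof. by rewrite /rdot hdotDl ReD. Qed.

Lemma rdotDr H (x y z : H) : rdot x (y + z) = rdot x y + rdot x z.
Proof. by rewrite /rdot hdotDr ReD. Qed.

Lemma rdotNl H (x y : H) : rdot (- x) y = - rdot x y.
Proof. by rewrite /rdot hdotNl ReN. Qed.

Lemma rdotNr H (x y : H) : rdot x (- y) = - rdot x y.
Proof. by rewrite /rdot hdotNr ReN. Qed.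

Lemma rdotZl H (c : R) (x y : H) : rdot (c%:C *: x) y = c * rdot x y.
Proof. by rewrite /rdot hdotZl ReMl. Qed.

Lemma rdotZr H (c : R) (x y : H) : rdot x (c%:C *: y) = c * rdot x y.
Proof. by rewrite rdotC rdotZl rdotC. Qed.

Lemma rdot0l H (x : H) : rdot 0 x = 0.
Proof. by rewrite /rdot hdot0l. Qed.

Lemma rdot0r H (x : H) : rdot x 0 = 0.
Proof. by rewrite /rdot hdot0r. Qed.

Lemma rdot_suml H I (r : seq I) (P : pred I) (F : I -> H) (y : H) :
  rdot (\sum_(i <- r | P i) F i) y = \sum_(i <- r | P i) rdot (F i) y.
Proof. by rewrite /rdot hdot_suml Re_sum. Qed.

Lemma rdot_sumr H I (r : seq I) (P : pred I) (F : I -> H) (y : H) :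
  rdot y (\sum_(i <- r | P i) F i) = \sum_(i <- r | P i) rdot y (F i).
Proof. by rewrite /rdot hdot_sumr Re_sum. Qed.

Lemma rdotxx H (x : H) : rdot x x = rnorm x ^+ 2.
Proof. by rewrite /rdot hdotxx. Qed.

Lemma rnormN H (x : H) : rnorm (- x) = rnorm x.
Proof. by rewrite /rnorm normrN. Qed.

Lemma rnormB H (x y : H) : rnorm (x - y) = rnorm (y - x).
Proof. by rewrite -opprB rnormN. Qed.

Lemma rnormZr H (c : R) (x : H) : rnorm (c%:C *: x) = `|c| * rnorm x.
Proof.
by rewrite rnormZ normc_def /= expr0n /= addr0 sqrtr_sqr.
Qed.

Lemma rnorm2D H (x y : H) :
  rnorm (x + y) ^+ 2 = rnorm x ^+ 2 + 2 * rdot x y + rnorm y ^+ 2.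
Proof. rewrite -!rdotxx rdotDl !rdotDr (rdotC y x); ring. Qed.

Lemma rnorm2B H (x y : H) :
  rnorm (x - y) ^+ 2 = rnorm x ^+ 2 - 2 * rdot x y + rnorm y ^+ 2.
Proof. rewrite rnorm2D rdotNr rnormN; ring. Qed.

Lemma rnorm2Z H (a : R[i]) (x : H) :
  rnorm (a *: x) ^+ 2 = complex.Re `|a| ^+ 2 * rnorm x ^+ 2.
Proof. by rewrite rnormZ exprMn. Qed.

Lemma rnorm_distD H (x y z : H) : rnorm (x - z) <= rnorm (x - y) + rnorm (y - z).
Proof. by rewrite (le_trans _ (rnormD _ _)) // addrA subrK. Qed.

Lemma rnorm_sum H I (r : seq I) (P : pred I) (F : I -> H) :
  rnorm (\sum_(i <- r | P i) F i) <= \sum_(i <- r | P i) rnorm (F i).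
Proof.
elim/big_ind2: _ => [|a b c d ab cd|//]; first by rewrite rnorm0.
by rewrite (le_trans (rnormD _ _)) // lerD.
Qed.

Lemma rnorm_gt0 H (x : H) : x != 0 -> 0 < rnorm x.
Proof.
move=> x0; rewrite lt_neqAle rnorm_ge0 andbT eq_sym.
by apply: contra x0 => /eqP /rnorm_eq0 ->.
Qed.

Lemma rdot_le H (x y : H) : rdot x y <= rnorm x * rnorm y.
Proof.
have := rnorm_ge0 ((rnorm y)%:C *: x - (rnorm x)%:C *: y).
have [/rnorm_eq0 ->|y0 _] := eqVneq (rnorm y) 0.
  by rewrite rdot0r rnorm0 mulr0.
have [/rnorm_eq0 ->|x0] := eqVneq (rnorm x) 0.
  by rewrite rdot0l rnorm0 mul0r.
have yp : 0 < rnorm y by rewrite lt_neqAle eq_sym y0 rnorm_ge0.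
have xp : 0 < rnorm x by rewrite lt_neqAle eq_sym x0 rnorm_ge0.
have := sqr_ge0 (rnorm ((rnorm y)%:C *: x - (rnorm x)%:C *: y)).
rewrite rnorm2B !rnormZr rdotZl rdotZr !ger0_norm ?rnorm_ge0 // => h.
have : 0 <= (rnorm x * rnorm y) * (rnorm x * rnorm y - rdot x y) by nra.
by rewrite pmulr_rge0 ?mulr_gt0 // subr_ge0.
Qed.

Lemma rdot_abs_le H (x y : H) : `|rdot x y| <= rnorm x * rnorm y.
Proof.
by rewrite ler_norml lerNl -rdotNl rdot_le -{1}(rnormN x) rdot_le.
Qed.

Lemma hdot_eq H (x y : H) : (forall z, '[z, x] = '[z, y]) -> x = y.
Proof.
move=> xy; apply/eqP; rewrite -subr_eq0; apply/eqP/rnorm_eq0/eqP.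
by rewrite -sqrf_eq0 -rdotxx /rdot hdotDr hdotNr xy subrr.
Qed.

Lemma Im_hdot H (x y : H) : complex.Im '[x, y] = rdot x ('i *: y).
Proof.
rewrite /rdot hdotZr; case: '[x, y] => a b.
by rewrite /= !mul0r mulN1r opprK add0r.
Qed.

(** Since Im <x, y> = Re <x, i y>, identities and limits only have to be proved for the real-valued
    form. *)
Lemma hdot_rdot H (x y : H) :
  '[x, y] = (rdot x y)%:C + 'i * (rdot x ('i *: y))%:C.
Proof.
rewrite -Im_hdot /rdot; case: '[x, y] => a b /=; apply/eqP.
by rewrite eq_complex /=; apply/andP; split; apply/eqP; ring.
Qed.

Lemma eq_rdot H K (x y : H) (x' y' : K) : rdot x y = rdot x' y' ->
  rdot x ('i *: y) = rdot x' ('i *: y') -> '[x, y] = '[x', y'].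
Proof. by move=> e1 e2; rewrite !hdot_rdot e1 e2. Qed.

End InnerProduct.

(** * Sequential limits; completeness of the space of bounded operators *)

Section Completeness.
Context {R : realType}.
Implicit Types G H K : hilbertType R.

(** Stated with real tolerances, because the norm of H takes its values in [R[i]]. *)
Definition tends H (u : nat -> H) (l : H) :=
  forall e : R, 0 < e -> exists N, forall n, (N <= n)%N -> rnorm (u n - l) <= e.

Definition rcauchy H (u : nat -> H) := forall e : R, 0 < e ->
  exists N, forall m n, (N <= m)%N -> (N <= n)%N -> rnorm (u m - u n) <= e.

Lemma gt0c_Re (e : R[i]) : 0 < e -> e = (complex.Re e)%:C /\ 0 < complex.Re e.
Proof.
case: e => a b; rewrite ltcE /= => /andP[/eqP b0 a0]; split => //.
by rewrite b0.
Qed.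

Lemma cauchy_tends H (u : nat -> H) : rcauchy u -> exists l, tends u l.
Proof.
move=> cu; suff /cvg_ex[l ul] : cvg (u @ \oo).
  exists l => e e0; have ec0 : 0 < e%:C :> R[i] by rewrite ltcR.
  have [N _ hN] := (cvgrPdist_le _ _).1 ul _ ec0.
  exists N => n Nn; have := hN n Nn.
  by rewrite /= rnormE lecR rnormB.
apply: cauchy_cvg; apply/cauchy_ballP => e /gt0c_Re [-> e0].
have [N hN] := cu _ (divr_gt0 e0 (ltr0n _ 2)).
exists (u @` [set n | (N <= n)%N], u @` [set n | (N <= n)%N]).
  by split; exists N => // n Nn; exists n.
move=> [_ _] [/= [m Nm <-] [n Nn <-]].
rewrite -ball_normE /ball_ /= rnormE ltcR.
by apply: le_lt_trans (hN _ _ Nm Nn) _; rewrite ltr_pdivrMr // ltr_pMr // ltr1n.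
Qed.

Lemma tends_unique H (u : nat -> H) l l' : tends u l -> tends u l' -> l = l'.
Proof.
move=> ul ul'; apply/eqP; rewrite -subr_eq0; apply/eqP/rnorm_eq0/eqP.
rewrite eq_le rnorm_ge0 andbT; apply/ler_addgt0Pl => e e0; rewrite addr0.
have e2 : 0 < e / 2 by rewrite divr_gt0.
have [[N hN] [N' hN']] := (ul _ e2, ul' _ e2).
rewrite (le_trans (rnorm_distD _ (u (maxn N N')) _)) //.
have := hN _ (leq_maxl N N'); have := hN' _ (leq_maxr N N').
by rewrite (rnormB l); lra.
Qed.

Lemma tendsD H (u v : nat -> H) l k : tends u l -> tends v k ->
  tends (fun n => u n + v n) (l + k).
Proof.
move=> ul vk e e0; have e2 : 0 < e / 2 by rewrite divr_gt0.
have [[N hN] [N' hN']] := (ul _ e2, vk _ e2).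
exists (maxn N N') => n; rewrite geq_max => /andP[Nn N'n].
rewrite opprD addrACA (le_trans (rnormD _ _)) //.
by have := hN _ Nn; have := hN' _ N'n; lra.
Qed.

Lemma tends_bound H K (u : nat -> H) l (v : nat -> K) k M :
  (forall n, rnorm (v n - k) <= M * rnorm (u n - l)) -> tends u l -> tends v k.
Proof.
move=> vu ul e e0; have M0 : 0 < `|M| + 1 by rewrite ltr_wpDl.
have [N hN] := ul _ (divr_gt0 e0 M0); exists N => n Nn.
rewrite (le_trans (vu n)) // (le_trans (y := (`|M| + 1) * rnorm (u n - l))) //.
  by rewrite ler_wpM2r ?rnorm_ge0 // (le_trans (ler_norm _)) // lerDl.
by rewrite mulrC -ler_pdivlMr // hN.
Qed.

Lemma tendsZ H (a : R[i]) (u : nat -> H) l : tends u l ->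
  tends (fun n => a *: u n) (a *: l).
Proof.
by apply: tends_bound (complex.Re `|a|) _ => n; rewrite -scalerBr rnormZ.
Qed.

Lemma tends_cst H (l : H) : tends (fun _ => l) l.
Proof. by move=> e e0; exists 0%N => n _; rewrite subrr rnorm0 ltW. Qed.

Lemma tends_le H (u : nat -> H) l M : tends u l ->
  (exists N, forall n, (N <= n)%N -> rnorm (u n) <= M) -> rnorm l <= M.
Proof.
move=> ul [N' uM]; apply/ler_addgt0Pl => e e0; have [N hN] := ul _ e0.
have := hN _ (leq_maxl N N'); have := uM _ (leq_maxr N N').
have := rnormD (u (maxn N N')) (l - u (maxn N N')).
by rewrite addrCA subrr addr0 (rnormB l); lra.
Qed.

Lemma tends_harmonic H (u : nat -> H) l :
  (forall n, rnorm (u n - l) <= n.+1%:R^-1) -> tends u l.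
Proof.
move=> ul e e0.
have [n hn] : exists n, (n.+1%:R^-1 : R) < e.
  exists (Num.truncn e^-1); rewrite -[ltRHS]invrK ltf_pV2 ?posrE ?invr_gt0 //.
  exact: truncnS_gt.
exists n => m nm; rewrite (le_trans (ul m)) // (le_trans _ (ltW hn)) //.
by rewrite lef_pV2 ?posrE // ler_nat.
Qed.

Lemma harmonic_lt (e : R) : 0 < e -> exists n, (n.+1%:R^-1 : R) < e.
Proof.
move=> e0; exists (Num.truncn e^-1).
rewrite -[ltRHS]invrK ltf_pV2 ?posrE ?invr_gt0 //; exact: truncnS_gt.
Qed.

Lemma bopD_apply H K (S T : bop H K) x : (S + T) x = S x + T x. Proof. by []. Qed.
Lemma bopZ_apply H K a (T : bop H K) x : (a *: T) x = a *: T x. Proof. by []. Qed.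
Lemma bopN_apply H K (T : bop H K) x : (- T) x = - T x.
Proof. by rewrite -[RHS]scaleN1r. Qed.
Lemma bopB_apply H K (S T : bop H K) x : (S - T) x = S x - T x.
Proof. by rewrite bopD_apply bopN_apply. Qed.
Lemma bop_sum_apply H K I (r : seq I) (P : pred I) (F : I -> bop H K) x :
  (\sum_(i <- r | P i) F i) x = \sum_(i <- r | P i) F i x.
Proof. by elim/big_rec2: _ => // i y T _ <-. Qed.

Lemma bcompE G H K (S : bop H K) (T : bop G H) x : (S *B T) x = S (T x).
Proof. by []. Qed.
Lemma bidE H (x : H) : bid H x = x. Proof. by []. Qed.
Lemma bop_add H K (T : bop H K) x y : T (x + y) = T x + T y.
Proof. exact: linearD. Qed.
Lemma bop_sub H K (T : bop H K) x y : T (x - y) = T x - T y.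
Proof. exact: linearB. Qed.
Lemma bop_scale H K (T : bop H K) a x : T (a *: x) = a *: T x.
Proof. exact: linearZ. Qed.
Lemma bop_zero H K (T : bop H K) : T 0 = 0.
Proof. exact: linear0. Qed.
Lemma bop_sum H K (T : bop H K) I (r : seq I) (P : pred I) (F : I -> H) :
  T (\sum_(i <- r | P i) F i) = \sum_(i <- r | P i) T (F i).
Proof. exact: linear_sum. Qed.

Lemma opnorm_tri H K (S T : bop H K) : opnorm (S + T) <= opnorm S + opnorm T.
Proof. by rewrite -lecR rmorphD; exact: bop_normD. Qed.

Lemma opnorm0 H K : opnorm (0 : bop H K) = 0.
Proof.
apply/eqP; rewrite eq_le opnorm_ge0 andbT opnorm_le // => x.
by rewrite rnorm0 mul0r.
Qed.

Lemma opnorm_sum H K I (r : seq I) (P : pred I) (F : I -> bop H K) :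
  opnorm (\sum_(i <- r | P i) F i) <= \sum_(i <- r | P i) opnorm (F i).
Proof.
elim/big_ind2: _ => [|a b c d ab cd|//]; first by rewrite opnorm0.
by rewrite (le_trans (opnorm_tri _ _)) // lerD.
Qed.

Lemma opnormN H K (T : bop H K) : opnorm (- T) = opnorm T.
Proof.
by have := bop_normZ (-1) T; rewrite normrN1 mul1r scaleN1r => -[].
Qed.

Definition op_tends H K (u : nat -> bop H K) (T : bop H K) :=
  forall e : R, 0 < e -> exists N, forall n, (N <= n)%N -> opnorm (u n - T) <= e.

Lemma op_tends_lim H K (u : nat -> bop H K) T : op_tends u T -> limn u = T.
Proof.
move=> uT; apply: (cvg_lim (@norm_hausdorff _ (bop H K))).
apply/cvgrPdist_le => e /gt0c_Re [-> e0].
have [N hN] := uT _ e0; exists N => // n /= Nn.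
suff -> : `|T - u n| = (opnorm (u n - T))%:C by rewrite lecR hN.
by rewrite -opnormN opprB.
Qed.

(** The pointwise limit is linear, and the Cauchy estimate passes to it with a bound proportional to
    |x|, which gives convergence in operator norm. *)
Lemma bop_cauchy H K (u : nat -> bop H K) :
  (forall e : R, 0 < e -> exists N, forall m n, (N <= m)%N -> (N <= n)%N ->
     opnorm (u m - u n) <= e) -> exists T, op_tends u T.
Proof.
move=> cu.
have cux x : rcauchy (fun n => u n x).
  move=> e e0; have x1 : 0 < rnorm x + 1 by rewrite ltr_wpDl ?rnorm_ge0.
  have [N hN] := cu _ (divr_gt0 e0 x1); exists N => m n Nm Nn.
  rewrite -bopB_apply (le_trans (opnormP _ _)) //.
  rewrite (le_trans (ler_wpM2r (rnorm_ge0 _) (hN _ _ Nm Nn))) //.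
  by rewrite mulrAC ler_pdivrMr // ler_wpM2l // ?lerDl // ltW.
have /choice[f fP] : forall x, exists l, tends (fun n => u n x) l.
  by move=> x; exact: cauchy_tends.
have flin : linear f.
  move=> a x y; apply: tends_unique (fP _) _.
  have := tendsD (tendsZ a (fP x)) (fP y).
  by congr (tends _ _); apply: funext => n; rewrite linearP.
have fbd N e : (forall m n, (N <= m)%N -> (N <= n)%N -> opnorm (u m - u n) <= e) ->
    forall n, (N <= n)%N -> forall x, rnorm (u n x - f x) <= e * rnorm x.
  move=> hN n Nn x; rewrite rnormB.
  apply: (@tends_le _ (fun m => u m x - u n x)).
    by apply: tendsD (fP x) (tends_cst _).
  exists N => m Nm; rewrite -bopB_apply (le_trans (opnormP _ _)) //.
  by rewrite ler_wpM2r ?rnorm_ge0 // hN.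
have fb : exists M : R, forall x, rnorm (f x) <= M * rnorm x.
  have [N hN] := cu 1 ltr01; exists (1 + opnorm (u N)) => x.
  have := fbd _ _ hN _ (leqnn N) x; have := opnormP (u N) x.
  have := rnormD (u N x) (f x - u N x).
  by rewrite addrCA subrr addr0 (rnormB (f x)); lra.
exists (Bop flin fb) => e e0; have [N hN] := cu _ e0; exists N => n Nn.
apply: opnorm_le; first exact: ltW.
by move=> x; rewrite bopB_apply /=; apply: fbd hN _ Nn _.
Qed.

End Completeness.

(** * Riesz representation, adjoints and extension by density *)

Section RieszAdjoint.
Context {R : realType}.
Implicit Types G H K : hilbertType R.

(** The representing vector is the minimizer of J(x) = |x|^2 - 2 f(x), which is bounded below
    because f is bounded. The parallelogram identity makes minimizing sequences Cauchy. *)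
Lemma riesz_real H (f : H -> R) (M : R) :
  {morph f : x y / x + y} -> (forall (c : R) x, f (c%:C *: x) = c * f x) ->
  (forall x, `|f x| <= M * rnorm x) -> exists y, forall x, f x = rdot x y.
Proof.
move=> fD fZ fM; pose J x := rnorm x ^+ 2 - 2 * f x.
have J_lb x : - M ^+ 2 <= J x.
  rewrite /J; have := fM x; rewrite ler_norml => /andP[_ fMx].
  have := sqr_ge0 (rnorm x - M); rewrite sqrrB; lra.
have hJ : has_inf (range J).
  by split; [exists (J 0), 0 | exists (- M ^+ 2) => _ [x _ <-]].
pose m := inf (range J).
have mJ x : m <= J x by apply: ge_inf; [case: hJ | exists x].
have /choice[u uP] : forall n : nat, exists x, J x <= m + n.+1%:R^-1.
  move=> n; have e0 : (0 : R) < n.+1%:R^-1 by rewrite invr_gt0.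
  by have [_ [x _ <-] xm] := inf_adherent e0 hJ; exists x; exact: ltW.
have Jpar x y : rnorm (x - y) ^+ 2 = 2 * (J x + J y - 2 * J ((2^-1)%:C *: (x + y))).
  rewrite /J fZ fD rnormZr ger0_norm ?invr_ge0 ?ler0n // exprMn.
  by rewrite rnorm2B rnorm2D; field.
have cu : rcauchy u.
  move=> e e0.
  have e4 : 0 < e ^+ 2 / 4 by rewrite divr_gt0 // exprn_gt0.
  have [N hN] := harmonic_lt e4; exists N => p q Np Nq.
  have inv_le k : (N <= k)%N -> (k.+1%:R^-1 : R) <= e ^+ 2 / 4.
    move=> Nk; apply: le_trans (ltW hN).
    by rewrite lef_pV2 ?posrE ?ltr0n // ler_nat.
  rewrite -ler_sqr ?nnegrE ?rnorm_ge0 ?(ltW e0) // Jpar.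
  have := mJ ((2^-1)%:C *: (u p + u q)).
  have := uP p; have := uP q; have := inv_le _ Np; have := inv_le _ Nq.
  move: (q.+1%:R^-1) (p.+1%:R^-1) => a b; lra.
have [y uy] := cauchy_tends cu; exists y => x.
pose q := rnorm x ^+ 2 + 1; pose d := rdot y x - f x.
have q0 : 0 < q by rewrite ltr_wpDl ?sqr_ge0.
suff : d = 0 by rewrite rdotC => /eqP; rewrite subr_eq0 => /eqP.
apply/eqP; apply: contraT => d0.
have d2 : 0 < d ^+ 2 by rewrite exprn_even_gt0.
(* Moving a near-minimizer by t x changes J by about t^2 |x|^2 + 2 t d. This t makes the change at
   most - d^2 / q, while the two errors, from near-minimality and from replacing y by u n, are at
   most a quarter of d^2 / q each. *)
pose t : R := - d / q.
have tq : t ^+ 2 * rnorm x ^+ 2 + 2 * t * d <= - d ^+ 2 / q.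
  have -> : t ^+ 2 * rnorm x ^+ 2 + 2 * t * d =
            - d ^+ 2 / q - d ^+ 2 / q * ((q - rnorm x ^+ 2) / q).
    by rewrite /t; field; rewrite gt_eqF.
  rewrite lerBlDr lerDl mulr_ge0 ?divr_ge0 ?ltW //.
  by rewrite /q addrAC subrr add0r.
have eps0 : 0 < d ^+ 2 / q / 4 by rewrite !divr_gt0.
have eps1 : 0 < d ^+ 2 / q / 4 / (2 * `|t| * rnorm x + 1).
  by rewrite divr_gt0 // ltr_wpDl // !mulr_ge0 // rnorm_ge0.
have [N1 hN1] := harmonic_lt eps0.
have [N2 hN2] := uy _ eps1.
pose n := maxn N1 N2.
have un := hN2 n (leq_maxr _ _).
have inv_le : (n.+1%:R^-1 : R) <= d ^+ 2 / q / 4.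
  apply: le_trans (ltW hN1).
  by rewrite lef_pV2 ?posrE ?ltr0n // ler_nat ltnS leq_maxl.
have := mJ (u n + t%:C *: x); have := uP n.
rewrite /J fD fZ rnorm2D rdotZr rnormZr exprMn real_normK ?num_real // => h1 h2.
have h3 : `|2 * t * rdot (u n - y) x| <= d ^+ 2 / q / 4.
  rewrite (normrM _ (rdot _ _)) (normrM 2 t) (ger0_norm (ler0n _ _)).
  have p0 : 0 < 2 * `|t| * rnorm x + 1.
    by rewrite ltr_wpDl // !mulr_ge0 // rnorm_ge0.
  move: un; rewrite ler_pdivlMr // => un; apply: le_trans un.
  have := ler_wpM2l (normr_ge0 t) (rdot_abs_le (u n - y) x).
  by have := rnorm_ge0 (u n - y); clear; lra.
move: h3; rewrite ler_norml rdotDl rdotNl => /andP[h3 h4].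
have td : t * d = t * rdot y x - t * f x by rewrite mulrBr.
move: tq; rewrite mulNr -mulrA td.
move: (d ^+ 2 / q) (n.+1%:R^-1) (t ^+ 2 * _) eps0 inv_le h1 h2 h3 h4.
move: (rnorm (u n) ^+ 2) (f (u n)) (rdot (u n) x) (rdot y x) (f x) => a b c g h.
by clear; move: t => t' e i w; lra.
Qed.

(** Riesz is applied to x |-> Re <T x, y>; the imaginary part follows by moving the factor i to the
    other argument. *)
Lemma adj_exists H K (T : bop H K) :
  exists S : bop K H, forall x y, '[T x, y] = '[x, S y].
Proof.
have /choice[f fP] : forall y, exists z, forall x, rdot (T x) y = rdot x z.
  move=> y; apply: (@riesz_real _ _ (opnorm T * rnorm y)) => [x z|c x|x].
  - by rewrite linearD rdotDl.
  - by rewrite linearZ rdotZl.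
  - by rewrite (le_trans (rdot_abs_le _ _)) // mulrAC ler_wpM2r ?rnorm_ge0 // opnormP.
have iZ (L : hilbertType R) (x y : L) : rdot x ('i *: y) = rdot (- 'i *: x) y.
  rewrite /rdot hdotZr hdotZl; congr (complex.Re (_ * _)).
  by apply/eqP; rewrite eq_complex /= oppr0 !eqxx.
have fE x y : '[T x, y] = '[x, f y].
  by apply: eq_rdot; [exact: fP|rewrite !iZ -fP linearZ].
have flin : linear f.
  move=> a x y; apply: hdot_eq => z.
  by rewrite hdotDr hdotZr -!fE hdotDr hdotZr.
have fbd : exists M : R, forall x, rnorm (f x) <= M * rnorm x.
  exists (opnorm T) => y.
  have [/eqP|fy] := boolP (rnorm (f y) == 0).
    by move=> ->; rewrite mulr_ge0 ?opnorm_ge0 ?rnorm_ge0.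
  rewrite -(@ler_pM2l _ (rnorm (f y))); last first.
    by rewrite lt_neqAle eq_sym fy rnorm_ge0.
  rewrite -expr2 -rdotxx -fP (le_trans (rdot_le _ _)) //.
  by rewrite mulrA ler_wpM2r ?rnorm_ge0 // mulrC opnormP.
by exists (Bop flin fbd) => x y; exact: fE.
Qed.

Lemma adjP H K (T : bop H K) x y : '[T x, y] = '[x, adj T y].
Proof.
rewrite /adj; have [S SP] := adj_exists T.
apply: (@xgetPex _ (0 : bop K H)
  [set S : bop K H | forall x y, '[T x, y] = '[x, S y]]).
by exists S.
Qed.

Lemma adjPr H K (T : bop H K) x y : '[adj T x, y] = '[x, T y].
Proof. by rewrite hdotC -adjP -hdotC. Qed.

Lemma adj_eq H K (T : bop H K) (S : bop K H) :
  (forall x y, '[T x, y] = '[x, S y]) -> adj T = S.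
Proof.
by move=> TS; apply: bopP => y; apply: hdot_eq => x; rewrite -adjP TS.
Qed.

Lemma rdot_adj H K (T : bop H K) x y : rdot (T x) y = rdot x (adj T y).
Proof. by rewrite /rdot adjP. Qed.

(** [Gr] is a linear relation rather than a map, because it will be given by finite sums with many
    representations. The bound makes it single-valued, and completeness of K extends it to the
    closure of its domain. Both the ampliations 1 (x) T and the operator L between dilations arise
    in this way. *)
Lemma extension_by_density H K (Gr : H -> K -> Prop) (M : R) :
  0 <= M ->
  (forall a x y x' y', Gr x y -> Gr x' y' -> Gr (a *: x + x') (a *: y + y')) ->
  (forall x y, Gr x y -> rnorm y <= M * rnorm x) ->
  closure [set x | exists y, Gr x y] = setT ->
  exists T : bop H K, (forall x y, Gr x y -> T x = y) /\ opnorm T <= M.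
Proof.
move=> M0 Glin Gbd Gdense.
have GB x y x' y' : Gr x y -> Gr x' y' -> rnorm (y' - y) <= M * rnorm (x' - x).
  move=> xy xy'; apply: Gbd.
  by have := Glin (-1) _ _ _ _ xy xy'; rewrite !scaleN1r addrC [- y + _]addrC.
have app x n : exists p : H * K, Gr p.1 p.2 /\ rnorm (p.1 - x) <= n.+1%:R^-1.
  have : closure [set x | exists y, Gr x y] x by rewrite Gdense.
  move=> /(_ (ball x (n.+1%:R^-1)%:C)) [].
    by apply: nbhsx_ballx; rewrite ltcR invr_gt0.
  move=> z [[y zy]]; rewrite -ball_normE /ball_ /= rnormE ltcR => xz.
  by exists (z, y); split => //=; rewrite rnormB ltW.
have inv_le (e : R) N n : (N.+1%:R^-1 : R) < e -> (N <= n)%N -> (n.+1%:R^-1 : R) <= e.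
  move=> hN Nn; apply: le_trans (ltW hN).
  by rewrite lef_pV2 ?posrE ?ltr0n // ler_nat.
pose R_ x y := exists p : nat -> H * K, [/\ forall n, Gr (p n).1 (p n).2,
  forall n, rnorm ((p n).1 - x) <= n.+1%:R^-1 & tends (fun n => (p n).2) y].
have /choice[f fP] : forall x, exists y, R_ x y.
  move=> x; have /choice[p pP] := app x.
  have [|y py] := @cauchy_tends _ _ (fun n => (p n).2); last first.
    by exists y, p; split => // n; case: (pP n).
  move=> e e0; have M1 : 0 < 2 * (M + 1) by rewrite mulr_gt0 // ltr_wpDl.
  have [N hN] := harmonic_lt (divr_gt0 e0 M1); exists N => m n Nm Nn.
  rewrite (le_trans (GB _ _ _ _ (pP n).1 (pP m).1)) //.
  have := rnorm_distD (p m).1 x (p n).1; rewrite (rnormB x).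
  have := (pP n).2; have := (pP m).2.
  have := inv_le _ _ _ hN Nn; have := inv_le _ _ _ hN Nm.
  have e1 : e = (e / (2 * (M + 1))) * (2 * (M + 1)) by rewrite divfK // gt_eqF.
  move: (e / _) e1 => e' -> i1 i2 i3 i4 i5.
  have e'0 : 0 <= e' by apply: le_trans i1; rewrite invr_ge0.
  have : rnorm ((p m).1 - (p n).1) <= 2 * e'.
    have := le_trans i3 i1; have := le_trans i4 i2; clear -i5; lra.
  move: (rnorm _) (rnorm_ge0 ((p m).1 - (p n).1)) => r r0 r2.
  have : M * r <= M * (2 * e') by rewrite ler_wpM2l.
  lra.
have R_bd x y : R_ x y -> rnorm y <= M * rnorm x.
  move=> [p [pG px py]]; apply/ler_addgt0Pl => e e0.
  have M1 : 0 < M + 1 by rewrite ltr_wpDl.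
  have [N hN] := harmonic_lt (divr_gt0 e0 M1).
  apply: (tends_le py); exists N => n Nn; rewrite (le_trans (Gbd _ _ (pG n))) //.
  have := rnormD x ((p n).1 - x); rewrite addrCA subrr addr0.
  have := px n; have := inv_le _ _ _ hN Nn.
  have e1 : e = (e / (M + 1)) * (M + 1) by rewrite divfK // gt_eqF.
  move: (e / _) e1 => e' -> i1 i2 i3.
  have e'0 : 0 <= e' by apply: le_trans i1; rewrite invr_ge0.
  have : rnorm (p n).1 <= rnorm x + e'.
    have := le_trans i2 i1; clear -i3; lra.
  move=> /(ler_wpM2l M0); lra.
have R_lin a x y x' y' : R_ x y -> R_ x' y' ->
    exists p : nat -> H * K, [/\ forall n, Gr (p n).1 (p n).2,
      tends (fun n => (p n).1) (a *: x + x') &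
      tends (fun n => (p n).2) (a *: y + y')].
  move=> [p [pG px py]] [q [qG qx qy]].
  exists (fun n => (a *: (p n).1 + (q n).1, a *: (p n).2 + (q n).2)).
  split=> [n||] /=; first exact: Glin.
    by apply: tendsD => //; [apply: tendsZ|]; exact: tends_harmonic.
  by apply: tendsD => //; apply: tendsZ.
have G_uniq x y y' (p q : nat -> H * K) : (forall n, Gr (p n).1 (p n).2) ->
    (forall n, Gr (q n).1 (q n).2) ->
    tends (fun n => (p n).1) x -> tends (fun n => (q n).1) x ->
    tends (fun n => (p n).2) y -> tends (fun n => (q n).2) y' -> y = y'.
  move=> pG qG px qx py qy; apply/eqP; rewrite -subr_eq0; apply/eqP.
  have t2 := tendsD py (tendsZ (-1) qy); rewrite scaleN1r in t2.
  apply: tends_unique t2 _.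
  have t1 := tendsD px (tendsZ (-1) qx); rewrite scaleN1r subrr in t1.
  apply: (tends_bound (M := M) _ t1) => n; rewrite !subr0 !scaleN1r.
  exact: GB.
have fT x : exists p : nat -> H * K, [/\ forall n, Gr (p n).1 (p n).2,
    tends (fun n => (p n).1) x & tends (fun n => (p n).2) (f x)].
  by have [p [pG px py]] := fP x; exists p; split => //; exact: tends_harmonic.
have flin : linear f.
  move=> a x y; have [p [pG px py]] := fT (a *: x + y).
  have [q [qG qx qy]] := R_lin a _ _ _ _ (fP x) (fP y).
  exact: (G_uniq _ _ _ _ _ pG qG px qx py qy).
have fbd : exists M : R, forall x, rnorm (f x) <= M * rnorm x.
  by exists M => x; apply: R_bd.
exists (Bop flin fbd); split; last by apply: opnorm_le => // x; exact: R_bd.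
move=> x y xy /=; have [p [pG px py]] := fT x.
by apply: (G_uniq x _ _ p (fun=> (x, y))) => //=; exact: tends_cst.
Qed.

Lemma lin_span_sub H (A D : set H) : D 0 ->
  (forall a x y, D x -> D y -> D (a *: x + y)) -> A `<=` D -> lin_span A `<=` D.
Proof.
move=> D0 Dlin AD _ [N [c [v [Av ->]]]].
elim/big_ind: _ => // [x y Dx Dy|i _]; first by rewrite -[x]scale1r; exact: Dlin.
by rewrite -[_ *: _]addr0; apply: Dlin => //; exact: AD.
Qed.

Lemma dense_span_sub H (A D : set H) : dense_span A -> D 0 ->
  (forall a x y, D x -> D y -> D (a *: x + y)) -> A `<=` D -> closure D = setT.
Proof.
move=> dA D0 Dlin AD; apply/seteqP; split => // x _.
have : closure (lin_span A) x by rewrite dA.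
by apply: closure_subset; exact: lin_span_sub.
Qed.

End RieszAdjoint.

(** * The Hilbert space l^2(N; G) of square summable sequences *)

Section RealSeries.
Context {R : realType}.

Lemma nonneg_series_cvg (u : nat -> R) M : (forall k, 0 <= u k) ->
  (forall N, \sum_(0 <= k < N) u k <= M) -> cvgn (series u).
Proof.
move=> u0 uM; apply: nondecreasing_is_cvgn.
  by apply/nondecreasing_seqP => n; rewrite !seriesEnat /= big_nat_recr //= lerDl.
by exists M => _ [n _ <-]; rewrite seriesEnat /=.
Qed.

Lemma series_ge_partial (u : nat -> R) N : (forall k, 0 <= u k) ->
  cvgn (series u) -> \sum_(0 <= k < N) u k <= limn (series u).
Proof.
move=> u0 cu; have := @nondecreasing_cvgn_le R (series u).
rewrite {3}/series /=; apply=> //.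
by apply/nondecreasing_seqP => n; rewrite !seriesEnat /= big_nat_recr //= lerDl.
Qed.

Lemma series_lim_le (u : nat -> R) M : cvgn (series u) ->
  (forall N, \sum_(0 <= k < N) u k <= M) -> limn (series u) <= M.
Proof.
move=> cu uM; apply: limr_le => //.
by near=> n; rewrite seriesEnat /=.
Unshelve. all: by end_near. Qed.

Lemma limn_series (u : nat -> R) l : series u @ \oo --> l -> limn (series u) = l.
Proof. exact: (cvg_lim (@norm_hausdorff _ R)). Qed.

End RealSeries.

Section SquareSummable.
Context {R : realType} (G : hilbertType R).

Record l2 := L2 { l2_fun :> nat -> G;
  l2_summable : exists M : R, forall N, \sum_(0 <= k < N) rnorm (l2_fun k) ^+ 2 <= M }.

Lemma l2P (x y : l2) : (forall k, x k = y k) -> x = y.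
Proof.
case: x => f fb; case: y => g gb /= fg.
have {}fg : f = g by exact: funext.
by subst g; congr L2; exact: Prop_irrelevance.
Qed.

Lemma l2_cvg (x : l2) : cvgn (series (fun k => rnorm (x k) ^+ 2)).
Proof.
by have [M xM] := l2_summable x; apply: nonneg_series_cvg xM => k; exact: sqr_ge0.
Qed.

Lemma l2_summable_le (f : nat -> G) (x y : l2) (a b : R) :
  0 <= a -> 0 <= b ->
  (forall k, rnorm (f k) ^+ 2 <= a * rnorm (x k) ^+ 2 + b * rnorm (y k) ^+ 2) ->
  exists M : R, forall N, \sum_(0 <= k < N) rnorm (f k) ^+ 2 <= M.
Proof.
move=> a0 b0 fxy.
have [[M xM] [N yN]] := (l2_summable x, l2_summable y).
exists (a * M + b * N) => n.
rewrite (le_trans (ler_sum _ (fun k _ => fxy k))) // big_split /= -!mulr_sumr.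
by rewrite lerD // ler_wpM2l.
Qed.

Lemma l2_0_subproof : exists M : R, forall N, \sum_(0 <= k < N) rnorm (0 : G) ^+ 2 <= M.
Proof. by exists 0 => N; rewrite big1 // => k _; rewrite rnorm0 expr0n. Qed.

Definition l2_0 := L2 l2_0_subproof.

Lemma l2_add_subproof (x y : l2) :
  exists M : R, forall N, \sum_(0 <= k < N) rnorm (x k + y k) ^+ 2 <= M.
Proof.
apply: (@l2_summable_le _ x y 2 2) => // k.
have := sqr_ge0 (rnorm (x k - y k)); rewrite rnorm2B rnorm2D; lra.
Qed.

Definition l2_add x y := L2 (l2_add_subproof x y).

Lemma l2_scale_subproof (a : R[i]) (x : l2) :
  exists M : R, forall N, \sum_(0 <= k < N) rnorm (a *: x k) ^+ 2 <= M.
Proof.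
apply: (@l2_summable_le _ x l2_0 (complex.Re `|a| ^+ 2) 0) => // [|k].
  exact: sqr_ge0.
by rewrite rnorm2Z mul0r addr0.
Qed.

Definition l2_scale a x := L2 (l2_scale_subproof a x).

HB.instance Definition _ := gen_eqMixin l2.
HB.instance Definition _ := gen_choiceMixin l2.

Lemma l2_addA : associative l2_add.
Proof. by move=> x y z; apply: l2P => k /=; rewrite addrA. Qed.

Lemma l2_addC : commutative l2_add.
Proof. by move=> x y; apply: l2P => k /=; rewrite addrC. Qed.

Lemma l2_add0 : left_id l2_0 l2_add.
Proof. by move=> x; apply: l2P => k /=; rewrite add0r. Qed.

Lemma l2_addN : left_inverse l2_0 (l2_scale (-1)) l2_add.
Proof. by move=> x; apply: l2P => k /=; rewrite scaleN1r addNr. Qed.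

HB.instance Definition _ :=
  GRing.isZmodule.Build l2 l2_addA l2_addC l2_add0 l2_addN.

Lemma l2_scaleA a b x : l2_scale a (l2_scale b x) = l2_scale (a * b) x.
Proof. by apply: l2P => k /=; rewrite scalerA. Qed.

Lemma l2_scale1 : left_id 1 l2_scale.
Proof. by move=> x; apply: l2P => k /=; rewrite scale1r. Qed.

Lemma l2_scaleDr : right_distributive l2_scale +%R.
Proof. by move=> a x y; apply: l2P => k /=; rewrite scalerDr. Qed.

Lemma l2_scaleDl x : {morph l2_scale^~ x : a b / a + b}.
Proof. by move=> a b; apply: l2P => k /=; rewrite scalerDl. Qed.

HB.instance Definition _ := GRing.Zmodule_isLmodule.Build R[i] l2
  l2_scaleA l2_scale1 l2_scaleDr l2_scaleDl.

Lemma l2D (x y : l2) k : (x + y) k = x k + y k. Proof. by []. Qed.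
Lemma l2Z a (x : l2) k : (a *: x) k = a *: x k. Proof. by []. Qed.
Lemma l20 k : (0 : l2) k = 0. Proof. by []. Qed.
Lemma l2N (x : l2) k : (- x) k = - x k. Proof. by rewrite -[RHS]scaleN1r. Qed.
Lemma l2B (x y : l2) k : (x - y) k = x k - y k. Proof. by rewrite l2D l2N. Qed.

Definition l2_rdot (x y : l2) : R := limn (series (fun k => rdot (x k) (y k))).

Lemma l2_rdot_cvg (x y : l2) :
  series (fun k => rdot (x k) (y k)) @ \oo --> l2_rdot x y.
Proof.
suff : cvgn (series (fun k => rdot (x k) (y k))) by [].
apply: normed_cvg; apply: (@series_le_cvg _ _
  (fun k => rnorm (x k) ^+ 2 + rnorm (y k) ^+ 2)) => [k|k|k|].
- exact: normr_ge0.
- by rewrite addr_ge0 ?sqr_ge0.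
- have := rdot_abs_le (x k) (y k); have := sqr_ge0 (rnorm (x k) - rnorm (y k)).
  have := rnorm_ge0 (x k); have := rnorm_ge0 (y k); rewrite sqrrB /=.
  move: `|_| (rnorm _) (rnorm _) => a b c b0 c0 h1 h2.
  have : 0 <= c * b by rewrite mulr_ge0.
  lra.
rewrite seriesD; apply: is_cvgD; exact: l2_cvg.
Qed.

Lemma l2_rdotDl (x y z : l2) : l2_rdot (x + y) z = l2_rdot x z + l2_rdot y z.
Proof.
apply: limn_series.
rewrite [X in series X](_ : _ = (fun k => rdot (x k) (z k)) \+
  (fun k => rdot (y k) (z k))).
  by rewrite seriesD; apply: cvgD; exact: l2_rdot_cvg.
by apply: funext => k; rewrite l2D rdotDl.
Qed.

Lemma l2_rdotC (x y : l2) : l2_rdot x y = l2_rdot y x.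
Proof.
by rewrite /l2_rdot; congr (limn (series _)); apply: funext => k; exact: rdotC.
Qed.

Lemma l2_rdotZl (c : R) (x y : l2) : l2_rdot (c%:C *: x) y = c * l2_rdot x y.
Proof.
apply: limn_series.
rewrite [X in series X](_ : _ = c *: (fun k => rdot (x k) (y k))).
  by rewrite seriesZ; apply: cvgZr; exact: l2_rdot_cvg.
by apply: funext => k; rewrite l2Z rdotZl.
Qed.

Lemma l2_rdotZZ (a : R[i]) (x y : l2) :
  l2_rdot (a *: x) (a *: y) = complex.Re `|a| ^+ 2 * l2_rdot x y.
Proof.
apply: limn_series.
rewrite [X in series X](_ : _ = (complex.Re `|a| ^+ 2) *: (fun k => rdot (x k) (y k))).
  by rewrite seriesZ; apply: cvgZr; exact: l2_rdot_cvg.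
apply: funext => k; rewrite !l2Z /rdot hdotZl hdotZr mulrA.
by rewrite normc2 ReMl.
Qed.

Lemma l2_rdot_ge0 (x : l2) : 0 <= l2_rdot x x.
Proof.
have := @series_ge_partial _ (fun k => rdot (x k) (x k)) 0.
rewrite big_geq //; apply; first by move=> k; rewrite rdotxx sqr_ge0.
exact: l2_rdot_cvg.
Qed.

Lemma l2_rdot_coord (x : l2) k : rnorm (x k) ^+ 2 <= l2_rdot x x.
Proof.
have := @series_ge_partial _ (fun k => rdot (x k) (x k)) k.+1.
move/(_ (fun k => _)); rewrite big_nat_recr //= rdotxx => h.
apply: le_trans (h _ _) => //; last exact: l2_rdot_cvg.
  by rewrite lerDr sumr_ge0 // => j _; rewrite rdotxx sqr_ge0.
by move=> j; rewrite rdotxx sqr_ge0.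
Qed.

Definition l2_norm (x : l2) : R := Num.sqrt (l2_rdot x x).

Lemma l2_norm2 (x : l2) : l2_norm x ^+ 2 = l2_rdot x x.
Proof. by rewrite sqr_sqrtr // l2_rdot_ge0. Qed.

Lemma l2_partial (x : l2) K :
  \sum_(0 <= k < K) rnorm (x k) ^+ 2 <= l2_norm x ^+ 2.
Proof.
rewrite l2_norm2; under eq_bigr do rewrite -rdotxx.
apply: (@series_ge_partial _ (fun k => rdot (x k) (x k))).
  by move=> k; rewrite rdotxx sqr_ge0.
exact: l2_rdot_cvg.
Qed.

Lemma l2_norm_eq0 (x : l2) : l2_norm x = 0 -> x = 0.
Proof.
move=> x0; apply: l2P => k; apply/rnorm_eq0/eqP; rewrite -sqrf_eq0.
by rewrite eq_le sqr_ge0 andbT (le_trans (l2_rdot_coord x k)) // -l2_norm2 x0 expr0n.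
Qed.

Lemma l2_rdotDr (x y z : l2) : l2_rdot x (y + z) = l2_rdot x y + l2_rdot x z.
Proof. by rewrite l2_rdotC l2_rdotDl !(l2_rdotC x). Qed.

Lemma l2_rdotZr (c : R) (x y : l2) : l2_rdot x (c%:C *: y) = c * l2_rdot x y.
Proof. by rewrite l2_rdotC l2_rdotZl l2_rdotC. Qed.

Lemma l2_rdot_le (x y : l2) : l2_rdot x y <= l2_norm x * l2_norm y.
Proof.
have l0 z : l2_rdot 0 z = 0.
  by have := l2_rdotZl 0 0 z; rewrite scaler0 mul0r.
have [/l2_norm_eq0 ->|y0] := eqVneq (l2_norm y) 0.
  by rewrite l2_rdotC l0 /l2_norm l0 sqrtr0 mulr0.
have [/l2_norm_eq0 ->|x0] := eqVneq (l2_norm x) 0.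
  by rewrite l0 /l2_norm l0 sqrtr0 mul0r.
have yp : 0 < l2_norm y by rewrite lt_neqAle eq_sym y0 sqrtr_ge0.
have xp : 0 < l2_norm x by rewrite lt_neqAle eq_sym x0 sqrtr_ge0.
have := l2_rdot_ge0 ((l2_norm y)%:C *: x + (- l2_norm x)%:C *: y).
rewrite l2_rdotDl !l2_rdotDr !l2_rdotZl !l2_rdotZr -!l2_norm2 (l2_rdotC y x) => h.
have : 0 <= (l2_norm x * l2_norm y) * (l2_norm x * l2_norm y - l2_rdot x y) by nra.
by rewrite pmulr_rge0 ?mulr_gt0 // subr_ge0.
Qed.

Lemma l2_norm_tri (x y : l2) : l2_norm (x + y) <= l2_norm x + l2_norm y.
Proof.
rewrite -ler_sqr ?nnegrE ?addr_ge0 ?sqrtr_ge0 // l2_norm2.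
rewrite l2_rdotDl !l2_rdotDr -!l2_norm2 (l2_rdotC y x).
have := l2_rdot_le x y; rewrite sqrrD; lra.
Qed.

Definition l2_normc (x : l2) : R[i] := (l2_norm x)%:C.

Lemma l2_normcD (x y : l2) : l2_normc (x + y) <= l2_normc x + l2_normc y.
Proof. by rewrite /l2_normc -rmorphD lecR l2_norm_tri. Qed.

Lemma l2_normcZ (a : R[i]) (x : l2) : l2_normc (a *: x) = `|a| * l2_normc x.
Proof.
rewrite /l2_normc normcRe -rmorphM /=; congr (_%:C).
rewrite /l2_norm l2_rdotZZ sqrtrM ?sqr_ge0 // sqrtr_sqr ger0_norm //.
by rewrite -ler0c -normcRe.
Qed.

Lemma l2_normc_eq0 (x : l2) : l2_normc x = 0 -> x = 0.
Proof. by case=> /l2_norm_eq0. Qed.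

HB.instance Definition _ := Lmodule_isNormed.Build R[i] l2
  l2_normcD l2_normcZ l2_normc_eq0.

End SquareSummable.

Lemma cvg_sum_nat (R : realType) (f : nat -> nat -> R) (l : nat -> R) K :
  (forall k, f k m @[m --> \oo] --> l k) ->
  (\sum_(0 <= k < K) f k m) @[m --> \oo] --> \sum_(0 <= k < K) l k.
Proof.
move=> fl; elim: K => [|K IH].
  by rewrite big_geq //; under eq_fun do rewrite big_geq //; exact: cvg_cst.
rewrite big_nat_recr //=; under eq_fun do rewrite big_nat_recr //=.
exact: cvgD.
Qed.

(** A Cauchy filter contains a ball of radius 1 / (n + 1) for each n; the centres form a Cauchy
    sequence, and its limit is a limit of the filter. *)
Lemma normed_seq_complete (R : realType) (V : normedModType R[i]) :
  (forall u : nat -> V, (forall e : R, 0 < e -> exists N, forall m n,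
      (N <= m)%N -> (N <= n)%N -> `|u m - u n| <= e%:C) ->
    exists l, forall e : R, 0 < e -> exists N, forall n,
      (N <= n)%N -> `|u n - l| <= e%:C) ->
  forall F : set_system V, ProperFilter F -> cauchy F -> cvg F.
Proof.
move=> seqc F FF /cauchyP Fc.
have inv_gt0 n : 0 < (n.+1%:R^-1 : R)%:C :> R[i] by rewrite ltcR invr_gt0.
have /choice[u uP] : forall n : nat, exists x, F (ball x (n.+1%:R^-1 : R)%:C).
  by move=> n; apply: Fc.
have inv_le (e : R) N n : (N.+1%:R^-1 : R) < e -> (N <= n)%N -> (n.+1%:R^-1 : R) <= e.
  move=> hN Nn; apply: le_trans (ltW hN).
  by rewrite lef_pV2 ?posrE ?ltr0n // ler_nat.
have [|l ul] := seqc u.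
  move=> e e0; have [N hN] := harmonic_lt (divr_gt0 e0 (ltr0n _ 2)).
  exists N => m n Nm Nn.
  have [y [ym yn]] := filter_ex (filterI (uP m) (uP n)).
  move: ym yn; rewrite -ball_normE /ball_ /= => ym yn.
  rewrite -(subrK y (u m)) -addrA (le_trans (ler_normD _ _)) //.
  rewrite (distrC y) [e in leRHS](_ : e = e / 2 + e / 2); last by field.
  rewrite rmorphD /= lerD //; [apply: le_trans (ltW ym) _|apply: le_trans (ltW yn) _];
    by rewrite lecR; apply: inv_le Nm || apply: inv_le Nn.
apply/cvg_ex; exists l; apply/cvgrPdist_le => e /gt0c_Re [-> e0].
have e2 : 0 < complex.Re e / 2 by rewrite divr_gt0.
have [[N hN] [N' hN']] := (harmonic_lt e2, ul _ e2).
apply: filterS (uP (maxn N N')) => y.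
rewrite -ball_normE /ball_ /= => uy.
rewrite -(subrK (u (maxn N N')) l) -addrA (le_trans (ler_normD _ _)) //.
rewrite (distrC l) [X in X%:C](_ : _ = complex.Re e / 2 + complex.Re e / 2); last by field.
rewrite rmorphD /= lerD //; first by rewrite hN' // leq_maxr.
by apply: le_trans (ltW uy) _; rewrite lecR; apply: inv_le hN (leq_maxl _ _).
Qed.

Section SquareSummableHilbert.
Context {R : realType} (G : hilbertType R).
Local Notation l2 := (l2 G).

(** The limit is taken coordinatewise. On each finite partial sum the Cauchy estimate passes to the
    limit, which yields at once the square summability of the limit and the convergence in norm. *)
Lemma l2_complete (F : set_system l2) : ProperFilter F -> cauchy F -> cvg F.
Proof.
apply: normed_seq_complete => u cu.
have normE (x : l2) : `|x| = (l2_norm x)%:C by [].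
have {}cu e : 0 < e -> exists N, forall m n,
    (N <= m)%N -> (N <= n)%N -> l2_norm (u m - u n) <= e.
  by move=> /cu[N hN]; exists N => m n Nm Nn; rewrite -lecR -normE hN.
have coord (x : l2) k : rnorm (x k) <= l2_norm x.
  by rewrite -ler_sqr ?nnegrE ?rnorm_ge0 ?sqrtr_ge0 // l2_norm2 l2_rdot_coord.
have /choice[f fP] : forall k, exists l, tends (fun n => u n k) l.
  move=> k; apply: cauchy_tends => e e0; have [N hN] := cu _ e0.
  by exists N => m n Nm Nn; rewrite -l2B (le_trans (coord _ _)) // hN.
have fin N e : (forall m n, (N <= m)%N -> (N <= n)%N -> l2_norm (u m - u n) <= e) ->
    forall n, (N <= n)%N -> forall K, \sum_(0 <= k < K) rnorm (u n k - f k) ^+ 2 <= e ^+ 2.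
  move=> hN n Nn K.
  have lim : (fun m => \sum_(0 <= k < K) rnorm (u n k - u m k) ^+ 2) @ \oo -->
       \sum_(0 <= k < K) rnorm (u n k - f k) ^+ 2.
    apply: cvg_sum_nat => k; rewrite expr2; under eq_fun do rewrite expr2.
    suff h : rnorm (u n k - u m k) @[m --> \oo] --> rnorm (u n k - f k).
      by apply: cvgM.
    apply/cvgrPdist_le => d d0; have [M hM] := fP k _ d0; exists M => // m /= Mm.
    apply: le_trans (hM _ Mm); rewrite ler_distl.
    have := rnorm_distD (u n k) (f k) (u m k).
    have := rnorm_distD (u n k) (u m k) (f k); rewrite (rnormB (f k)).
    by move=> h1 h2; apply/andP; split; lra.
  rewrite -(cvg_lim (@norm_hausdorff _ R) lim).
  apply: limr_le; first exact: (cvgP _ lim).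
  exists N => // m /= Nm.
  have -> : \sum_(0 <= k < K) rnorm (u n k - u m k) ^+ 2 =
            \sum_(0 <= k < K) rnorm ((u n - u m) k) ^+ 2.
    by apply: eq_bigr => k _; congr (rnorm _ ^+ 2); rewrite -l2B.
  apply: le_trans (l2_partial (u n - u m) K) _.
  rewrite ler_sqr ?nnegrE ?sqrtr_ge0 ?hN //.
  by apply: le_trans (hN n m Nn Nm); rewrite sqrtr_ge0.
have [N1 hN1] := cu 1 ltr01.
have fb : exists M : R, forall K, \sum_(0 <= k < K) rnorm (f k) ^+ 2 <= M.
  have [M uM] := l2_summable (u N1); exists (2 * M + 2 * 1 ^+ 2) => K.
  apply: (@le_trans _ _ (\sum_(0 <= k < K)
      (2 * rnorm (u N1 k) ^+ 2 + 2 * rnorm (u N1 k - f k) ^+ 2))).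
    apply: ler_sum => k _; rewrite rnorm2B.
    have := sqr_ge0 (rnorm (2%:C *: u N1 k - f k)).
    rewrite rnorm2B rnormZr rdotZl ger0_norm // exprMn; lra.
  rewrite big_split /= -!mulr_sumr lerD // ler_wpM2l //.
  exact: fin hN1 _ (leqnn _) _.
exists (L2 fb) => e e0; have [N hN] := cu _ e0; exists N => n Nn.
rewrite normE lecR -ler_sqr ?nnegrE ?sqrtr_ge0 ?(ltW e0) // l2_norm2.
apply: series_lim_le; first exact: l2_rdot_cvg.
move=> K; apply: le_trans (fin _ _ hN n Nn K).
by apply: ler_sum => k _; rewrite rdotxx l2B.
Qed.

HB.instance Definition _ := Uniform_isComplete.Build l2 l2_complete.

Definition l2_dot (x y : l2) : R[i] :=
  (l2_rdot x y)%:C + 'i * (l2_rdot x ('i *: y))%:C.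

Lemma l2_rdotNl (x y : l2) : l2_rdot (- x) y = - l2_rdot x y.
Proof.
by have := l2_rdotZl (-1) x y; rewrite mulN1r => <-; rewrite rmorphN1 scaleN1r.
Qed.

Lemma l2_rdot_iC (x y : l2) : l2_rdot ('i *: x) y = - l2_rdot x ('i *: y).
Proof.
rewrite -l2_rdotNl /l2_rdot; congr (limn (series _)); apply: funext => k.
rewrite l2N !l2Z /rdot hdotNl hdotZl hdotZr -mulNr; congr (complex.Re (_ * _)).
by apply/eqP; rewrite eq_complex /= ?opprK ?oppr0 !eqxx.
Qed.

Lemma l2_dotDl (z : l2) : {morph l2_dot^~ z : x y / x + y}.
Proof. by move=> x y; rewrite /l2_dot !l2_rdotDl !rmorphD /=; ring. Qed.

Lemma l2_dotC (x y : l2) : l2_dot x y = Num.conj (l2_dot y x).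
Proof.
rewrite /l2_dot l2_rdotC -[l2_rdot x ('i *: y)]opprK -l2_rdot_iC.
rewrite (l2_rdotC ('i *: x)); apply/eqP; rewrite eq_complex /=.
by apply/andP; split; apply/eqP; ring.
Qed.

Lemma l2_dotZl (a : R[i]) (x z : l2) : l2_dot (a *: x) z = a * l2_dot x z.
Proof.
case: a => a b.
have -> : a +i* b = a%:C + b%:C * 'i.
  by apply/eqP; rewrite eq_complex /=; apply/andP; split; apply/eqP; ring.
have ii (u : l2) : 'i *: ('i *: u) = - u.
  by rewrite scalerA -expr2 sqr_i scaleN1r.
have rN (u v : l2) : l2_rdot u (- v) = - l2_rdot u v.
  by rewrite l2_rdotC l2_rdotNl l2_rdotC.
rewrite /l2_dot scalerDl -scalerA !l2_rdotDl !l2_rdotZl !l2_rdot_iC ii rN.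
by apply/eqP; rewrite eq_complex /=; apply/andP; split; apply/eqP; ring.
Qed.

Lemma l2_dot_morphl (z : l2) : zmod_morphism (l2_dot^~ z).
Proof.
move=> x y; rewrite l2_dotDl; congr (_ + _).
by rewrite -scaleN1r l2_dotZl mulN1r.
Qed.

Lemma l2_dot_morphr (z : l2) : zmod_morphism (l2_dot z).
Proof.
move=> x y; rewrite l2_dotC (l2_dotC z x) (l2_dotC z y) -rmorphB.
by congr (Num.conj _); exact: l2_dot_morphl.
Qed.

Lemma l2_dot_scalel (z : l2) : scalable_for *%R (l2_dot^~ z).
Proof. by move=> a x; exact: l2_dotZl. Qed.

Lemma l2_dot_scaler (z : l2) :
  scalable_for (@Num.conj R[i] \; *%R) (l2_dot z).
Proof.
by move=> a x; rewrite /= l2_dotC l2_dotZl rmorphM /= -l2_dotC.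
Qed.

Lemma l2_dot_herm (x y : l2) : l2_dot x y = (-1) ^+ false * Num.conj (l2_dot y x).
Proof. by rewrite expr0 mul1r l2_dotC. Qed.

Lemma l2_dotxx (x : l2) : l2_dot x x = (l2_norm x ^+ 2)%:C.
Proof.
have h : l2_rdot x ('i *: x) = 0.
  have : l2_rdot x ('i *: x) = - l2_rdot x ('i *: x).
    by rewrite -l2_rdot_iC l2_rdotC.
  lra.
by rewrite /l2_dot h mulr0 addr0 l2_norm2.
Qed.

Lemma l2_dot_gt0 (x : l2) : x != 0 -> 0 < l2_dot x x.
Proof.
move=> x0; rewrite l2_dotxx ltcR exprn_gt0 // lt_neqAle sqrtr_ge0 andbT eq_sym.
by apply: contra x0 => /eqP /l2_norm_eq0 ->.
Qed.

HB.instance Definition _ := isBilinear.Build R[i] l2 l2 R[i] *%R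
  (@Num.conj R[i] \; *%R) l2_dot
  l2_dot_morphl l2_dot_morphr l2_dot_scalel l2_dot_scaler.

HB.instance Definition _ := isHermitianSesquilinear.Build R[i] l2 false
  (@Num.conj R[i]) l2_dot l2_dot_herm.

HB.instance Definition _ := isDotProduct.Build R[i] l2 l2_dot l2_dot_gt0.

Lemma l2_dot_norm (x : l2) : `|x| ^+ 2 = l2_dot x x.
Proof. by rewrite l2_dotxx rmorphXn. Qed.

HB.instance Definition _ := CompleteNormedModule_isHilbert.Build R l2 l2_dot_norm.

End SquareSummableHilbert.

(** * Row contractions, through the adjoints of their entries and through columns of vectors *)

Section RowContractions.
Context {R : realType}.
Implicit Types G H K : hilbertType R.

Lemma rdot_amgm H (x y : H) : 2 * rdot x y <= rnorm x ^+ 2 + rnorm y ^+ 2.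
Proof. by have := sqr_ge0 (rnorm (x - y)); rewrite rnorm2B; lra. Qed.

Lemma rdot_sum_adj k H (X : op_tuple k H) x :
  rdot ((\sum_i X i *B adj (X i)) x) x = \sum_i rnorm (adj (X i) x) ^+ 2.
Proof.
rewrite bop_sum_apply rdot_suml; apply: eq_bigr => i _.
by rewrite /= rdot_adj rdotxx.
Qed.

(** The sum is the quadratic form of \sum_i X_i X_i^*. To bound the norm by the form, take y the
    image of x: then 2 |y|^2 = 2 \sum_i Re <X_i^* x, X_i^* y>, which is at most |x|^2 + |y|^2. *)
Lemma closed_ball_adj k H (X : op_tuple k H) :
  closed_ball_op X <-> forall x, \sum_i rnorm (adj (X i) x) ^+ 2 <= rnorm x ^+ 2.
Proof.
rewrite /closed_ball_op /row_norm /=; split => [X1 x|Xx].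
  have {}X1 : opnorm (\sum_i X i *B adj (X i)) <= 1.
    by rewrite -(ler_sqrt _ ler01) sqrtr1.
  rewrite -rdot_sum_adj (le_trans (rdot_le _ _)) // expr2 ler_wpM2r ?rnorm_ge0 //.
  by rewrite (le_trans (opnormP _ _)) // ler_piMl ?rnorm_ge0.
rewrite -sqrtr1 ler_sqrt // opnorm_le // => x; rewrite mul1r.
rewrite -ler_sqr ?nnegrE ?rnorm_ge0 //; set y := _ x.
have : 2 * rdot y y <= \sum_i (rnorm (adj (X i) x) ^+ 2 + rnorm (adj (X i) y) ^+ 2).
  rewrite {1}/y bop_sum_apply rdot_suml mulr_sumr ler_sum // => i _.
  by rewrite /= rdot_adj rdot_amgm.
rewrite big_split /= rdotxx; have := Xx x; have := Xx y; lra.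
Qed.

Lemma closed_ball_opP k H (X : op_tuple k H) :
  closed_ball_op X <->
  forall v : 'I_k -> H, rnorm (\sum_i X i (v i)) ^+ 2 <= \sum_i rnorm (v i) ^+ 2.
Proof.
rewrite closed_ball_adj; split => [Xx v|Xv x].
  set y := \sum_i _.
  have : 2 * rdot y y <= \sum_i (rnorm (v i) ^+ 2 + rnorm (adj (X i) y) ^+ 2).
    rewrite {1}/y rdot_suml mulr_sumr ler_sum // => i _.
    by rewrite rdot_adj rdot_amgm.
  rewrite big_split /= rdotxx; have := Xx y; lra.
have := rdot_amgm ((\sum_i X i *B adj (X i)) x) x.
rewrite rdot_sum_adj bop_sum_apply.
by have := Xv (fun i => adj (X i) x); rewrite /=; lra.
Qed.

Lemma open_closed_ball k H (X : op_tuple k H) : open_ball_op X -> closed_ball_op X.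
Proof. exact: ltW. Qed.

Lemma adj_addZ H K a (S T : bop H K) : adj (a *: S + T) = Num.conj a *: adj S + adj T.
Proof.
apply: adj_eq => x y; rewrite !bopD_apply !bopZ_apply hdotDl hdotDr hdotZl hdotZr.
by rewrite conjCK !adjP.
Qed.

Lemma adjZ H K a (S : bop H K) : adj (a *: S) = Num.conj a *: adj S.
Proof. by apply: adj_eq => x y; rewrite !bopZ_apply hdotZl hdotZr conjCK adjP. Qed.

Lemma adj_id H : adj (bid H) = bid H.
Proof. exact: adj_eq. Qed.

(** A factor r < 1 uniform in x is required, since strict inequality at each vector does not keep
    the norm away from 1 in infinite dimension. The argument is that of [closed_ball_adj] with the
    vectors X_i^* x weighted by r. *)
Lemma open_ball_adj k H (X : op_tuple k H) (r : R) : 0 < r -> r < 1 ->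
  (forall x, \sum_i rnorm (adj (X i) x) ^+ 2 <= r * rnorm x ^+ 2) ->
  open_ball_op X.
Proof.
move=> r0 r1 Xx; rewrite /open_ball_op /row_norm /=.
rewrite (@le_lt_trans _ _ (Num.sqrt r)) //; last first.
  by rewrite -[ltRHS]sqrtr1 ltr_sqrt.
rewrite ler_sqrt ?(ltW r0) // opnorm_le ?(ltW r0) // => x.
rewrite -ler_sqr ?nnegrE ?rnorm_ge0 ?mulr_ge0 ?rnorm_ge0 ?(ltW r0) //; set y := _ x.
rewrite exprMn.
have : 2 * r * rdot y y <= \sum_i (r ^+ 2 * rnorm (adj (X i) x) ^+ 2 +
    rnorm (adj (X i) y) ^+ 2).
  rewrite {1}/y bop_sum_apply rdot_suml mulr_sumr ler_sum // => i _ /=.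
  rewrite rdot_adj; have := rdot_amgm (r%:C *: adj (X i) x) (adj (X i) y).
  by rewrite rdotZl rnormZr exprMn real_normK ?num_real // mulrA.
rewrite big_split /= -mulr_sumr rdotxx; have := Xx x; have := Xx y.
move: (rnorm x ^+ 2) (rnorm y ^+ 2) (\sum_i _) (\sum_i _) => a b c d h1 h2 h3.
have h4 : r ^+ 2 * c <= r ^+ 2 * (r * a) by rewrite ler_wpM2l ?sqr_ge0.
have : r * b <= r * (r ^+ 2 * a) by lra.
by rewrite ler_pM2l.
Qed.

End RowContractions.

(** * Diagonal ampliations on l^2(N; G) and the oblique idempotent *)

Section SquareSummableOperators.
Context {R : realType} (G : hilbertType R).
Implicit Types x y : l2 G.

Lemma l2_rnorm x : rnorm x = l2_norm x. Proof. by []. Qed.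

Lemma l2_rdotE x y : rdot x y = l2_rdot x y.
Proof.
by rewrite /rdot /hdot /= !mul0r mul1r subrr addr0.
Qed.

Lemma l2_rnorm2_partial x K :
  \sum_(0 <= k < K) rnorm (x k) ^+ 2 <= rnorm x ^+ 2.
Proof. exact: l2_partial. Qed.

Lemma l2_rnorm2_le x M :
  (forall K, \sum_(0 <= k < K) rnorm (x k) ^+ 2 <= M) -> rnorm x ^+ 2 <= M.
Proof.
move=> xM; rewrite l2_rnorm l2_norm2; apply: series_lim_le; first exact: l2_rdot_cvg.
by move=> K; apply: le_trans (xM K); apply: ler_sum => k _; rewrite rdotxx.
Qed.

Lemma l2_rdot_fin x y K : (forall k, (K <= k)%N -> rdot (x k) (y k) = 0) ->
  rdot x y = \sum_(0 <= k < K) rdot (x k) (y k).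
Proof.
move=> xy; rewrite l2_rdotE; apply: limn_series.
apply: cvg_near_cst; exists K => // n /= Kn; apply/eqP.
rewrite seriesEnat /= (big_cat_nat (leq0n K) Kn) //= [X in _ + X]big_nat_cond [X in _ + X]big1 ?addr0 //.
by move=> k /andP[/andP[Kk _] _]; exact: xy.
Qed.

Lemma l2_hdot_fin x y K : (forall k, (K <= k)%N -> y k = 0) ->
  '[x, y] = \sum_(0 <= k < K) '[x k, y k].
Proof.
move=> y0; rewrite hdot_rdot !(@l2_rdot_fin _ _ K) => [|k Kk|k Kk]; last 2 first.
- by rewrite l2Z y0 // scaler0 rdot0r.
- by rewrite y0 // rdot0r.
rewrite !rmorph_sum /= mulr_sumr -big_split /=; apply: eq_bigr => k _.
by rewrite [RHS]hdot_rdot.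
Qed.

Definition l2_seq (s : nat -> G) (K : nat) : nat -> G :=
  fun k => if (k < K)%N then s k else 0.

Lemma l2_seq_summable s K : exists M : R, forall N,
  \sum_(0 <= k < N) rnorm (l2_seq s K k) ^+ 2 <= M.
Proof.
exists (\sum_(0 <= k < K) rnorm (s k) ^+ 2) => N.
have h0 k : (K <= k)%N -> rnorm (l2_seq s K k) ^+ 2 = 0.
  by move=> Kk; rewrite /l2_seq ltnNge Kk /= rnorm0 expr0n.
have hK : \sum_(0 <= k < K) rnorm (s k) ^+ 2 = \sum_(0 <= k < K) rnorm (l2_seq s K k) ^+ 2.
  by apply: eq_big_nat => k /andP[_ kK]; rewrite /l2_seq kK.
rewrite hK; case: (leqP N K) => NK.
  by rewrite [leRHS](big_cat_nat (leq0n N) NK) //= lerDl sumr_ge0 // => k _; rewrite sqr_ge0.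
rewrite (big_cat_nat (leq0n K) (ltnW NK)) //= [X in _ + X]big_nat_cond [X in _ + X]big1 ?addr0 //.
by move=> k /andP[/andP[Kk _] _]; exact: h0.
Qed.

Definition l2_trunc s K : l2 G := L2 (l2_seq_summable s K).

Lemma l2_truncE s K k : l2_trunc s K k = if (k < K)%N then s k else 0.
Proof. by []. Qed.

Definition l2_two (u v : G) : l2 G := l2_trunc (fun k => if k == 0%N then u else v) 2.

Lemma l2_twoE u v k :
  l2_two u v k = if k is 0 then u else if k is 1 then v else 0.
Proof. by case: k => [|[|k]]. Qed.

Lemma l2_two_hdot x u v : '[x, l2_two u v] = '[x 0%N, u] + '[x 1%N, v].
Proof.
rewrite (@l2_hdot_fin _ _ 2) => [|[|[|k]]] //.
by rewrite !big_nat_recr //= big_geq // add0r.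
Qed.

Lemma l2_two_rnorm2 u v : rnorm (l2_two u v) ^+ 2 = rnorm u ^+ 2 + rnorm v ^+ 2.
Proof. by rewrite -!rdotxx /rdot l2_two_hdot ReD. Qed.

Lemma l2_two_linear a u v u' v' :
  l2_two (a *: u + u') (a *: v + v') = a *: l2_two u v + l2_two u' v'.
Proof.
by apply: l2P => -[|[|k]]; rewrite l2D l2Z //= scaler0 addr0.
Qed.

Lemma l2_rnorm2_two x : rnorm (x 0%N) ^+ 2 + rnorm (x 1%N) ^+ 2 <= rnorm x ^+ 2.
Proof.
by have := l2_rnorm2_partial x 2; rewrite !big_nat_recr //= big_geq // add0r.
Qed.

Lemma l2_single_rnorm u k : rnorm (l2_trunc (fun j => if j == k then u else 0) k.+1) = rnorm u.
Proof.
set x := l2_trunc _ _.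
have : rnorm x ^+ 2 = rnorm u ^+ 2.
  rewrite -!rdotxx (@l2_rdot_fin _ _ k.+1) => [|j kj]; last first.
    by rewrite l2_truncE ltnNge kj rdot0r.
  rewrite big_nat_recr //= big_nat_cond big1 ?add0r => [|j /andP[/andP[_ jk] _]].
    by rewrite /l2_seq ltnSn eqxx.
  by rewrite /= /l2_seq ltn_eqF // if_same rdot0r.
by move/eqP; rewrite eqrXn2 ?rnorm_ge0 // => /eqP.
Qed.

Lemma l2_diag_summable (A : bop G G) x : exists M : R, forall N,
  \sum_(0 <= k < N) rnorm (A (x k)) ^+ 2 <= M.
Proof.
apply: (@l2_summable_le _ _ _ x x (opnorm A ^+ 2) 0) => // [|k].
  exact: sqr_ge0.
by rewrite mul0r addr0 -exprMn ler_sqr ?nnegrE ?rnorm_ge0 ?mulr_ge0 ?opnorm_ge0 ?rnorm_ge0 ?opnormP.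
Qed.

Lemma l2_diag_linear A : linear (fun x => L2 (l2_diag_summable A x)).
Proof. by move=> a x y; apply: l2P => k; rewrite l2D l2Z /= linearP. Qed.

Lemma l2_diag_rnorm A x : rnorm (L2 (l2_diag_summable A x)) <= opnorm A * rnorm x.
Proof.
rewrite -ler_sqr ?nnegrE ?rnorm_ge0 ?mulr_ge0 ?rnorm_ge0 ?opnorm_ge0 //.
apply: l2_rnorm2_le => K; rewrite exprMn.
apply: le_trans (ler_wpM2l (sqr_ge0 _) (l2_rnorm2_partial x K)).
rewrite mulr_sumr ler_sum // => k _ /=.
by rewrite -exprMn ler_sqr ?nnegrE ?rnorm_ge0 ?mulr_ge0 ?opnorm_ge0 ?rnorm_ge0 ?opnormP.
Qed.

Lemma l2_diag_bounded A : exists M : R, forall x,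
  rnorm (L2 (l2_diag_summable A x)) <= M * rnorm x.
Proof. by exists (opnorm A); exact: l2_diag_rnorm. Qed.

Definition l2_diag A : bop (l2 G) (l2 G) := Bop (l2_diag_linear A) (l2_diag_bounded A).

Arguments l2_diag : simpl never.

Lemma l2_diagE A x k : l2_diag A x k = A (x k). Proof. by []. Qed.

Lemma opnorm_l2_diag A : opnorm (l2_diag A) <= opnorm A.
Proof. by apply: opnorm_le; [exact: opnorm_ge0|exact: l2_diag_rnorm]. Qed.

Lemma l2_proj_linear (t : R) : linear (fun x => l2_two 0 (t%:C *: x 0%N + x 1%N)).
Proof.
move=> a x y; rewrite !l2D !l2Z -l2_two_linear scaler0 addr0; congr l2_two.
by rewrite !scalerDr !scalerA (mulrC a) -!addrA; congr (_ + _); rewrite addrCA.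
Qed.

Lemma l2_proj_bounded (t : R) : exists M : R, forall x,
  rnorm (l2_two 0 (t%:C *: x 0%N + x 1%N)) <= M * rnorm x.
Proof.
exists (`|t| + 1) => x.
have -> : rnorm (l2_two 0 (t%:C *: x 0%N + x 1%N)) = rnorm (t%:C *: x 0%N + x 1%N).
  apply/eqP; rewrite -(@eqrXn2 _ 2) ?rnorm_ge0 // l2_two_rnorm2.
  by rewrite rnorm0 expr0n add0r.
have h := l2_rnorm2_two x.
have h0 : rnorm (x 0%N) <= rnorm x.
  by rewrite -ler_sqr ?nnegrE ?rnorm_ge0 //; have := sqr_ge0 (rnorm (x 1%N)); lra.
have h1 : rnorm (x 1%N) <= rnorm x.
  by rewrite -ler_sqr ?nnegrE ?rnorm_ge0 //; have := sqr_ge0 (rnorm (x 0%N)); lra.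
rewrite (le_trans (rnormD _ _)) // rnormZr mulrDl mul1r lerD //.
by rewrite ler_wpM2l.
Qed.

(** Its range is coordinate 1. Its kernel consists of the pairs (y, - t y) in coordinates 0 and 1,
    together with all coordinates from 2 on. *)
Definition l2_proj (t : R) : bop (l2 G) (l2 G) :=
  Bop (l2_proj_linear t) (l2_proj_bounded t).

Arguments l2_proj : simpl never.

Lemma l2_projE t x : l2_proj t x = l2_two 0 (t%:C *: x 0%N + x 1%N).
Proof. by []. Qed.

Lemma l2_proj_adj t x : adj (l2_proj t) x = l2_two (t%:C *: x 1%N) (x 1%N).
Proof.
apply: hdot_eq => y; rewrite -adjP l2_projE l2_two_hdot hdotC l2_two_hdot.
rewrite hdot0r add0r -hdotC hdotDl; congr (_ + _).
by rewrite hdotZl hdotZr conj_real.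
Qed.

Lemma l2_diag_proj A t x : l2_diag A (l2_proj t x) = l2_proj t (l2_diag A x).
Proof.
apply: l2P => -[|[|k]]; rewrite l2_diagE !l2_projE /= ?linear0 //.
by rewrite linearP.
Qed.

Lemma l2_proj_idem t x : l2_proj t (l2_proj t x) = l2_proj t x.
Proof.
by apply: l2P => -[|[|k]]; rewrite !l2_projE //= scaler0 add0r.
Qed.

End SquareSummableOperators.

(** * Spans, density, and infinite dimension of l^2(N; G) *)

Section Spans.
Context {R : realType}.
Implicit Types G H K : hilbertType R.

Lemma lin_span_gen H (A : set H) x : A x -> lin_span A x.
Proof.
move=> Ax; exists 1%N, (fun=> 1), (fun=> x); split => //.
by rewrite big_ord1 scale1r.
Qed.

Lemma lin_span0 H (A : set H) : lin_span A 0.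
Proof. by exists 0%N, (fun=> 0), (fun=> 0); split => [[]|] //; rewrite big_ord0. Qed.

Lemma lin_span_lin H (A : set H) a x y :
  lin_span A x -> lin_span A y -> lin_span A (a *: x + y).
Proof.
move=> [N [c [v [Av ->]]]] [M [d [w [Aw ->]]]].
exists (N + M)%N.
exists (fun i => match fintype.split i with inl j => a * c j | inr j => d j end).
exists (fun i => match fintype.split i with inl j => v j | inr j => w j end).
split; first by move=> i; case: (fintype.split i).
rewrite big_split_ord /= scaler_sumr; congr (_ + _); apply: eq_bigr => i _.
  by case: split_ordP => j; [move/lshift_inj -> | move/eqP; rewrite eq_lrshift];
    rewrite ?scalerA.
by case: split_ordP => j; [move/eqP; rewrite eq_rlshift | move/rshift_inj ->].
Qed.

Definition approximable H (A : set H) (x : H) :=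
  forall e : R, 0 < e -> exists y, A y /\ rnorm (x - y) <= e.

Lemma closure_approximable H (A : set H) x : closure A x <-> approximable A x.
Proof.
split=> [Ax e e0|Ax B].
  have [|y [Ay]] := Ax (ball x e%:C); first by apply: nbhsx_ballx; rewrite ltcR.
  by rewrite -ball_normE /ball_ /= rnormE ltcR => xy; exists y; split=> //; exact: ltW.
move=> /nbhs_ballP[e /= /gt0c_Re [ee e0] eB].
have [y [Ay xy]] := Ax _ (divr_gt0 e0 (ltr0n _ 2)).
exists y; split=> //; apply: eB; rewrite -ball_normE /ball_ /= rnormE ee ltcR.
by apply: le_lt_trans xy _; rewrite ltr_pdivrMr // ltr_pMr // ltr1n.
Qed.

Lemma approximable_lin H (A : set H) a x y :
  (forall a x y, A x -> A y -> A (a *: x + y)) ->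
  approximable A x -> approximable A y -> approximable A (a *: x + y).
Proof.
move=> Alin Ax Ay e e0.
have b0 : 0 < complex.Re `|a| + 1 by rewrite ltr_wpDl // -ler0c -normcRe.
have e2 : 0 < e / 2 by rewrite divr_gt0.
have [[x' [Ax' xx']] [y' [Ay' yy']]] := (Ax _ (divr_gt0 e2 b0), Ay _ e2).
exists (a *: x' + y'); split; first exact: Alin.
rewrite opprD addrACA -scalerBr (le_trans (rnormD _ _)) // rnormZ.
have : (complex.Re `|a| + 1) * rnorm (x - x') <= e / 2.
  by rewrite mulrC -ler_pdivlMr.
rewrite mulrDl mul1r; have := rnorm_ge0 (x - x'); lra.
Qed.

Lemma approximable_trans H (A B : set H) x :
  (forall y, B y -> approximable A y) -> approximable B x -> approximable A x.
Proof.
move=> BA Bx e e0; have e2 : 0 < e / 2 by rewrite divr_gt0.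
have [y [/BA /(_ _ e2) [z [Az yz]] xy]] := Bx _ e2.
by exists z; split=> //; have := rnorm_distD x y z; lra.
Qed.

Lemma approximable_gen H (A : set H) x : A x -> approximable A x.
Proof. by move=> Ax e e0; exists x; split=> //; rewrite subrr rnorm0 ltW. Qed.

Lemma dense_approximable H (A : set H) :
  dense_span A <-> forall x, approximable (lin_span A) x.
Proof.
rewrite /dense_span; split=> [h x|h]; first by apply/closure_approximable; rewrite h.
by apply/seteqP; split=> // x _; apply/closure_approximable.
Qed.

Lemma bop_eq_dense H K (A : set H) (S T : bop H K) : dense_span A ->
  (forall x, A x -> S x = T x) -> S = T.
Proof.
move=> /dense_approximable dA ST; apply: bopP => x.
have {}ST y : lin_span A y -> S y = T y.
  apply: (@lin_span_sub _ _ _ [set y | S y = T y]) => //=.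
  - by rewrite !bop_zero.
  - by move=> a u v Su Sv; rewrite !bop_add !bop_scale Su Sv.
apply/eqP; rewrite -subr_eq0; apply/eqP/rnorm_eq0.
pose D := S - T.
have D0 : 0 < opnorm D + 1 by rewrite ltr_wpDl ?opnorm_ge0.
apply/eqP; rewrite eq_le rnorm_ge0 andbT; apply/ler_addgt0Pl => e e0; rewrite addr0.
have [y [hy xy]] := dA x _ (divr_gt0 e0 D0).
have Dy : D y = 0 by rewrite bopB_apply ST // subrr.
have -> : S x - T x = D (x - y) by rewrite bop_sub Dy subr0 bopB_apply.
rewrite (le_trans (opnormP _ _)) // (le_trans (ler_wpM2l (opnorm_ge0 _) xy)) //.
by rewrite mulrCA ger_pMr // ler_pdivrMr // mul1r lerDl.
Qed.

Lemma lin_span_range H N (v : 'I_N -> H) x : lin_span (range v) x ->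
  exists d : 'I_N -> R[i], x = \sum_i d i *: v i.
Proof.
apply: (@lin_span_sub _ _ _ [set x | exists d : 'I_N -> R[i],
  x = \sum_i d i *: v i]) => /= [|a y z [d ->] [d' ->]|_ [i _ <-]].
- by exists (fun=> 0); rewrite big1 // => i _; rewrite scale0r.
- exists (fun i => a * d i + d' i); rewrite scaler_sumr -big_split /=.
  by apply: eq_bigr => i _; rewrite scalerDl scalerA.
exists (fun j => (j == i)%:R); rewrite (bigD1 i) //= eqxx scale1r big1 ?addr0 //.
by move=> j /negPf ->; rewrite scale0r.
Qed.

Definition l2_single G (k : nat) (u : G) : l2 G :=
  l2_trunc (fun j => if j == k then u else 0) k.+1.

Lemma l2_singleE G k (u : G) j : l2_single k u j = if j == k then u else 0.
Proof.
rewrite l2_truncE; case: eqP => [->|_]; first by rewrite ltnSn.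
by rewrite if_same.
Qed.

Lemma l2_single_linear G k a (u v : G) :
  l2_single k (a *: u + v) = a *: l2_single k u + l2_single k v.
Proof.
apply: l2P => j; rewrite l2D l2Z !l2_singleE.
by case: ifP => // _; rewrite scaler0 addr0.
Qed.

Lemma l2_singleB G k (u v : G) :
  l2_single k (u - v) = l2_single k u - l2_single k v.
Proof. by rewrite -[in LHS]scaleN1r addrC l2_single_linear scaleN1r addrC. Qed.

Lemma rnorm_l2_single G k (u : G) : rnorm (l2_single k u) = rnorm u.
Proof. exact: l2_single_rnorm. Qed.

(** If N vectors spanned the space, the coefficients of N + 1 copies of g in distinct coordinates
    would form an (N + 1) x N matrix. Its left kernel is nonzero, which contradicts the independence
    of the copies. *)
Lemma l2_infinite_dim G (g : G) : g != 0 -> infinite_dim (l2 G).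
Proof.
move=> g0 [N [v vT]].
have /choice[d dP] : forall k : nat, exists d : 'I_N -> R[i],
    l2_single k g = \sum_i d i *: v i.
  by move=> k; apply: lin_span_range; rewrite vT.
pose D := \matrix_(k < N.+1, i < N) d k i.
have : kermx D != 0.
  rewrite kermx_eq0 /row_free neq_ltn; apply/orP; left.
  by rewrite ltnS rank_leq_col.
case/rowV0Pn => u /sub_kermxP uD u0.
have h : \sum_(k < N.+1) u 0 k *: l2_single k g = 0.
  under eq_bigr do rewrite dP scaler_sumr.
  rewrite exchange_big /= big1 // => i _.
  under eq_bigr do rewrite scalerA; rewrite -scaler_suml.
  have /matrixP/(_ 0 i) := uD; rewrite !mxE => uD0.
  rewrite [X in X *: _](_ : _ = 0) ?scale0r // -[RHS]uD0.
  by apply: eq_bigr => k _; rewrite mxE.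
case/eqP: u0; apply/rowP => k; rewrite mxE; apply/eqP.
have hk : (\sum_(k < N.+1) u 0 k *: l2_single k g) k = u 0 k *: g.
  have hs (s : seq 'I_N.+1) : (\sum_(k <- s) u 0 k *: l2_single k g) k =
      \sum_(j <- s) u 0 j *: l2_single j g k.
    by elim: s => [|j s IH]; rewrite ?big_nil // !big_cons l2D IH.
  rewrite hs (bigD1 k) // l2_singleE eqxx big1 => [|j jk].
    by rewrite /= addr0.
  by rewrite l2_singleE eq_sym (inj_eq val_inj) (negPf jk) scaler0.
move: hk; rewrite h l20 => /esym/eqP; rewrite scaler_eq0 (negPf g0) orbF.
by [].
Qed.

Lemma l2_trunc_sum G (x : l2 G) (K : nat) :
  l2_trunc x K = \sum_(0 <= k < K) l2_single k (x k).
Proof.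
elim: K => [|K IH]; first by rewrite big_geq //; apply: l2P => k; rewrite l2_truncE.
rewrite big_nat_recr //= -IH; apply: l2P => k.
rewrite l2D l2_singleE !l2_truncE ltnS leq_eqVlt.
case: (eqVneq k K) => [->|_] /=; first by rewrite ltnn add0r.
by rewrite addr0.
Qed.

Lemma l2_trunc_approx G (x : l2 G) (e : R) : 0 < e ->
  exists K : nat, rnorm (x - l2_trunc x K) <= e.
Proof.
move=> e0; have e2 : 0 < e ^+ 2 by rewrite exprn_gt0.
have cx := @l2_cvg _ _ x.
have [K _ hK] := (cvgrPdist_le _ _).1 cx _ e2.
have rx : limn (series (fun k => rnorm (x k) ^+ 2)) = rnorm x ^+ 2.
  rewrite l2_rnorm l2_norm2 /l2_rdot; congr (limn (series _)).
  by apply: funext => k; rewrite rdotxx.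
exists K; rewrite -ler_sqr ?nnegrE ?rnorm_ge0 ?(ltW e0) //.
have := hK K (leqnn K); rewrite rx seriesEnat /= => h.
apply: le_trans (le_trans (ler_norm _) h).
set y := x - _; apply: l2_rnorm2_le => N; rewrite lerBrDr.
have yE k : y k = x k - l2_trunc x K k by exact: l2B.
have e1 k : rnorm (y k) ^+ 2 = if (k < K)%N then 0 else rnorm (x k) ^+ 2.
  rewrite yE l2_truncE; case: ifP => _; last by rewrite subr0.
  by rewrite subrr rnorm0 expr0n.
have -> : \sum_(0 <= k < N) rnorm (y k) ^+ 2 =
    \sum_(0 <= k < N) if (k < K)%N then 0 else rnorm (x k) ^+ 2.
  by apply: eq_bigr => k _; exact: e1.
case: (leqP N K) => NK.
  suff -> : \sum_(0 <= k < N) (if (k < K)%N then 0 else rnorm (x k) ^+ 2) = 0.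
    by rewrite add0r; exact: l2_rnorm2_partial.
  rewrite big_nat_cond big1 // => k /andP[/andP[_ kN] _].
  by rewrite (leq_trans kN).
rewrite addrC (big_cat_nat (leq0n K) (ltnW NK)) //= [X in _ + (X + _)]big_nat_cond.
rewrite [X in _ + (X + _)]big1 ?add0r; last by move=> k /andP[/andP[_ ->] _].
apply: le_trans (l2_rnorm2_partial x N).
rewrite [leRHS](big_cat_nat (leq0n K) (ltnW NK)) //= lerD2l big_nat_cond.
rewrite [leRHS]big_nat_cond ler_sum // => k /andP[/andP[Kk _] _].
by rewrite ltnNge Kk.
Qed.

End Spans.

(** * The tensor product of l^2(N; H) and E *)

Section SquareSummableTensor.
Context {R : realType} (H E : hilbertType R) (HE : hilbert_tensor H E).

Lemma ten_rnorm2 h e : rnorm (ht_ten HE h e) ^+ 2 = rnorm h ^+ 2 * rnorm e ^+ 2.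
Proof.
have := ht_dot HE h e h e; rewrite !hdotxx -rmorphM /= => /eqP.
by rewrite eq_complex /= => /andP[/eqP].
Qed.

Lemma l2_ten_summable (x : l2 H) e : exists M : R, forall N,
  \sum_(0 <= k < N) rnorm (ht_ten HE (x k) e) ^+ 2 <= M.
Proof.
have [M xM] := l2_summable x; exists (M * rnorm e ^+ 2) => N.
under eq_bigr do rewrite ten_rnorm2.
by rewrite -mulr_suml ler_wpM2r // sqr_ge0.
Qed.

Definition l2_ten (x : l2 H) (e : E) : l2 HE := L2 (l2_ten_summable x e).

Lemma l2_tenE x e k : l2_ten x e k = ht_ten HE (x k) e. Proof. by []. Qed.

Lemma l2_ten_morphl e : zmod_morphism (l2_ten^~ e).
Proof. by move=> x y; apply: l2P => k; rewrite l2B !l2_tenE l2B linearBl. Qed.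

Lemma l2_ten_morphr x : zmod_morphism (l2_ten x).
Proof. by move=> e f; apply: l2P => k; rewrite l2B !l2_tenE linearBr. Qed.

Lemma l2_ten_scalel e : scalable_for *:%R (l2_ten^~ e).
Proof. by move=> a x; apply: l2P => k; rewrite l2Z !l2_tenE l2Z linearZl_LR. Qed.

Lemma l2_ten_scaler x : scalable_for *:%R (l2_ten x).
Proof. by move=> a e; apply: l2P => k; rewrite l2Z !l2_tenE linearZr_LR. Qed.

HB.instance Definition _ := isBilinear.Build R[i] (l2 H) E (l2 HE) *:%R *:%R
  l2_ten l2_ten_morphl l2_ten_morphr l2_ten_scalel l2_ten_scaler.

Lemma l2_ten_rdot x e x' e' :
  rdot (l2_ten x e) (l2_ten x' e') = complex.Re ('[x, x'] * '[e, e']).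
Proof.
rewrite ReM Im_hdot -/(rdot x x') !l2_rdotE; apply: limn_series.
rewrite [X in series X](_ : _ = (complex.Re '[e, e']) *: (fun k => rdot (x k) (x' k)) -
   (complex.Im '[e, e']) *: (fun k => rdot (x k) (('i *: x') k))); last first.
  apply: funext => k; rewrite !l2_tenE /rdot ht_dot ReM.
  by rewrite (Im_hdot (x k)) /rdot mulrC [X in _ - X]mulrC.
rewrite (mulrC (l2_rdot x x')) (mulrC (l2_rdot x _)) seriesD seriesN !seriesZ.
by apply: cvgB; apply: cvgZr; exact: l2_rdot_cvg.
Qed.

Lemma l2_ten_dot x e x' e' :
  '[l2_ten x e, l2_ten x' e'] = '[x, x'] * '[e, e'].
Proof.
rewrite hdot_rdot -l2_ten_scaler !l2_ten_rdot hdotZr.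
case: ('[x, x']) ('[e, e']) => a b [c d].
by apply/eqP; rewrite eq_complex /=; apply/andP; split; apply/eqP; ring.
Qed.

Lemma l2_ten_total : dense_span [set l2_ten p.1 p.2 | p in [set: l2 H * E]].
Proof.
apply/dense_approximable => y; set A := [set _ | _ in _].
have single k u : approximable (lin_span A) (l2_single k u).
  apply: (@approximable_trans _ _ _ [set l2_single k v |
     v in lin_span [set ht_ten HE p.1 p.2 | p in [set: H * E]]]).
    move=> _ [v hv <-]; apply: approximable_gen.
    apply: (@lin_span_sub _ _ _ [set v | lin_span A (l2_single k v)]) hv => [|a v1 v2|].
    - rewrite /= (_ : l2_single k 0 = 0); first exact: lin_span0.
      by apply: l2P => j; rewrite l2_singleE if_same.
    - by rewrite /= l2_single_linear; exact: lin_span_lin.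
    move=> _ [[h e] _ <-]; apply: lin_span_gen; exists (l2_single k h, e) => //=.
    apply: l2P => j; rewrite l2_tenE !l2_singleE.
    by case: ifP => // _; rewrite linear0l.
  move=> e e0.
  have [v [hv uv]] := (dense_approximable _).1 (ht_total HE) u _ e0.
  by exists (l2_single k v); split; [exists v | rewrite -l2_singleB rnorm_l2_single].
have tr K : approximable (lin_span A) (l2_trunc y K).
  rewrite l2_trunc_sum; elim/big_ind: _ => [|u v hu hv|k _]; last exact: single.
    by apply: approximable_gen; exact: lin_span0.
  rewrite -[u]scale1r; apply: approximable_lin hu hv.
  by move=> a x1 x2; exact: lin_span_lin.
apply: (@approximable_trans _ _ _ [set l2_trunc y K | K in [set: nat]]).
  by move=> _ [K _ <-].
by move=> e e0; have [K hK] := l2_trunc_approx y e0; exists (l2_trunc y K); split=> //; exists K.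
Qed.

(** Contractivity of F covers every model of the tensor product. In this one the space is l^2(N; H
    (x) E), so values of F are again operators on square summable sequences. *)
Definition l2_tensor : hilbert_tensor (l2 H) E :=
  @HilbertTensor R (l2 H) E (l2 HE) l2_ten l2_ten_dot l2_ten_total.

End SquareSummableTensor.

(** * The operators 1 (x) T *)

Section TensorOperators.
Context {R : realType}.
Implicit Types H K E : hilbertType R.

Lemma op_tensor_eq H K (HK : hilbert_tensor H K) (S : bop H H) (T : bop K K)
    (U : bop HK HK) :
  (forall h k, U (ht_ten HK h k) = ht_ten HK (S h) (T k)) -> op_tensor HK S T = U.
Proof.
move=> UP; have := @xgetPex _ (0 : bop HK HK) [set U : bop HK HK |
  forall h k, U (ht_ten HK h k) = ht_ten HK (S h) (T k)] (ex_intro _ U UP).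
rewrite -/(op_tensor HK S T) => /= VP; apply: (bop_eq_dense (ht_total HK)).
by move=> _ [[h k] _ <-] /=; rewrite VP UP.
Qed.

Section IdentityTensor.
Context (H K : hilbertType R) (HK : hilbert_tensor H K).
Local Notation "h \ox k" := (ht_ten HK h k) (at level 38).

Let orth (x y : H) := '[x, y] == 0.

(** One step of Gram-Schmidt on the first legs, compensated in the second legs. The identity has to
    hold for all T with the same new family, because it is used both for T and for the identity
    operator. *)
Lemma orthogonalize_one (s : seq (H * K)) (h : H) (k : K) :
  pairwise orth (map fst s) ->
  exists h' (s' : seq (H * K)), [/\ map fst s' = map fst s,
    forall q, q \in map fst s -> orth h' q &
    forall T : bop K K, h \ox T k + \sum_(p <- s) p.1 \ox T p.2 =
      h' \ox T k + \sum_(p <- s') p.1 \ox T p.2].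
Proof.
elim: s => [|p s IH] /=; first by move=> _; exists h, [::].
move=> /andP[/allP ps /IH[h' [s' [ss' hs' E]]]].
pose c := '[h', p.1] / '[p.1, p.1].
exists (h' - c *: p.1), ((p.1, p.2 + c *: k) :: s'); split.
- by rewrite /= ss'.
- move=> q; rewrite inE /orth hdotDl hdotNl hdotZl => /orP[/eqP ->|qs].
    (* If <p.1, p.1> = 0 then p.1 = 0 and c is a division by zero, but orthogonality to p.1 is then
       automatic. *)
    rewrite /c; have [p0|p0] := eqVneq '[p.1, p.1] 0; last by rewrite divfK // subrr.
    have -> : p.1 = 0.
      apply/rnorm_eq0/eqP; rewrite -sqrf_eq0; move: p0; rewrite hdotxx => /eqP.
      by rewrite eq_complex /= => /andP[].
    by rewrite !hdot0r mulr0 subrr.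
  by rewrite (eqP (hs' _ qs)) (eqP (ps _ qs)) mulr0 subrr.
move=> T; rewrite !big_cons /= addrCA E linearBl linearD linearDr linearZ.
rewrite linearZr_LR linearZl_LR /= addrCA -!addrA; congr (_ + _).
by rewrite [RHS]addrCA addKr.
Qed.

Lemma orthogonalize (s : seq (H * K)) : exists s' : seq (H * K),
  pairwise orth (map fst s') /\ forall T : bop K K,
    \sum_(p <- s) p.1 \ox T p.2 = \sum_(p <- s') p.1 \ox T p.2.
Proof.
elim: s => [|[h k] s [s' [os' E]]]; first by exists [::].
have [h' [s'' [ss hs E']]] := orthogonalize_one h k os'.
exists ((h', k) :: s''); split=> [|T].
  by rewrite /= ss os' andbT; apply/allP.
by rewrite !big_cons E E'.
Qed.

Lemma orthogonal_rnorm2 (s : seq (H * K)) (T : bop K K) : pairwise orth (map fst s) ->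
  rnorm (\sum_(p <- s) p.1 \ox T p.2) ^+ 2 =
  \sum_(p <- s) rnorm p.1 ^+ 2 * rnorm (T p.2) ^+ 2.
Proof.
elim: s => [|p s IH] /=; first by rewrite !big_nil rnorm0 expr0n.
move=> /andP[/allP ps os]; rewrite !big_cons rnorm2D IH // ten_rnorm2.
suff -> : rdot (p.1 \ox T p.2) (\sum_(q <- s) q.1 \ox T q.2) = 0.
  by rewrite mulr0 addr0.
rewrite rdot_sumr big_seq big1 // => q qs; rewrite /rdot ht_dot.
by rewrite (eqP (ps _ _)) ?mul0r //; apply: map_f.
Qed.

(** Once the first legs are orthogonal, both squared norms are sums of |h|^2 |T k|^2 and of |h|^2
    |k|^2, which are compared term by term. *)
Lemma idten_bound (s : seq (H * K)) (T : bop K K) :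
  rnorm (\sum_(p <- s) p.1 \ox T p.2) <=
  opnorm T * rnorm (\sum_(p <- s) p.1 \ox p.2).
Proof.
have [s' [os' E]] := orthogonalize s.
rewrite E; have /= -> := E (bid K).
rewrite -ler_sqr ?nnegrE ?rnorm_ge0 ?mulr_ge0 ?opnorm_ge0 ?rnorm_ge0 // exprMn.
rewrite orthogonal_rnorm2 //; have /= -> := orthogonal_rnorm2 (bid K) os'.
rewrite mulr_sumr ler_sum // => p _; rewrite [leRHS]mulrCA; apply: ler_wpM2l; first exact: sqr_ge0.
by rewrite -exprMn ler_sqr ?nnegrE ?rnorm_ge0 ?mulr_ge0 ?opnorm_ge0 ?rnorm_ge0 ?opnormP.
Qed.

Lemma idten_exists (T : bop K K) : exists U : bop HK HK,
  (forall h k, U (h \ox k) = h \ox T k) /\ opnorm U <= opnorm T.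
Proof.
pose Gr (x y : HK) := exists s : seq (H * K),
  x = \sum_(p <- s) p.1 \ox p.2 /\ y = \sum_(p <- s) p.1 \ox T p.2.
have [||||U [UG UT]] := @extension_by_density _ _ _ Gr (opnorm T).
- exact: opnorm_ge0.
- move=> a x y x' y' [s [-> ->]] [s' [-> ->]].
  exists ([seq (a *: p.1, p.2) | p <- s] ++ s').
  rewrite !big_cat !big_map /=; split; congr (_ + _); rewrite scaler_sumr;
    by apply: eq_bigr => p _; rewrite linearZl_LR.
- by move=> x y [s [-> ->]]; exact: idten_bound.
- apply: (dense_span_sub (ht_total HK)) => /=.
  + by exists 0, [::]; rewrite !big_nil.
  + move=> a x x' [y [s [-> _]]] [y' [s' [-> _]]]; eexists.
    exists ([seq (a *: p.1, p.2) | p <- s] ++ s'); split; last by [].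
    rewrite big_cat big_map /=; congr (_ + _); rewrite scaler_sumr.
    by apply: eq_bigr => p _; rewrite linearZl_LR.
  + move=> _ [[h k] _ <-] /=; exists (h \ox T k), [:: (h, k)].
    by rewrite !big_seq1.
exists U; split=> // h k; apply: UG; exists [:: (h, k)].
by rewrite !big_seq1.
Qed.

Definition idten (T : bop K K) : bop HK HK := op_tensor HK (bid H) T.

Arguments idten : simpl never.

Lemma idtenE T h k : idten T (h \ox k) = h \ox T k.
Proof. by have [U [UP _]] := idten_exists T; rewrite /idten (op_tensor_eq (U := U)). Qed.

Lemma opnorm_idten T : opnorm (idten T) <= opnorm T.
Proof. by have [U [UP UT]] := idten_exists T; rewrite /idten (op_tensor_eq (U := U)). Qed.

Lemma op_tensor_scalar (c : R[i]) T : op_tensor HK (c *: bid H) T = c *: idten T.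
Proof.
by apply: op_tensor_eq => h k; rewrite !bopZ_apply idtenE linearZl_LR.
Qed.

Lemma idten_sum I (r : seq I) (c : I -> R[i]) (T : I -> bop K K) :
  idten (\sum_(i <- r) c i *: T i) = \sum_(i <- r) c i *: idten (T i).
Proof.
apply: op_tensor_eq => h k; rewrite !bop_sum_apply linear_sumr.
by apply: eq_bigr => i _; rewrite !bopZ_apply idtenE linearZr_LR.
Qed.

End IdentityTensor.

End TensorOperators.

(** * Convergence of free power series at points of the ball *)

Section FiniteCauchySchwarz.
Context {R : realType}.

(** Lagrange's identity: the difference of the two sides is half a sum of squares. *)
Lemma sum_CauchySchwarz (I : finType) (x y : I -> R) :
  (\sum_i x i * y i) ^+ 2 <= (\sum_i x i ^+ 2) * (\sum_i y i ^+ 2).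
Proof.
have h : 0 <= \sum_i \sum_j (x i * y j - x j * y i) ^+ 2.
  by apply: sumr_ge0 => i _; apply: sumr_ge0 => j _; rewrite sqr_ge0.
suff e : \sum_i \sum_j (x i * y j - x j * y i) ^+ 2 =
    2 * ((\sum_i x i ^+ 2) * (\sum_i y i ^+ 2) - (\sum_i x i * y i) ^+ 2).
  by move: h; rewrite e; lra.
pose A i j := x i ^+ 2 * y j ^+ 2; pose B i j := (x i * y i) * (x j * y j).
transitivity (\sum_i \sum_j (A i j + A j i - 2 * B i j)).
  by apply: eq_bigr => i _; apply: eq_bigr => j _; rewrite /A /B; ring.
under eq_bigr do rewrite sumrB big_split /=.
rewrite sumrB big_split /= [X in _ + X - _]exchange_big /=.
have -> : \sum_i \sum_j A i j = (\sum_i x i ^+ 2) * (\sum_i y i ^+ 2).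
  by rewrite big_distrlr.
have -> : \sum_i \sum_j 2 * B i j = 2 * (\sum_i x i * y i) ^+ 2.
  by rewrite expr2 big_distrlr /= mulr_sumr; apply: eq_bigr => i _; rewrite mulr_sumr.
ring.
Qed.

End FiniteCauchySchwarz.

Section Words.
Context {R : realType}.

Lemma big_cons_tuple (V : zmodType) n q (f : seq 'I_n -> V) :
  \sum_(a : q.+1.-tuple 'I_n) f a =
  \sum_(i < n) \sum_(a : q.-tuple 'I_n) f (i :: a).
Proof.
rewrite pair_big /= (reindex (fun p : 'I_n * q.-tuple 'I_n => [tuple of p.1 :: p.2])) //=.
exists (fun a => (thead a, [tuple of behead a])) => [[i a] _|a _] /=.
  by congr pair; apply: val_inj.
by rewrite -tuple_eta.
Qed.

Lemma big_tuple0 (V : zmodType) n (f : seq 'I_n -> V) :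
  \sum_(a : 0.-tuple 'I_n) f a = f [::].
Proof.
rewrite (big_pred1 [tuple]) // => a.
by rewrite [a]tuple0 /= eqxx.
Qed.

Definition sqn n (w : 'rV[R[i]]_n) : R := \sum_i complex.Re `|w 0 i| ^+ 2.

Lemma sqn_ge0 n (w : 'rV[R[i]]_n) : 0 <= sqn w.
Proof. by apply: sumr_ge0 => i _; rewrite sqr_ge0. Qed.

Lemma norm2_sqn n (w : 'rV[R[i]]_n) : norm2 w ^+ 2 = sqn w.
Proof. by rewrite sqr_sqrtr // sqn_ge0. Qed.

Lemma unit_ball_sqn n (w : 'rV[R[i]]_n) : unit_ball w <-> sqn w < 1.
Proof.
by rewrite /unit_ball /= /norm2 -[X in _ < X <-> _]sqrtr1 ltr_sqrt.
Qed.

Definition word_val n (w : 'rV[R[i]]_n) (a : seq 'I_n) : R[i] := \prod_(i <- a) w 0 i.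

Lemma word_op_scalar n (H : hilbertType R) (w : 'rV[R[i]]_n) a :
  word_op (scalar_tuple H w) a = word_val w a *: bid H.
Proof.
elim: a => [|i a IH]; first by rewrite /word_val big_nil scale1r.
apply: bopP => x; rewrite /= IH /word_val big_cons.
by rewrite !bopZ_apply scalerA.
Qed.

Lemma sum_word_val2 n (w : 'rV[R[i]]_n) q :
  \sum_(a : q.-tuple 'I_n) complex.Re `|word_val w a| ^+ 2 = sqn w ^+ q.
Proof.
elim: q => [|q IH].
  rewrite (big_tuple0 (fun a => complex.Re `|word_val w a| ^+ 2)).
  by rewrite /word_val big_nil normr1 /= expr1n expr0.
rewrite (big_cons_tuple q (fun a => complex.Re `|word_val w a| ^+ 2)).
rewrite exprS -IH mulr_suml; apply: eq_bigr => i _.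
rewrite mulr_sumr; apply: eq_bigr => a _.
rewrite /word_val big_cons normrM ReM [in LHS]normcRe /= mul0r subr0.
by rewrite exprMn.
Qed.

End Words.

Section PointEvaluation.
Context {R : realType}.
Implicit Types H E : hilbertType R.

(** The combination is the row of the scalars c_i times the column of the A_i, and the squared norm
    of that column is the norm of \sum_i A_i^* A_i. This matches the form in which the radius of
    convergence is given. *)
Lemma opnorm_comb E (I : finType) (c : I -> R[i]) (A : I -> bop E E) :
  opnorm (\sum_i c i *: A i) ^+ 2 <=
  (\sum_i complex.Re `|c i| ^+ 2) * opnorm (\sum_i adj (A i) *B A i).
Proof.
set S := \sum_i _ ^+ 2; set B := opnorm (\sum_i adj (A i) *B A i).
have S0 : 0 <= S by apply: sumr_ge0 => i _; rewrite sqr_ge0.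
have B0 : 0 <= B by exact: opnorm_ge0.
rewrite -[leRHS]sqr_sqrtr ?mulr_ge0 //.
rewrite ler_sqr ?nnegrE ?opnorm_ge0 ?sqrtr_ge0 //.
apply: opnorm_le => [|x]; first by rewrite sqrtr_ge0.
rewrite -ler_sqr ?nnegrE ?rnorm_ge0 ?mulr_ge0 ?sqrtr_ge0 ?rnorm_ge0 //.
rewrite exprMn sqr_sqrtr ?mulr_ge0 // bop_sum_apply.
apply: (@le_trans _ _ ((\sum_i complex.Re `|c i| * rnorm (A i x)) ^+ 2)).
  rewrite ler_sqr ?nnegrE ?rnorm_ge0 //; last first.
    by apply: sumr_ge0 => i _; rewrite mulr_ge0 ?rnorm_ge0 // -ler0c -normcRe.
  rewrite (le_trans (rnorm_sum _ _ _)) // ler_sum // => i _.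
  by rewrite bopZ_apply rnormZ.
apply: le_trans (sum_CauchySchwarz _ _) _.
rewrite -mulrA ler_wpM2l //.
have -> : \sum_i rnorm (A i x) ^+ 2 = rdot ((\sum_i adj (A i) *B A i) x) x.
  rewrite bop_sum_apply rdot_suml; apply: eq_bigr => i _.
  by rewrite /= -rdotxx /rdot adjPr.
rewrite (le_trans (rdot_le _ _)) // expr2 mulrA ler_wpM2r ?rnorm_ge0 //.
exact: opnormP.
Qed.

Lemma geometric_op_series E (u : nat -> bop E E) (t : R) N : 0 <= t -> t < 1 ->
  (forall q, (N <= q)%N -> opnorm (u q) <= t ^+ q) ->
  exists T, op_tends (series u) T.
Proof.
move=> t0 t1 ut; apply: bop_cauchy => e e0.
have t1' : 0 < 1 - t by rewrite subr_gt0.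
have [M hM] : exists M : nat, t ^+ M <= e * (1 - t).
  have e1 : 0 < e * (1 - t) by rewrite mulr_gt0.
  have := @cvg_expr R t; rewrite ger0_norm // => /(_ t1) /cvgrPdist_le /(_ _ e1).
  by case=> M _ /(_ M (leqnn M)); rewrite /= sub0r normrN ger0_norm ?exprn_ge0 //; exists M.
have part m k : (N <= m)%N -> (M <= m)%N ->
    opnorm (series u (m + k)%N - series u m) <= e.
  move=> Nm Mm.
  have -> : series u (m + k)%N - series u m = \sum_(m <= q < m + k) u q.
    rewrite !seriesEnat /= (big_cat_nat (leq0n m) (leq_addr k m)) /=.
    by rewrite addrAC subrr add0r.
  rewrite (le_trans (opnorm_sum _ _ _)) //.
  have hs : (\sum_(m <= q < m + k) opnorm (u q)) * (1 - t) <= t ^+ m - t ^+ (m + k).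
    elim: k => [|k IH]; first by rewrite addn0 big_geq // mul0r subrr.
    rewrite addnS big_nat_recr ?leq_addr //= mulrDl.
    have := ler_wpM2r (ltW t1') (ut (m + k)%N (leq_trans Nm (leq_addr _ _))).
    by move: IH; rewrite exprS mulrBr mulr1; lra.
  rewrite -(ler_pM2r t1') (le_trans hs) // (le_trans _ hM) //.
  rewrite (@le_trans _ _ (t ^+ m)) ?gerDl ?oppr_le0 ?exprn_ge0 //.
  by rewrite ler_wiXn2l // ltW.
exists (maxn N M) => m n; rewrite !geq_max => /andP[Nm Mm] /andP[Nn Mn].
case: (leqP m n) => mn.
  by rewrite -opnormN opprB -(subnKC mn) part.
by rewrite -(subnKC (ltnW mn)) part.
Qed.

Lemma fh_radius_bound n E (A : free_hol n E) (b : R) : 1 < b ->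
  exists N, forall q, (N <= q)%N ->
    opnorm (\sum_(a : q.-tuple 'I_n) adj (A a) *B A a) <= b ^+ (2 * q).
Proof.
move=> b1; have := fh_radius A.
set u := fun q : nat => _ => uA.
have : (limn_esup u < b%:E)%E by apply: le_lt_trans uA _; rewrite lte_fin.
move=> /ereal_inf_lt[_ [V [N _ NV] <-] Vb].
(* From index 1 on the exponent 1 / (2 q) is a genuine root and can be undone. *)
exists N.+1 => q Nq.
have : (u q <= b%:E)%E.
  apply: le_trans (ltW Vb); apply: ereal_sup_ubound; exists q => //.
  by apply: NV; apply: ltnW.
rewrite /u lee_fin; set B := opnorm _ => h.
have q0 : (2 * q)%:R != 0 :> R.
  by rewrite pnatr_eq0 muln_eq0 /= -lt0n (leq_trans _ Nq).
have B0 : 0 <= B by exact: opnorm_ge0.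
rewrite -[B]powRr1 // -(mulVf q0) powRrM powR_mulrn ?powR_ge0 //.
by rewrite lerXn2r ?nnegrE ?powR_ge0 // (le_trans ler01) // ltW.
Qed.

Lemma point_series_cvg n E (A : free_hol n E) (w : 'rV[R[i]]_n) : unit_ball w ->
  exists t N, [/\ 0 <= t, t < 1 & forall q, (N <= q)%N ->
    opnorm (\sum_(a : q.-tuple 'I_n) word_val w a *: A a) <= t ^+ q].
Proof.
move=> /unit_ball_sqn w1; have w0 := sqn_ge0 w.
pose s := Num.sqrt (sqn w).
have s0 : 0 <= s by rewrite sqrtr_ge0.
have s1 : s < 1 by rewrite -sqrtr1 ltr_sqrt.
have ss : s ^+ 2 = sqn w by rewrite sqr_sqrtr.
(* For s = |w| < 1 this b exceeds 1, as the bound on the coefficients requires, while the ratio s b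
   = 2 s / (1 + s) stays below 1. *)
pose b := 2 / (1 + s).
have p0 : 0 < 1 + s by lra.
have b1 : 1 < b by rewrite /b ltr_pdivlMr // mul1r; lra.
have b0 : 0 <= b by rewrite ltW // (lt_trans ltr01).
have [N hN] := fh_radius_bound A b1.
exists (s * b), N; split=> [||q Nq].
- exact: mulr_ge0.
- by rewrite /b mulrA ltr_pdivrMr // mul1r; lra.
rewrite -ler_sqr ?nnegrE ?opnorm_ge0 ?exprn_ge0 ?(mulr_ge0 s0 b0) //.
apply: le_trans (opnorm_comb _ _) _.
rewrite sum_word_val2 -ss -exprM mulnC exprM exprMn -!exprM mulnC.
rewrite exprMn -!exprM !(mulnC q) ler_wpM2l ?exprn_ge0 //.
by rewrite hN.
Qed.

End PointEvaluation.

(** * Operators that carry two points at once, and the values of F at them *)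

Section TwoPointOperator.
Context {R : realType} (G : hilbertType R) (t : R).
Implicit Types A B : bop G G.

(* The idempotent [l2_proj G t] commutes with diagonal operators, so this is
   multiplicative in (A, B): a polynomial or power series in such operators is
   evaluated at two points at once. *)
Definition l2_tri A B : bop (l2 G) (l2 G) :=
  l2_diag A *B (bid _ - l2_proj G t) + l2_diag B *B l2_proj G t.

Arguments l2_tri : simpl never.

Lemma l2_triE A B x : l2_tri A B x =
  l2_diag A (x - l2_proj G t x) + l2_diag B (l2_proj G t x).
Proof. by rewrite /l2_tri bopD_apply !bcompE bopB_apply. Qed.

Lemma l2_tri_proj A B x : l2_proj G t (l2_tri A B x) = l2_diag B (l2_proj G t x).
Proof.
by rewrite l2_triE bop_add -!l2_diag_proj bop_sub !l2_proj_idem subrr bop_zero add0r.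
Qed.

Lemma l2_diag_comp A A' x : l2_diag A (l2_diag A' x) = l2_diag (A *B A') x.
Proof. by apply: l2P. Qed.

Lemma l2_tri_comp A B A' B' :
  l2_tri A B *B l2_tri A' B' = l2_tri (A *B A') (B *B B').
Proof.
apply: bopP => x; rewrite bcompE l2_triE l2_tri_proj l2_triE addrK !l2_diag_comp.
by rewrite -l2_triE.
Qed.

Lemma l2_tri_id : l2_tri (bid G) (bid G) = bid (l2 G).
Proof.
apply: bopP => x; rewrite l2_triE.
have l2_diag_id y : l2_diag (bid G) y = y by apply: l2P.
by rewrite !l2_diag_id subrK.
Qed.

Lemma l2_tri_word k (A B : op_tuple k G) a :
  word_op (fun i => l2_tri (A i) (B i)) a = l2_tri (word_op A a) (word_op B a).
Proof.
elim: a => [|i a IH]; first by rewrite /= l2_tri_id.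
by rewrite /= IH l2_tri_comp.
Qed.

Lemma l2_triB A B A' B' : l2_tri A B - l2_tri A' B' = l2_tri (A - A') (B - B').
Proof.
apply: bopP => x; rewrite bopB_apply !l2_triE; apply: l2P => k.
by rewrite l2B !l2D !l2_diagE !bopB_apply opprD addrACA.
Qed.

Lemma l2_tri_scaleD (a : R[i]) A B A' B' :
  l2_tri (a *: A + A') (a *: B + B') = a *: l2_tri A B + l2_tri A' B'.
Proof.
apply: bopP => x; rewrite [RHS]bopD_apply [in RHS]bopZ_apply !l2_triE; apply: l2P => k.
by rewrite !(l2D, l2Z, l2_diagE) !bopD_apply !bopZ_apply scalerDr addrACA.
Qed.

Lemma l2_tri0 : l2_tri 0 0 = 0.
Proof. by rewrite -[in LHS](subrr 0) -l2_triB subrr. Qed.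

Lemma l2_tri_sum I (r : seq I) (A B : I -> bop G G) :
  l2_tri (\sum_(i <- r) A i) (\sum_(i <- r) B i) =
  \sum_(i <- r) l2_tri (A i) (B i).
Proof.
elim: r => [|i r IH]; first by rewrite !big_nil l2_tri0.
rewrite !big_cons -IH -[A i]scale1r -[B i]scale1r l2_tri_scaleD.
by rewrite !scale1r.
Qed.

Lemma opnorm_bcomp (K L M : hilbertType R) (S : bop L M) (T : bop K L) :
  opnorm (S *B T) <= opnorm S * opnorm T.
Proof.
apply: opnorm_le => [|x]; first by rewrite mulr_ge0 ?opnorm_ge0.
rewrite bcompE (le_trans (opnormP S (T x))) // -mulrA ler_wpM2l ?opnorm_ge0 //.
exact: opnormP.
Qed.

Lemma l2_tri_tends (A B : nat -> bop G G) (A' B' : bop G G) :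
  op_tends A A' -> op_tends B B' ->
  op_tends (fun n => l2_tri (A n) (B n)) (l2_tri A' B').
Proof.
move=> AA' BB' e e0.
pose P := l2_proj G t; pose Q := bid (l2 G) - P.
pose M := opnorm Q + opnorm P + 1.
have M0 : 0 < M by rewrite ltr_wpDl ?addr_ge0 ?opnorm_ge0.
have eM : 0 < e / M by rewrite divr_gt0.
have [[N1 h1] [N2 h2]] := (AA' _ eM, BB' _ eM).
exists (maxn N1 N2) => n; rewrite geq_max => /andP[/h1 An /h2 Bn].
rewrite l2_triB (le_trans (opnorm_tri _ _)) //.
have hQ := opnorm_bcomp (l2_diag (A n - A')) Q.
have hP := opnorm_bcomp (l2_diag (B n - B')) P.
have hA : opnorm (l2_diag (A n - A')) * opnorm Q <= e / M * opnorm Q.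
  by rewrite ler_wpM2r ?opnorm_ge0 // (le_trans (opnorm_l2_diag _)).
have hB : opnorm (l2_diag (B n - B')) * opnorm P <= e / M * opnorm P.
  by rewrite ler_wpM2r ?opnorm_ge0 // (le_trans (opnorm_l2_diag _)).
have : e / M * opnorm Q + e / M * opnorm P <= e.
  have -> : e / M * opnorm Q + e / M * opnorm P = e / M * (M - 1).
    by rewrite /M addrK mulrDr.
  by rewrite mulrAC ler_pdivrMr // ler_wpM2l ?(ltW e0) // gerBl.
by move=> h; apply: le_trans h; apply: lerD; [apply: le_trans hQ hA|apply: le_trans hP hB].
Qed.

End TwoPointOperator.

Section EvaluationAtTwoPoints.
Context {R : realType} (H E : hilbertType R) (HE : hilbert_tensor H E) (n : nat).

Definition point_series (A : free_hol n E) (w : 'rV[R[i]]_n) : nat -> bop HE HE :=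
  fun q => idten HE (\sum_(a : q.-tuple 'I_n) word_val w a *: A a).

Lemma point_series_tends (A : free_hol n E) (w : 'rV[R[i]]_n) : unit_ball w ->
  op_tends (series (point_series A w)) (fh_eval HE A (scalar_tuple H w)).
Proof.
move=> w1; have [t [N [t0 t1 hN]]] := point_series_cvg A w1.
have [|T hT] := @geometric_op_series R HE (point_series A w) t N t0 t1.
  by move=> q Nq; rewrite (le_trans (opnorm_idten _ _)) // hN.
suff -> : fh_eval HE A (scalar_tuple H w) = T by [].
rewrite /fh_eval; apply: op_tends_lim.
set s := series _; suff -> : s = series (point_series A w) by [].
rewrite /s; congr (series _); apply: funext => q.
rewrite /point_series idten_sum; apply: eq_bigr => a _.
by rewrite word_op_scalar op_tensor_scalar.
Qed.

Definition two_point_tuple (t : R) (z xi : 'rV[R[i]]_n) : op_tuple n (l2 H) :=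
  fun i => l2_tri t (scalar_tuple H z i) (scalar_tuple H xi i).

(** Under the identification of l^2(N; H) (x) E with l^2(N; H (x) E), the idempotent of l^2(N; H)
    tensored with 1 is the idempotent of l^2(N; H (x) E). *)
Lemma l2_tri_tensor t (c d : R[i]) (T : bop E E) :
  op_tensor (l2_tensor HE) (l2_tri t (c *: bid H) (d *: bid H)) T =
  l2_tri t (c *: idten HE T) (d *: idten HE T).
Proof.
apply: op_tensor_eq => x e.
have tenP (y : l2 H) : l2_proj HE t (l2_ten HE y e) = l2_ten HE (l2_proj H t y) e.
  apply: l2P => -[|[|j]]; rewrite l2_tenE !l2_projE /= ?linear0l //.
  by rewrite linearDl linearZl_LR.
have E1 : l2_tri t (c *: idten HE T) (d *: idten HE T) (l2_ten HE x e) =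
   l2_ten HE (l2_tri t (c *: bid H) (d *: bid H) x) (T e).
  apply: l2P => j; rewrite !l2_triE tenP l2D !l2_diagE l2B !l2_tenE.
  rewrite !bopZ_apply -linearBl !idtenE -!linearZl_LR -linearDl.
  by congr (ht_ten HE _ _); rewrite l2D !l2_diagE !bopZ_apply l2B.
exact: E1.
Qed.

(** By multiplicativity on words, each partial sum at the two-point tuple is the two-point operator
    of the partial sums at z and at xi; these converge, and [l2_tri] is continuous in the pair. *)
Lemma fh_eval_two_point t (A : free_hol n E) (z xi : 'rV[R[i]]_n) :
  unit_ball z -> unit_ball xi ->
  fh_eval (l2_tensor HE) A (two_point_tuple t z xi) =
  l2_tri t (fh_eval HE A (scalar_tuple H z)) (fh_eval HE A (scalar_tuple H xi)).
Proof.
move=> z1 xi1; apply: op_tends_lim.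
have := @l2_tri_tends _ _ t _ _ _ _ (point_series_tends A z1) (point_series_tends A xi1).
move=> lim e e0; have [N hN] := lim e e0; exists N => k Nk.
have seriesE (V : zmodType) (u : nat -> V) : series u k = \sum_(q <- index_iota 0 k) u q.
  by rewrite seriesEnat.
suff -> : series (fun q : nat => \sum_(a : q.-tuple 'I_n)
    op_tensor (l2_tensor HE) (word_op (two_point_tuple t z xi) a) (A a)) k =
    l2_tri t (series (point_series A z) k) (series (point_series A xi) k) by exact: hN.
rewrite !seriesE l2_tri_sum; apply: eq_bigr => q _.
rewrite /point_series !idten_sum l2_tri_sum; apply: eq_bigr => a _.
by rewrite -l2_tri_tensor -!word_op_scalar -l2_tri_word.
Qed.

End EvaluationAtTwoPoints.

(** * Matrix polynomials as quadratic forms; passage to the closed ball *)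

Section MatrixForms.
Context {R : realType}.
Implicit Types G H K : hilbertType R.

Definition mxform q K (P : 'M[bop K K]_q) (x : 'I_q -> K) : R[i] :=
  \sum_i \sum_j '[P i j (x j), x i].

Lemma half_ReE (a : R[i]) : 2^-1 * (a + Num.conj a) = (complex.Re a)%:C.
Proof.
case: a => a b; have -> : (2^-1 : R[i]) = (2^-1 : R)%:C by rewrite fmorphV rmorph_nat.
by apply/eqP; rewrite eq_complex /=; apply/andP; split; apply/eqP; field.
Qed.

Lemma mxform_re q K (P : 'M[bop K K]_q) x :
  mxform (mxop_re P) x = (complex.Re (mxform P x))%:C.
Proof.
rewrite -half_ReE [in RHS]/mxform; set S := \sum_i \sum_j '[P i j (x j), x i].
have -> : Num.conj S = \sum_i \sum_j '[adj (P j i) (x j), x i].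
  rewrite /S exchange_big rmorph_sum /=; apply: eq_bigr => j _.
  rewrite rmorph_sum /=; apply: eq_bigr => i _.
  by rewrite adjPr -hdotC.
rewrite /S -big_split mulr_sumr /mxform /=; apply: eq_bigr => i _.
rewrite -big_split mulr_sumr /=; apply: eq_bigr => j _.
by rewrite mxE bopZ_apply bopD_apply hdotZl hdotDl.
Qed.

Lemma mxop_leE q K (P Q : 'M[bop K K]_q) (c : R) :
  mxop_le (mxop_re P) (map_mx (fun T => c%:C *: T) (mxop_re Q)) <->
  forall x, complex.Re (mxform P x) <= c * complex.Re (mxform Q x).
Proof.
have E x : \sum_i \sum_j '[(map_mx (fun T => c%:C *: T) (mxop_re Q) - mxop_re P) i j (x j), x i] =
    (c * complex.Re (mxform Q x) - complex.Re (mxform P x))%:C.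
  rewrite rmorphB rmorphM /= -!mxform_re /mxform mulr_sumr -sumrB.
  move: (mxop_re P) (mxop_re Q) => MP MQ.
  apply: eq_bigr => i _; rewrite mulr_sumr -sumrB; apply: eq_bigr => j _.
  by rewrite !mxE bopB_apply hdotDl hdotNl bopZ_apply hdotZl.
by split=> h x; have := h x; rewrite ?E ?lecR ?subr_ge0.
Qed.

Lemma mxop_ge0E q K (P : 'M[bop K K]_q) :
  mxop_le 0 (mxop_re P) <-> forall x, 0 <= complex.Re (mxform P x).
Proof.
have E x : \sum_i \sum_j '[(mxop_re P - 0) i j (x j), x i] =
    (complex.Re (mxform P x))%:C by rewrite subr0 -mxform_re.
by split=> h x; have := h x; rewrite ?E ?lecR.
Qed.

Lemma nc_eval_apply k q (p : ncpoly k q) K (X : op_tuple k K) i j y :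
  nc_eval p X i j y = \sum_(a <- finsupp p) p a i j *: word_op X a y.
Proof.
rewrite /nc_eval summxE bop_sum_apply; apply: eq_bigr => a _.
by rewrite mxE bopZ_apply.
Qed.

Lemma mxform_nc_eval k q (p : ncpoly k q) K (X : op_tuple k K) x :
  mxform (nc_eval p X) x = \sum_(a <- finsupp p) \sum_i \sum_j
    p a i j * '[word_op X a (x j), x i].
Proof.
rewrite exchange_big; apply: eq_bigr => i _.
rewrite exchange_big; apply: eq_bigr => j _.
rewrite nc_eval_apply hdot_suml; apply: eq_bigr => a _.
by rewrite hdotZl.
Qed.

Definition scale_tuple k K (s : R) (X : op_tuple k K) : op_tuple k K :=
  fun i => s%:C *: X i.

Lemma word_op_scale_tuple k K s (X : op_tuple k K) a :
  word_op (scale_tuple s X) a = (s ^+ size a)%:C *: word_op X a.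
Proof.
elim: a => [|i a IH]; first by rewrite /= expr0 scale1r.
apply: bopP => x; rewrite /= IH bopZ_apply bop_scale scalerA.
by rewrite exprS rmorphM.
Qed.

Lemma scale_tuple_open k K s (X : op_tuple k K) : 0 < s -> s < 1 ->
  closed_ball_op X -> open_ball_op (scale_tuple s X).
Proof.
move=> s0 s1 /closed_ball_adj X1; apply: (@open_ball_adj _ _ _ _ (s ^+ 2)).
- by rewrite exprn_gt0.
- by rewrite expr_lt1 // ltW.
move=> x; apply: le_trans (ler_wpM2l (sqr_ge0 s) (X1 x)).
rewrite mulr_sumr ler_sum // => i _.
by rewrite adjZ conj_real bopZ_apply rnormZr exprMn real_normK ?num_real.
Qed.

Lemma expr_ge_bernoulli (s : R) m : 0 <= s -> s <= 1 -> 1 - s ^+ m <= m%:R * (1 - s).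
Proof.
move=> s0 s1; elim: m => [|m IH]; first by rewrite expr0 subrr mul0r.
have : s ^+ m <= 1 by rewrite exprn_ile1.
have := exprn_ge0 m s0; rewrite exprS -natr1; nra.
Qed.

(** Positivity is assumed on the open ball, but F maps the two-point tuple only into the closed one.
    It is applied to s X with s tending to 1; Bernoulli's inequality bounds the loss by (1 - s)
    C. *)
Lemma nc_re_nonneg_closed k q (p : ncpoly k q) K (X : op_tuple k K) x :
  nc_re_nonneg p -> infinite_dim K -> closed_ball_op X ->
  0 <= complex.Re (mxform (nc_eval p X) x).
Proof.
move=> pp iK X1; rewrite mxform_nc_eval Re_sum.
pose c a := \sum_i \sum_j p a i j * '[word_op X a (x j), x i].
rewrite -/(c _); under eq_bigr do rewrite -/(c _).
have h s : 0 < s -> s < 1 -> 0 <= \sum_(a <- finsupp p) s ^+ size a * complex.Re (c a).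
  move=> s0 s1; have := (mxop_ge0E _).1 (pp _ _ iK (scale_tuple_open s0 s1 X1)) x.
  rewrite mxform_nc_eval Re_sum; congr (_ <= _); apply: eq_bigr => a _.
  rewrite -ReMl; congr complex.Re; rewrite /c mulr_sumr; apply: eq_bigr => i _.
  rewrite mulr_sumr; apply: eq_bigr => j _.
  by rewrite word_op_scale_tuple bopZ_apply hdotZl mulrCA.
pose C := \sum_(a <- finsupp p) (size a)%:R * `|complex.Re (c a)|.
have C0 : 0 <= C by apply: sumr_ge0 => a _; rewrite mulr_ge0.
have key s : 0 < s -> s < 1 ->
    - ((1 - s) * C) <= \sum_(a <- finsupp p) complex.Re (c a).
  move=> s0 s1; have := h s s0 s1; rewrite lerNl => h0.
  suff : \sum_(a <- finsupp p) s ^+ size a * complex.Re (c a) -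
      \sum_(a <- finsupp p) complex.Re (c a) <= (1 - s) * C by lra.
  rewrite -sumrB mulr_sumr ler_sum // => a _.
  have := expr_ge_bernoulli (size a) (ltW s0) (ltW s1).
  have : s ^+ size a <= 1 by rewrite exprn_ile1 // ltW.
  have := ler_norm (- complex.Re (c a)); rewrite normrN.
  have := normr_ge0 (complex.Re (c a)).
  move: (complex.Re (c a)) `|_| (s ^+ _) => r u v u0 ru v1 vb.
  have : (1 - v) * - r <= (1 - v) * u by rewrite ler_wpM2l // subr_ge0.
  have : (1 - v) * u <= (size a)%:R * (1 - s) * u by rewrite ler_wpM2r.
  lra.
apply/ler_addgt0Pl => e e0.
have C1 : 0 < 2 * (C + 1) by rewrite mulr_gt0 // ltr_wpDl.
(* The first term makes the loss (1 - s) C at most e; the second keeps s positive. *)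
pose s := 1 - Num.min (e / (2 * (C + 1))) (2^-1).
have m0 : 0 < Num.min (e / (2 * (C + 1))) (2^-1) by rewrite lt_min divr_gt0 //= invr_gt0.
have m1 : Num.min (e / (2 * (C + 1))) (2^-1) <= 2^-1 by rewrite ge_min lexx orbT.
have m2 : Num.min (e / (2 * (C + 1))) (2^-1) * (2 * (C + 1)) <= e.
  by rewrite -ler_pdivlMr // ge_min lexx.
have s0 : 0 < s by rewrite /s; lra.
have s1 : s < 1 by rewrite /s; lra.
have := key s s0 s1; rewrite [1 - s](_ : _ = Num.min (e / (2 * (C + 1))) (2^-1)).
  move: (Num.min _ _) m0 m2 => w w0 w2.
  have : 0 <= w * C by rewrite mulr_ge0 // ltW.
  lra.
by rewrite /s opprB addrC subrK.
Qed.

End MatrixForms.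

(** * The Gram form of the dilation, and domination of one tuple by another *)

Section Trees.
Context {R : realType}.
Implicit Types G H K : hilbertType R.

(** The sum of X_a (g a) over the words a of length at most d, organized by first letters. For the
    isometries of a dilation and g with values in the embedded space, these sums exhaust the span of
    the words. *)
Fixpoint tree_sum k K (X : op_tuple k K) (d : nat) (g : seq 'I_k -> K) : K :=
  if d is d'.+1 then
    g [::] + \sum_i X i (tree_sum X d' (fun a => g (i :: a)))
  else g [::].

(* The form of [|tree_sum|^2] when the X i are isometries with orthogonal ranges;
   for a general X it is [|tree_sum|^2] computed in a dilation (tree_form_emb). *)
Fixpoint tree_form k K (X : op_tuple k K) (d : nat) (g : seq 'I_k -> K) : R :=
  if d is d'.+1 then
    rnorm (g [::]) ^+ 2
    + 2 * \sum_i rdot (X i (tree_sum X d' (fun a => g (i :: a)))) (g [::])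
    + \sum_i tree_form X d' (fun a => g (i :: a))
  else rnorm (g [::]) ^+ 2.

(** The two expansions differ only in that the form has \sum_i |x_i|^2 where the norm has |\sum_i
    X_i x_i|^2, and for a row contraction the latter is smaller. *)
Lemma tree_form_ge k K (X : op_tuple k K) d g : closed_ball_op X ->
  rnorm (tree_sum X d g) ^+ 2 <= tree_form X d g.
Proof.
move=> /closed_ball_opP X1; elim: d g => [|d IH] g //=.
rewrite rnorm2D rdot_sumr.
have := X1 (fun i => tree_sum X d (fun a => g (i :: a))).
have : \sum_i rnorm (tree_sum X d (fun a => g (i :: a))) ^+ 2 <=
       \sum_i tree_form X d (fun a => g (i :: a)) by apply: ler_sum => i _.
rewrite [X in _ -> _ -> _ + 2 * X + _ <= _](eq_bigr _ (fun i _ => rdotC _ _)).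
lra.
Qed.

Section Witness.
Context (k : nat) (G K : hilbertType R) (A B : op_tuple k G) (Y : op_tuple k K).
Context (M1 M2 : bop G K) (p1 p2 : R).
Context (YM1 : forall i g, Y i (M1 g) = M1 (A i g)).
Context (YM2 : forall i g, Y i (M2 g) = M2 (B i g)).
Context (M1E : forall g h, '[M1 g, (M1 + M2) h] = p1%:C * '[g, h]).
Context (M2E : forall g h, '[M2 g, (M1 + M2) h] = p2%:C * '[g, h]).
Context (Y1 : closed_ball_op Y).

Lemma witness_word a g : word_op Y a ((M1 + M2) g) =
  M1 (word_op A a g) + M2 (word_op B a g).
Proof. by elim: a => [//|i a IH]; rewrite /= IH bop_add YM1 YM2. Qed.

Lemma witness_mxform q (p : ncpoly k q) x :
  mxform (nc_eval p Y) (fun i => (M1 + M2) (x i)) =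
  p1%:C * mxform (nc_eval p A) x + p2%:C * mxform (nc_eval p B) x.
Proof.
rewrite !mxform_nc_eval !mulr_sumr -big_split /=; apply: eq_bigr => a _.
rewrite !mulr_sumr -big_split /=; apply: eq_bigr => i _.
rewrite !mulr_sumr -big_split /=; apply: eq_bigr => j _.
by rewrite witness_word hdotDl M1E M2E; ring.
Qed.

Lemma witness_tree_sum d g : tree_sum Y d (fun a => (M1 + M2) (g a)) =
  M1 (tree_sum A d g) + M2 (tree_sum B d g).
Proof.
elim: d g => [//|d IH] g; rewrite [LHS]/=.
under eq_bigr do rewrite (IH (fun a => g (_ :: a))) bop_add YM1 YM2.
by rewrite big_split /= !bop_add !bop_sum addrACA.
Qed.

Lemma witness_tree_form d g : tree_form Y d (fun a => (M1 + M2) (g a)) =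
  p1 * tree_form A d g + p2 * tree_form B d g.
Proof.
have nE h : rnorm ((M1 + M2) h) ^+ 2 = (p1 + p2) * rnorm h ^+ 2.
  rewrite -!rdotxx /rdot [X in '[X, _]]bopD_apply hdotDl M1E M2E -mulrDl -rmorphD.
  by rewrite ReMl.
elim: d g => [|d IH] g; rewrite [LHS]/= nE; first by rewrite mulrDl.
under [X in _ + 2 * X + _]eq_bigr do rewrite (witness_tree_sum _ (fun a => g (_ :: a)))
  bop_add YM1 YM2 /rdot hdotDl M1E M2E ReD !ReMl.
under [X in _ + X]eq_bigr do rewrite (IH (fun a => g (_ :: a))).
rewrite !big_split /= -!mulr_sumr /rdot; ring.
Qed.

(** Only the sum has a sign. In the application p2 is negative, so that positivity at Y becomes
    domination of B by A. *)
Lemma witness_mxform_ge0 q (p : ncpoly k q) x : nc_re_nonneg p -> infinite_dim K ->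
  0 <= p1 * complex.Re (mxform (nc_eval p A) x) +
       p2 * complex.Re (mxform (nc_eval p B) x).
Proof.
move=> pp iK; rewrite -!ReMl -ReD -witness_mxform.
exact: nc_re_nonneg_closed.
Qed.

Lemma witness_tree_form_ge0 d g : 0 <= p1 * tree_form A d g + p2 * tree_form B d g.
Proof.
by rewrite -witness_tree_form (le_trans _ (tree_form_ge _ _ Y1)) // sqr_ge0.
Qed.

End Witness.

(* The first half gives the Harnack relation, the second the intertwiner between
   the minimal isometric dilations. *)
Definition dominated k G (C : R) (A B : op_tuple k G) :=
  (forall q (p : ncpoly k q) x, nc_re_nonneg p ->
     complex.Re (mxform (nc_eval p B) x) <= C * complex.Re (mxform (nc_eval p A) x)) /\
  (forall d g, tree_form B d g <= C * tree_form A d g).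

Lemma l2_diag_two G (A : bop G G) u v : l2_diag A (l2_two u v) = l2_two (A u) (A v).
Proof. by apply: l2P => -[|[|j]]; rewrite l2_diagE !l2_twoE ?bop_zero. Qed.

Lemma l2_two_bounded G (a b : R) : exists M : R, forall g : G,
  rnorm (l2_two (a%:C *: g) (b%:C *: g)) <= M * rnorm g.
Proof.
exists (`|a| + `|b|) => g.
rewrite -ler_sqr ?nnegrE ?rnorm_ge0 ?mulr_ge0 ?addr_ge0 ?rnorm_ge0 //.
rewrite l2_two_rnorm2 !rnormZr !exprMn -mulrDl ler_wpM2r ?sqr_ge0 // sqrrD.
have : 0 <= `|a| * `|b| by rewrite mulr_ge0.
lra.
Qed.

Lemma l2_two_lin G (a b : R) : linear (fun g : G => l2_two (a%:C *: g) (b%:C *: g)).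
Proof.
move=> c g h; rewrite -l2_two_linear; congr l2_two;
by rewrite scalerDr !scalerA (mulrC c).
Qed.

Definition l2_pair G (a b : R) : bop G (l2 G) := Bop (@l2_two_lin G a b) (l2_two_bounded G a b).

Lemma l2_pairE G a b (g : G) : l2_pair G a b g = l2_two (a%:C *: g) (b%:C *: g).
Proof. by []. Qed.

Lemma l2_pairD G a b a' b' : l2_pair G a b + l2_pair G a' b' = l2_pair G (a + a') (b + b').
Proof.
apply: bopP => g; rewrite bopD_apply !l2_pairE; apply: l2P => -[|[|j]];
by rewrite l2D !l2_twoE ?addr0 // -scalerDl -rmorphD.
Qed.

Lemma l2_pair_dot G a b a' b' (g h : G) :
  '[l2_pair G a b g, l2_pair G a' b' h] = (a * a' + b * b')%:C * '[g, h].
Proof.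
rewrite !l2_pairE l2_two_hdot !l2_twoE !hdotZl !hdotZr !conj_real !mulrA.
by rewrite -!rmorphM -mulrDl -rmorphD.
Qed.

(** M1 = (1, - t) maps into the kernel of the idempotent and M2 = (0, t - mu) into its range, where
    the two-point tuple acts as A and as B. The two are not orthogonal, whence the negative
    coefficient of B. *)
Lemma l2_tri_dominated k G (s : R) (A B : op_tuple k G) :
  1 < s -> infinite_dim (l2 G) ->
  closed_ball_op (fun i => l2_tri (Num.sqrt (s ^+ 2 - 1)) (A i) (B i)) ->
  dominated ((s + 1) / (s - 1)) A B.
Proof.
move=> s1 iG Y1; set t := Num.sqrt _ in Y1.
have t2 : t ^+ 2 = s ^+ 2 - 1 by rewrite sqr_sqrtr //; nra.
have t0 : 0 < t by rewrite sqrtr_gt0; nra.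
(* For M = (1, - mu) the test gives the constant (1 + t mu) / (mu (t - mu)). This mu is its
   minimizer on (0, t), and the minimum is (s + 1) / (s - 1). *)
pose mu := (s - 1) / t; have tmu : t * mu = s - 1 by rewrite mulrC divfK // gt_eqF.
pose M1 := l2_pair G 1 (- t); pose M2 := l2_pair G 0 (t - mu).
have M12 : M1 + M2 = l2_pair G 1 (- mu).
  by rewrite l2_pairD; congr l2_pair; ring.
have muq : mu * (t - mu) = s * (s - 1) / (s + 1).
  apply: (mulfI (x := t ^+ 2)); first by rewrite gt_eqF // exprn_gt0.
  have -> : t ^+ 2 * (mu * (t - mu)) = (t * mu) * (t ^+ 2 - t * mu) by ring.
  by rewrite tmu t2; field; lra.
have p1E : 1 * 1 + - t * - mu = s by rewrite mulrNN tmu; ring.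
have p2E : 0 * 1 + (t - mu) * - mu = - (s * (s - 1) / (s + 1)) by rewrite -muq; ring.
have M1E g h : '[M1 g, (M1 + M2) h] = s%:C * '[g, h].
  by rewrite M12 l2_pair_dot p1E.
have M2E g h : '[M2 g, (M1 + M2) h] = (- (s * (s - 1) / (s + 1)))%:C * '[g, h].
  by rewrite M12 l2_pair_dot p2E.
have PM1 g : l2_proj G t (M1 g) = 0.
  rewrite l2_projE !l2_pairE !l2_twoE; apply: l2P => -[|[|j]] //.
  by rewrite l2_twoE l20 scalerA mulr1 -scalerDl -rmorphD subrr scale0r.
have PM2 g : l2_proj G t (M2 g) = M2 g.
  rewrite l2_projE !l2_pairE !l2_twoE; apply: l2P => -[|[|j]] //; rewrite !l2_twoE.
    by rewrite scale0r.
  by rewrite scale0r scaler0 add0r.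
have YM1 i g : l2_tri t (A i) (B i) (M1 g) = M1 (A i g).
  rewrite l2_triE PM1 subr0 bop_zero addr0 l2_pairE l2_diag_two.
  by rewrite !bop_scale.
have YM2 i g : l2_tri t (A i) (B i) (M2 g) = M2 (B i g).
  rewrite l2_triE PM2 subrr bop_zero add0r l2_pairE l2_diag_two.
  by rewrite !bop_scale.
have fin a b : 0 <= s * a + - (s * (s - 1) / (s + 1)) * b -> b <= (s + 1) / (s - 1) * a.
  have -> : s * a + - (s * (s - 1) / (s + 1)) * b =
     s * (s - 1) / (s + 1) * ((s + 1) / (s - 1) * a - b) by field; lra.
  rewrite pmulr_rge0 ?subr_ge0 // divr_gt0 ?mulr_gt0 //; lra.
split=> [q p x pp|d g]; apply: fin.
  exact: (witness_mxform_ge0 YM1 YM2 M1E M2E Y1).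
exact: (witness_tree_form_ge0 YM1 YM2 M1E M2E Y1).
Qed.

End Trees.

(** * Geometry of the unit ball and of its involutions *)

Section BallGeometry.
Context {R : realType} {n : nat}.
Implicit Types a u v w z xi : 'rV[R[i]]_n.

Lemma Re_normc2 (c : R[i]) :
  complex.Re `|c| ^+ 2 = complex.Re c ^+ 2 + complex.Im c ^+ 2.
Proof.
by case: c => a b; rewrite normc_def /= sqr_sqrtr // addr_ge0 ?sqr_ge0.
Qed.

Lemma Re_normc_ge0 (c : R[i]) : 0 <= complex.Re `|c|.
Proof. by rewrite -ler0c -normcRe. Qed.

Lemma cdotDl u v w : cdot (u + v) w = cdot u w + cdot v w.
Proof. by rewrite -big_split; apply: eq_bigr => i _; rewrite mxE mulrDl. Qed.

Lemma cdotZl c u w : cdot (c *: u) w = c * cdot u w.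
Proof. by rewrite mulr_sumr; apply: eq_bigr => i _; rewrite mxE mulrA. Qed.

Lemma cdotC u w : cdot u w = Num.conj (cdot w u).
Proof.
by rewrite rmorph_sum; apply: eq_bigr => i _; rewrite rmorphM /= conjCK mulrC.
Qed.

Lemma cdotDr u v w : cdot w (u + v) = cdot w u + cdot w v.
Proof. by rewrite cdotC cdotDl rmorphD /= -!cdotC. Qed.

Lemma cdotZr c u w : cdot w (c *: u) = Num.conj c * cdot w u.
Proof. by rewrite cdotC cdotZl rmorphM /= -cdotC. Qed.

Lemma cdotxx u : cdot u u = (sqn u)%:C.
Proof. by rewrite rmorph_sum; apply: eq_bigr => i _; rewrite normc2. Qed.

Lemma sqn_lin (c : R[i]) u v : sqn (c *: u + v) =
  complex.Re `|c| ^+ 2 * sqn u + 2 * complex.Re (c * cdot u v) + sqn v.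
Proof.
have sqnE (x : 'rV[R[i]]_n) : sqn x = complex.Re (cdot x x) by rewrite cdotxx.
rewrite !sqnE !(cdotDl, cdotDr, cdotZl, cdotZr) (cdotC v u) !cdotxx Re_normc2.
by case: c => c1 c2; case: (cdot u v) => p1 p2 /=; ring.
Qed.

Lemma sqnZ (c : R[i]) u : sqn (c *: u) = complex.Re `|c| ^+ 2 * sqn u.
Proof. by rewrite mulr_sumr; apply: eq_bigr => i _; rewrite mxE normrM ReM
  [in LHS]normcRe /= mul0r subr0 exprMn. Qed.

Lemma sqn_eq0 u : sqn u = 0 -> u = 0.
Proof.
move=> u0; apply/rowP => i; rewrite mxE; apply/eqP; rewrite -normr_eq0 normcRe.
have /psumr_eq0P := u0; move=> /(_ (fun j _ => sqr_ge0 _)) /(_ i isT) /eqP.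
by rewrite sqrf_eq0 => /eqP ->.
Qed.

Lemma sqnB z xi : sqn (xi - z) = sqn xi - 2 * complex.Re (cdot xi z) + sqn z.
Proof.
have := sqn_lin (-1) z xi; rewrite scaleN1r normrN1 expr1n mul1r mulN1r ReN addrC.
by rewrite (cdotC xi) Re_conj => ->; ring.
Qed.

(** The reciprocal of the squared modulus of the kernel 1 / (1 - <xi, z>) of the ball. *)
Definition pole z xi : R := complex.Re `|1 - cdot xi z| ^+ 2.

(** The right-hand side is visibly nonnegative in the ball, and it is the combination of |xi - z|^2
    and <xi - z, z> that occurs in the determinant deciding whether the two-point tuple is
    strict. *)
Lemma pole_split z xi : pole z xi - (1 - sqn z) * (1 - sqn xi) =
  (1 - sqn z) * sqn (xi - z) + complex.Re `|cdot (xi - z) z| ^+ 2.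
Proof.
rewrite /pole sqnB cdotDl (_ : cdot (- z) z = - (sqn z)%:C); last first.
  by rewrite -scaleN1r cdotZl cdotxx mulN1r.
rewrite !Re_normc2; case: (cdot xi z) => p1 p2 /=; ring.
Qed.

Lemma poleC z xi : pole z xi = pole xi z.
Proof.
by rewrite /pole (cdotC xi z) !Re_normc2; case: (cdot z xi) => p1 p2 /=; ring.
Qed.

Lemma pole_gt0 z xi : sqn z < 1 -> sqn xi < 1 -> 0 < pole z xi.
Proof.
move=> z1 xi1; rewrite -(subr0 (pole _ _)).
have : 0 <= (1 - sqn z) * sqn (xi - z) + complex.Re `|cdot (xi - z) z| ^+ 2.
  by rewrite addr_ge0 ?sqr_ge0 ?mulr_ge0 ?sqn_ge0 // subr_ge0 ltW.
have : 0 < (1 - sqn z) * (1 - sqn xi) by rewrite mulr_gt0 // subr_gt0.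
by have := pole_split z xi; lra.
Qed.

(** The numerator v of phi_z(xi) is a multiple of z plus a multiple of the component of xi
    orthogonal to z, so its norm follows from Pythagoras. The point z = 0 is separate because the
    projection is then 0 by convention. *)
Lemma sqn_ball_aut z xi : sqn z < 1 -> sqn xi < 1 ->
  sqn (ball_aut z xi) = 1 - (1 - sqn z) * (1 - sqn xi) / pole z xi.
Proof.
move=> z1 xi1; have D0 := pole_gt0 z1 xi1.
rewrite /ball_aut sqnZ; set v := z - _ - _.
suff -> : sqn v = pole z xi - (1 - sqn z) * (1 - sqn xi).
  have -> : complex.Re `|(1 - cdot xi z)^-1| ^+ 2 = (pole z xi)^-1.
    rewrite /pole normfV [in LHS]normcRe -fmorphV /= exprVn.
    by [].
  by rewrite mulrBr mulVf ?gt_eqF // mulrC.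
have s2 : complex.Re `|defect z| ^+ 2 = 1 - sqn z.
  rewrite /defect cdotxx Re_normc2 /= expr0n addr0 sqr_sqrtr //.
  by rewrite subr_ge0 ltW.
have [z0|z0] := eqVneq z 0.
  have n0 : sqn z = 0 by rewrite z0 /sqn big1 // => i _; rewrite mxE normr0 expr0n.
  have p0 : cdot xi z = 0 by rewrite z0 /cdot big1 // => i _; rewrite mxE rmorph0 mulr0.
  rewrite /v /proj_line z0 eqxx !subr0 sub0r -scaleNr sqnZ normrN -z0 s2.
  by rewrite /pole p0 subr0 normr1 expr1n n0; ring.
have nz : sqn z != 0 by apply: contra z0 => /eqP /sqn_eq0 ->.
pose l := cdot xi z / (sqn z)%:C.
have lE : cdot xi z = l * (sqn z)%:C.
  by rewrite divfK // eq_complex /= eqxx andbT.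
have -> : v = (1 - l) *: z + (- defect z) *: (xi + (- l) *: z).
  rewrite /v /proj_line (negPf z0) cdotxx -/l scalerBl scale1r.
  by rewrite !scaleNr.
have orth : cdot z (xi + (- l) *: z) = 0.
  rewrite cdotDr cdotZr cdotxx cdotC lE rmorphM rmorphN /= conj_real.
  by rewrite mulNr subrr.
rewrite sqn_lin cdotZr orth !mulr0 addr0 sqnZ normrN s2.
rewrite [xi + _]addrC sqn_lin (cdotC z xi) /pole lE !Re_normc2.
by case: l {lE orth} => l1 l2 /=; ring.
Qed.

Lemma sqn_ball_aut_lt1 z xi : sqn z < 1 -> sqn xi < 1 ->
  0 <= sqn (ball_aut z xi) < 1.
Proof.
move=> z1 xi1; rewrite sqn_ge0 sqn_ball_aut //= ltrBlDr ltrDl.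
by rewrite divr_gt0 ?pole_gt0 // mulr_gt0 // subr_gt0.
Qed.

End BallGeometry.

(** * Strictness of the two-point tuple *)

Section TwoPointBall.
Context {R : realType} {n : nat} (H : hilbertType R).
Implicit Types z xi : 'rV[R[i]]_n.

Lemma quad_ge0 (A B c a b : R) : 0 < A -> c ^+ 2 <= A * B ->
  0 <= A * a ^+ 2 - 2 * c * a * b + B * b ^+ 2.
Proof.
move=> A0 cAB; rewrite -(pmulr_rge0 _ A0).
have -> : A * (A * a ^+ 2 - 2 * c * a * b + B * b ^+ 2) =
  (A * a - c * b) ^+ 2 + (A * B - c ^+ 2) * b ^+ 2 by ring.
by rewrite addr_ge0 ?sqr_ge0 // mulr_ge0 ?sqr_ge0 // subr_ge0.
Qed.

Lemma two_point_adj t z xi i (x : l2 H) : adj (two_point_tuple H t z xi i) x =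
  Num.conj (xi 0 i - z 0 i) *: adj (l2_proj H t) x + Num.conj (z 0 i) *: x.
Proof.
have -> : two_point_tuple H t z xi i =
    (xi 0 i - z 0 i) *: l2_proj H t + z 0 i *: bid (l2 H).
  apply: bopP => y; rewrite /two_point_tuple l2_triE.
  rewrite bopD_apply !bopZ_apply bidE scalerBl.
  apply: l2P => j; rewrite !(l2D, l2B, l2Z, l2_diagE) !bopZ_apply !bidE.
  by rewrite !scaleN1r scalerBr addrC addrA [RHS]addrAC.
by rewrite adj_addZ bopD_apply adjZ adj_id !bopZ_apply.
Qed.

Lemma two_point_row t z xi (x : l2 H) :
  \sum_i rnorm (adj (two_point_tuple H t z xi i) x) ^+ 2 =
  sqn (xi - z) * ((t ^+ 2 + 1) * rnorm (x 1%N) ^+ 2)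
  + 2 * (t * rdot (cdot (xi - z) z *: x 0%N) (x 1%N)
         + complex.Re (cdot (xi - z) z) * rnorm (x 1%N) ^+ 2)
  + sqn z * rnorm x ^+ 2.
Proof.
set c := cdot _ _; set P := adj (l2_proj H t) x.
have P2 : rnorm P ^+ 2 = (t ^+ 2 + 1) * rnorm (x 1%N) ^+ 2.
  by rewrite /P l2_proj_adj l2_two_rnorm2 rnormZr exprMn real_normK ?num_real // mulrDl mul1r.
have Px : '[x, P] = t%:C * '[x 0%N, x 1%N] + '[x 1%N, x 1%N].
  by rewrite /P l2_proj_adj l2_two_hdot hdotZr conj_real.
transitivity (\sum_i (complex.Re `|(xi - z) 0 i| ^+ 2 * rnorm P ^+ 2 +
   2 * complex.Re (((xi - z) 0 i * Num.conj (z 0 i)) * '[x, P]) +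
   complex.Re `|z 0 i| ^+ 2 * rnorm x ^+ 2)).
  apply: eq_bigr => i _; rewrite two_point_adj -/P rnorm2D !rnorm2Z !norm_conjC !mxE.
  congr (_ + 2 * _ + _); rewrite rdotC /rdot hdotZl hdotZr conjCK mulrA.
  by rewrite (mulrC (Num.conj (z 0 i))).
rewrite !big_split /= -!mulr_suml -mulr_sumr -Re_sum -mulr_suml P2; congr (_ + 2 * _ + _).
rewrite -/(cdot _ _) -/c Px mulrDr ReD hdotxx mulrCA ReMl /rdot hdotZl; congr (_ + _).
by rewrite ReM /= mulr0 subr0.
Qed.

(** With a and b the norms of coordinates 0 and 1, the gap between |x|^2 and the row form is at
    least A1 a^2 - 2 t g a b + B1 b^2, whose determinant f is positive by the hypothesis on t. *)
Lemma two_point_open (t : R) z xi : 0 <= t -> sqn z < 1 -> sqn xi < 1 ->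
  t ^+ 2 * (pole z xi - (1 - sqn z) * (1 - sqn xi)) < (1 - sqn z) * (1 - sqn xi) ->
  open_ball_op (two_point_tuple H t z xi).
Proof.
move=> t0 z1 xi1; rewrite pole_split.
set c := cdot _ _; set d := sqn (xi - z); set nz := sqn z; set nx := sqn xi.
have z0 : 0 <= nz := sqn_ge0 z; have x0 : 0 <= nx := sqn_ge0 xi.
have d0 : 0 <= d := sqn_ge0 _.
have nxE : nx = nz + 2 * complex.Re c + d.
  rewrite /c cdotDl (_ : cdot (- z) z = - (sqn z)%:C); last first.
    by rewrite -scaleN1r cdotZl cdotxx mulN1r.
  by rewrite ReD ReN /d sqnB /nz /nx /=; ring.
set g := complex.Re `|c|; have g0 : 0 <= g := Re_normc_ge0 c.
move=> hf; pose A1 := 1 - nz; pose B1 := 1 - nx - d * t ^+ 2.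
pose f := A1 * B1 - t ^+ 2 * g ^+ 2.
have f0 : 0 < f by rewrite /f /A1 /B1; move: hf; rewrite /d; lra.
have A10 : 0 < A1 by rewrite subr_gt0.
(* Subtracting e from both diagonal entries lowers the determinant by at most e (A1 + B1) <= 2 e,
   which e <= f / 2 allows; e <= A1 / 2 keeps the first entry positive. *)
pose e := Num.min (f / 2) (A1 / 2).
have e0 : 0 < e by rewrite lt_min !divr_gt0.
have ef : e <= f / 2 by rewrite ge_min lexx.
have eA : e <= A1 / 2 by rewrite ge_min lexx orbT.
clearbody e.
have dt0 : 0 <= d * t ^+ 2 by rewrite mulr_ge0 ?sqr_ge0.
apply: (@open_ball_adj _ _ _ _ (1 - e)).
- by move: eA; rewrite /A1; lra.
- by lra.
move=> x; rewrite two_point_row -/c -/d -/nz.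
have hx := l2_rnorm2_two x.
set a := rnorm (x 0%N) in hx *; set b := rnorm (x 1%N) in hx *.
have hc : rdot (c *: x 0%N) (x 1%N) <= g * a * b.
  by rewrite (le_trans (rdot_le _ _)) // rnormZ.
have htc := ler_wpM2l t0 hc.
have Ae : 0 < 1 - e - nz by move: eA; rewrite /A1 in A10 *; lra.
have AB : (t * g) ^+ 2 <= (1 - e - nz) * (1 - e - nx - d * t ^+ 2).
  rewrite exprMn.
  have -> : (1 - e - nz) * (1 - e - nx - d * t ^+ 2) =
    A1 * B1 - e * (A1 + B1) + e ^+ 2 by rewrite /A1 /B1; ring.
  have : e * (A1 + B1) <= e * 2 by rewrite ler_wpM2l ?(ltW e0) // /A1 /B1; lra.
  by have := sqr_ge0 e; move: ef; rewrite /f; lra.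
have := quad_ge0 a b Ae AB.
have : (1 - e - nz) * (a ^+ 2 + b ^+ 2) <= (1 - e - nz) * rnorm x ^+ 2.
  by rewrite ler_wpM2l // ltW.
rewrite nxE; lra.
Qed.

End TwoPointBall.

(** * Domination with the constant (1 + rho) / (1 - rho) *)

Section Domination.
Context {R : realType}.

(** The zero space is set apart because l^2(N; G) is then not infinite-dimensional; it occurs as H
    (x) E when E = 0. *)
Lemma dominated_trivial k (G : hilbertType R) (C : R) (A B : op_tuple k G) :
  (forall x : G, x = 0) -> dominated C A B.
Proof.
move=> G0; split=> [q p x pp|d g].
  have form0 (X : op_tuple k G) : mxform (nc_eval p X) x = 0.
    by rewrite /mxform big1 // => i _; rewrite big1 // => j _; rewrite (G0 (x i)) hdot0r.
  by rewrite !form0 mulr0.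
have tree0 (X : op_tuple k G) : tree_form X d g = 0.
  elim: d g => [|d IH] g /=; rewrite (G0 (g [::])) rnorm0 expr0n //= add0r.
  rewrite big1 ?mulr0 ?add0r; last by move=> i _; rewrite rdot0r.
  by rewrite big1.
by rewrite !tree0 mulr0.
Qed.

(** Cleared of denominators, the inequality is affine in u and so passes to u = r, whatever the
    signs of a and b. *)
Lemma ratio_limit (r a b : R) : 0 <= r -> r < 1 ->
  (forall u, r < u -> u < 1 -> (1 - u) * b <= (1 + u) * a) ->
  b <= (1 + r) / (1 - r) * a.
Proof.
move=> r0 r1 h; have r1' : 0 < 1 - r by rewrite subr_gt0.
rewrite mulrAC ler_pdivlMr // mulrC.
apply/ler_addgt0Pl => e e0; pose M := `|a + b| + 1.
have M0 : 0 < M by rewrite ltr_wpDl.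
pose d := Num.min ((1 - r) / 2) (e / M).
have d0 : 0 < d by rewrite lt_min !divr_gt0.
have d1 : d <= (1 - r) / 2 by rewrite ge_min lexx.
have d2 : d * M <= e by rewrite -ler_pdivlMr // ge_min lexx orbT.
clearbody d; have := h (r + d); rewrite ltrDl => /(_ d0).
have -> : r + d < 1 by lra.
move=> /(_ isT); have : d * (a + b) <= d * `|a + b| by rewrite ler_wpM2l ?(ltW d0) ?ler_norm.
by move: d2; rewrite /M; lra.
Qed.

(** The idempotent vanishes on coordinate 2, so the restriction of the tuple to that coordinate is
    A. *)
Lemma closed_ball_l2_tri k (G : hilbertType R) t (A B : op_tuple k G) :
  closed_ball_op (fun i => l2_tri t (A i) (B i)) -> closed_ball_op A.
Proof.
move=> /closed_ball_opP h; apply/closed_ball_opP => v.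
have := h (fun i => l2_single 2 (v i)).
have E i : l2_tri t (A i) (B i) (l2_single 2 (v i)) = l2_single 2 (A i (v i)).
  have P0 : l2_proj G t (l2_single 2 (v i)) = 0.
    rewrite l2_projE; apply: l2P => -[|[|j]]; rewrite l2_twoE // !l2_singleE /=.
    by rewrite scaler0 addr0.
  rewrite l2_triE P0 subr0 bop_zero addr0; apply: l2P => j.
  by rewrite l2_diagE !l2_singleE; case: ifP => // _; rewrite bop_zero.
rewrite (eq_bigr _ (fun i _ => E i)).
have -> : \sum_i l2_single 2 (A i (v i)) = l2_single 2 (\sum_i A i (v i)).
  elim/big_rec2: _ => [|i x y _ ->].
    by apply: l2P => j; rewrite l2_singleE if_same.
  by rewrite -[A i (v i) in RHS]scale1r l2_single_linear scale1r.
rewrite rnorm_l2_single; congr (_ <= _); apply: eq_bigr => i _.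
by rewrite rnorm_l2_single.
Qed.

Section Points.
Context (n : nat) (z xi : 'rV[R[i]]_n).
Hypotheses (z1 : sqn z < 1) (xi1 : sqn xi < 1).

Let rho : R := norm2 (ball_aut z xi).

Definition harnack_const : R :=
  (1 + norm2 (ball_aut z xi)) / (1 - norm2 (ball_aut z xi)).

Lemma rho_bounds : 0 <= rho < 1.
Proof.
have /andP[_ h] := sqn_ball_aut_lt1 z1 xi1.
by rewrite sqrtr_ge0 /= -sqrtr1 ltr_sqrt.
Qed.

Lemma rho2E : rho ^+ 2 = 1 - (1 - sqn z) * (1 - sqn xi) / pole z xi.
Proof. by rewrite norm2_sqn sqn_ball_aut. Qed.

Lemma harnack_const_ge1 : 1 <= harnack_const.
Proof.
have /andP[r0 r1] := rho_bounds.
by rewrite ler_pdivlMr ?subr_gt0 // -/rho; lra.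
Qed.

(** After division by [pole], the condition on t reads (s^2 - 1) rho^2 < 1 - rho^2. *)
Lemma two_point_open_s (H : hilbertType R) (s : R) : 1 < s -> s * rho < 1 ->
  open_ball_op (two_point_tuple H (Num.sqrt (s ^+ 2 - 1)) z xi).
Proof.
move=> s1 sr; have D0 := pole_gt0 z1 xi1; have /andP[r0 r1] := rho_bounds.
apply: two_point_open => //; rewrite sqr_sqrtr; last by nra.
have e1 : (1 - sqn z) * (1 - sqn xi) = (1 - rho ^+ 2) * pole z xi.
  have -> : 1 - rho ^+ 2 = (1 - sqn z) * (1 - sqn xi) / pole z xi.
    by rewrite rho2E; ring.
  by rewrite divfK // gt_eqF.
rewrite e1.
have -> : (s ^+ 2 - 1) * (pole z xi - (1 - rho ^+ 2) * pole z xi) =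
  ((s ^+ 2 - 1) * rho ^+ 2) * pole z xi by ring.
rewrite ltr_pM2r //.
have : (s * rho) ^+ 2 < 1 by rewrite expr_lt1 // mulr_ge0 //; lra.
rewrite exprMn; lra.
Qed.

(** With u = 1 / s the constant (s + 1) / (s - 1) is (1 + u) / (1 - u), and u runs through (rho, 1).
    This also covers rho = 0, where s is unbounded. *)
Lemma dominated_limit k (G : hilbertType R) (A B : op_tuple k G) :
  (forall s, 1 < s -> s * rho < 1 ->
     closed_ball_op (fun i => l2_tri (Num.sqrt (s ^+ 2 - 1)) (A i) (B i))) ->
  dominated harnack_const A B.
Proof.
move=> h; have /andP[r0 r1] := rho_bounds.
have [G0|G0] := pselect (forall x : G, x = 0); first exact: dominated_trivial.
have [g /eqP g0] : exists g : G, g <> 0 by apply/existsNP.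
have iG := l2_infinite_dim g0.
have dom u : rho < u -> u < 1 -> dominated ((u^-1 + 1) / (u^-1 - 1)) A B.
  move=> ru u1; have u0 : 0 < u by apply: le_lt_trans ru.
  have s1 : 1 < u^-1 by rewrite invf_gt1.
  apply: l2_tri_dominated => //; apply: h => //.
  by rewrite mulrC ltr_pdivrMr // mul1r.
have conv (u a b : R) : 0 < u -> u < 1 -> b <= (u^-1 + 1) / (u^-1 - 1) * a ->
    (1 - u) * b <= (1 + u) * a.
  move=> u0 u1; have -> : (u^-1 + 1) / (u^-1 - 1) * a = (1 + u) * a / (1 - u).
    by field; apply/andP; split; lra.
  by rewrite ler_pdivlMr ?subr_gt0 // mulrC.
split=> [q p x pp|d g']; apply: ratio_limit => // u ru u1;
  have u0 : 0 < u by apply: le_lt_trans ru.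
  by apply: conv => //; apply: (dom u ru u1).1.
by apply: conv => //; apply: (dom u ru u1).2.
Qed.

Lemma dominated_scalar (H : hilbertType R) :
  dominated harnack_const (scalar_tuple H z) (scalar_tuple H xi).
Proof.
by apply: dominated_limit => s s1 sr; apply/open_closed_ball/two_point_open_s.
Qed.

Lemma closed_ball_scalar (H : hilbertType R) : closed_ball_op (scalar_tuple H z).
Proof.
apply: (@closed_ball_l2_tri _ _ 0 _ (scalar_tuple H xi)).
apply/open_closed_ball/two_point_open => //.
by rewrite expr0n mul0r mulr_gt0 // subr_gt0.
Qed.

Section Contractive.
Context (m : nat) (H E : hilbertType R) (HE : hilbert_tensor H E).
Context (F : 'I_m -> free_hol n E).
Hypotheses (F1 : contractive F) (H0 : exists x : H, x != 0).

(** The point at which contractivity of F is used. It applies to l^2(N; H), which is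
    infinite-dimensional for every nonzero H. *)
Lemma contractive_two_point t : open_ball_op (two_point_tuple H t z xi) ->
  closed_ball_op (fun j => l2_tri t (fh_eval_tuple HE F (scalar_tuple H z) j)
                                    (fh_eval_tuple HE F (scalar_tuple H xi) j)).
Proof.
move=> X1; have [x x0] := H0.
have := F1; rewrite /contractive => /(le_trans _) F1'.
have : ((row_norm (fh_eval_tuple (l2_tensor HE) F (two_point_tuple H t z xi)))%:E <= 1%E)%E.
  apply: F1'; apply: ereal_sup_ubound.
  exists (l2 H), (l2_tensor HE), (two_point_tuple H t z xi); split=> //.
  exact: l2_infinite_dim x0.
rewrite lee_fin => h.
suff -> : (fun j => l2_tri t (fh_eval_tuple HE F (scalar_tuple H z) j)
    (fh_eval_tuple HE F (scalar_tuple H xi) j)) =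
  fh_eval_tuple (l2_tensor HE) F (two_point_tuple H t z xi) by exact: h.
by apply: funext => j; rewrite /fh_eval_tuple fh_eval_two_point //; apply/unit_ball_sqn.
Qed.

Lemma dominated_fh : dominated harnack_const
  (fh_eval_tuple HE F (scalar_tuple H z)) (fh_eval_tuple HE F (scalar_tuple H xi)).
Proof.
by apply: dominated_limit => s s1 sr; apply/contractive_two_point/two_point_open_s.
Qed.

(** H may be finite-dimensional, so contractivity is used on l^2(N; H) and then restricted to
    coordinate 2. The choice t = 0 makes strictness automatic. *)
Lemma closed_ball_fh : closed_ball_op (fh_eval_tuple HE F (scalar_tuple H z)).
Proof.
apply: (@closed_ball_l2_tri _ _ 0).
apply/contractive_two_point/two_point_open => //.
by rewrite expr0n mul0r mulr_gt0 // subr_gt0.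
Qed.

End Contractive.

End Points.

Lemma harnack_constC n (z xi : 'rV[R[i]]_n) : sqn z < 1 -> sqn xi < 1 ->
  harnack_const z xi = harnack_const xi z.
Proof.
move=> z1 xi1; rewrite /harnack_const.
have e : norm2 (ball_aut z xi) = norm2 (ball_aut xi z).
  have E1 := congr1 Num.sqrt (sqn_ball_aut z1 xi1).
  have E2 := congr1 Num.sqrt (sqn_ball_aut xi1 z1).
  rewrite (mulrC (1 - sqn xi)) (poleC xi) in E2.
  exact: etrans E1 (esym E2).
exact: (@congr1 R R (fun r : R => (1 + r) / (1 - r))).
Qed.

Lemma dominated_harnack_le k (G : hilbertType R) (C : R) (A B : op_tuple k G) :
  0 < C -> closed_ball_op A -> closed_ball_op B -> dominated C A B ->
  harnack_le (Num.sqrt C) B A.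
Proof.
move=> C0 A1 B1 [nc _]; split=> //; first by rewrite sqrtr_gt0.
move=> q p pp; rewrite sqr_sqrtr ?ltW //.
by apply/mxop_leE => x; exact: nc.
Qed.

End Domination.

(** * Minimal isometric dilations and the construction of L *)

Section TreeSums.
Context {R : realType}.
Implicit Types G K : hilbertType R.

Lemma eq_tree_sum k K (X : op_tuple k K) d g g' : g =1 g' ->
  tree_sum X d g = tree_sum X d g'.
Proof. by move=> /funext ->. Qed.

Lemma tree_sum_sum k K (X : op_tuple k K) d I (r : seq I) (f : I -> seq 'I_k -> K) :
  tree_sum X d (fun b => \sum_(p <- r) f p b) = \sum_(p <- r) tree_sum X d (f p).
Proof.
elim: d f => [//|d IH] f /=; rewrite big_split /=; congr (_ + _).
rewrite exchange_big; apply: eq_bigr => i _.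
by rewrite (IH (fun p a => f p (i :: a))) bop_sum.
Qed.

Lemma tree_sum0 k K (X : op_tuple k K) d : tree_sum X d (fun=> 0) = 0.
Proof.
elim: d => [//|d IH] /=; rewrite IH add0r big1 // => i _.
by rewrite bop_zero.
Qed.

Lemma tree_sum_single k K (X : op_tuple k K) d a h : (size a <= d)%N ->
  tree_sum X d (fun b => if b == a then h else 0) = word_op X a h.
Proof.
elim: d a => [|d IH] [|j a] //= ad.
  by rewrite big1 ?addr0 // => i _; rewrite tree_sum0 bop_zero.
rewrite add0r (bigD1 j) //= big1 ?addr0 => [|i ij].
  by rewrite -IH //; congr (X j _); apply: eq_tree_sum => b; rewrite eqseq_cons eqxx.
rewrite (@eq_tree_sum _ _ _ _ _ (fun=> 0)) ?tree_sum0 ?bop_zero // => b.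
by rewrite eqseq_cons (negPf ij).
Qed.

(** The same d and g serve all tuples and embeddings, so that the two dilations to be compared are
    described by one tree. Entries of s with equal words are added up in g. *)
Lemma words_tree_sum k G (s : seq (seq 'I_k * G)) : exists d (g : seq 'I_k -> G),
  forall K (X : op_tuple k K) (e : bop G K),
    \sum_(p <- s) word_op X p.1 (e p.2) = tree_sum X d (fun a => e (g a)).
Proof.
exists (\max_(p <- s) size p.1), (fun a => \sum_(p <- s) if a == p.1 then p.2 else 0).
move=> K X e; set d := \max_(p <- s) _.
have sd p : p \in s -> (size p.1 <= d)%N.
  by move=> ps; rewrite /d (big_rem p) //= leq_maxl.
rewrite (@eq_tree_sum _ _ _ _ _ (fun b => \sum_(p <- s) if b == p.1 then e p.2 else 0)).
  rewrite tree_sum_sum big_seq [RHS]big_seq; apply: eq_bigr => p ps.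
  by rewrite tree_sum_single // sd.
move=> b; rewrite bop_sum; apply: eq_bigr => p _.
by case: ifP => // _; rewrite bop_zero.
Qed.

End TreeSums.

Section Dilations.
Context {R : realType} (k : nat) (G : hilbertType R).

Section OneDilation.
Context (A : op_tuple k G) (V : min_iso_dilation A).
Local Notation K := (mid_space V).
Local Notation emb := (mid_emb V).

Lemma isometric_hdot (L M : hilbertType R) (T : bop L M) x y :
  isometric T -> '[T x, T y] = '[x, y].
Proof.
move=> iT; have rd u v : rdot (T u) (T v) = rdot u v.
  have := iT (u + v); rewrite bop_add => /(congr1 (fun r => r ^+ 2)).
  rewrite !rnorm2D !iT; lra.
by apply: eq_rdot; rewrite // -bop_scale rd.
Qed.

Lemma mid_opK i x : adj (mid_op V i) (mid_op V i x) = x.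
Proof.
by apply: hdot_eq => y; rewrite -adjP isometric_hdot //; exact: mid_isometric.
Qed.

(** Test \sum_j V_j V_j^* <= I at V_i x: the term of index i already exhausts |x|^2. *)
Lemma mid_op_orth i j x : i != j -> adj (mid_op V j) (mid_op V i x) = 0.
Proof.
move=> ij; have := @mid_row _ _ _ _ V (mid_op V i x).
rewrite bopB_apply bidE hdotDl hdotNl => h.
have : 0 <= rnorm x ^+ 2 - \sum_j rnorm (adj (mid_op V j) (mid_op V i x)) ^+ 2.
  move: h; rewrite lecE => /andP[_]; rewrite ReD ReN -!/(rdot _ _) rdot_sum_adj rdotxx.
  by rewrite mid_isometric.
rewrite (bigD1 i) //= mid_opK opprD addrA subrr add0r oppr_ge0 => h0.
apply/rnorm_eq0/eqP; rewrite -sqrf_eq0 eq_le sqr_ge0 andbT.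
apply: le_trans h0; rewrite (bigD1 j) /=; last by rewrite eq_sym.
by rewrite lerDl sumr_ge0 // => l _; rewrite sqr_ge0.
Qed.

Lemma mid_op_rnorm2 (x : 'I_k -> K) :
  rnorm (\sum_i mid_op V i (x i)) ^+ 2 = \sum_i rnorm (x i) ^+ 2.
Proof.
rewrite -rdotxx rdot_suml; apply: eq_bigr => i _.
rewrite rdot_sumr (bigD1 i) //= big1 ?addr0 => [|j ji].
  by rewrite rdot_adj mid_opK rdotxx.
by rewrite rdotC rdot_adj mid_op_orth ?rdot0r // eq_sym.
Qed.

Lemma mid_op_emb i x h : '[mid_op V i x, emb h] = '[x, emb (adj (A i) h)].
Proof. by rewrite adjP -bcompE mid_coext. Qed.

Lemma emb_hdot x y : '[emb x, emb y] = '[x, y].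
Proof. exact: isometric_hdot (mid_emb_isometric V). Qed.

Lemma tree_sum_emb d g h :
  '[tree_sum (mid_op V) d (fun a => emb (g a)), emb h] = '[tree_sum A d g, h].
Proof.
elim: d g h => [|d IH] g h /=; first exact: emb_hdot.
rewrite !hdotDl emb_hdot !hdot_suml; congr (_ + _); apply: eq_bigr => i _.
by rewrite mid_op_emb (IH (fun a => g (i :: a))) adjP.
Qed.

(** Isometries with orthogonal ranges turn |\sum_i V_i x_i|^2 into \sum_i |x_i|^2, and the cross
    terms with the embedded space see only the compression, which is A. The norm therefore depends
    on A alone. *)
Lemma tree_form_emb d g :
  rnorm (tree_sum (mid_op V) d (fun a => emb (g a))) ^+ 2 = tree_form A d g.
Proof.
elim: d g => [|d IH] g /=; first by rewrite mid_emb_isometric.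
rewrite rnorm2D mid_emb_isometric mid_op_rnorm2; congr (_ + 2 * _ + _).
  rewrite rdotC rdot_suml; apply: eq_bigr => i _.
  by rewrite /rdot mid_op_emb (tree_sum_emb _ (fun a => g (i :: a))) adjP.
by apply: eq_bigr => i _; exact: (IH (fun a => g (i :: a))).
Qed.

End OneDilation.

(** L sends each word of W at an embedded vector to the same word of V. The squared norms of finite
    sums are tree forms of A and of B, so domination is the boundedness of this relation. *)
Lemma harnack_op_exists (C : R) (A B : op_tuple k G)
    (W : min_iso_dilation A) (V : min_iso_dilation B) :
  0 <= C -> dominated C A B ->
  exists L : bop (mid_space W) (mid_space V),
    is_harnack_op L /\ opnorm L <= Num.sqrt C.
Proof.
move=> C0 [_ AB].
pose word (T : op_tuple k G) (U : min_iso_dilation T) (p : seq 'I_k * G) :=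
  word_op (mid_op U) p.1 (mid_emb U p.2).
pose Gr x y := exists s, x = \sum_(p <- s) word _ W p /\ y = \sum_(p <- s) word _ V p.
have word_scale T (U : min_iso_dilation T) a s :
    \sum_(p <- [seq (p.1, a *: p.2) | p <- s]) word T U p = a *: \sum_(p <- s) word T U p.
  rewrite big_map scaler_sumr; apply: eq_bigr => p _.
  by rewrite /word /= !bop_scale.
have [||||L [LG LC]] := @extension_by_density _ _ _ Gr (Num.sqrt C).
- exact: sqrtr_ge0.
- move=> a x y x' y' [s [-> ->]] [s' [-> ->]].
  by exists ([seq (p.1, a *: p.2) | p <- s] ++ s'); rewrite !big_cat /= !word_scale.
- move=> x y [s [-> ->]]; have [d [g E]] := words_tree_sum s.
  rewrite /word !E -ler_sqr ?nnegrE ?rnorm_ge0 ?mulr_ge0 ?sqrtr_ge0 ?rnorm_ge0 //.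
  by rewrite exprMn sqr_sqrtr // !tree_form_emb.
- apply: (dense_span_sub (mid_total W)) => /=.
  + by exists 0, [::]; rewrite !big_nil.
  + move=> a x x' [y [s [-> _]]] [y' [s' [-> _]]].
    eexists; exists ([seq (p.1, a *: p.2) | p <- s] ++ s'); split; last by [].
    by rewrite big_cat /= word_scale.
  + move=> _ [p _ <-]; exists (word _ V p), [:: p].
    by rewrite !big_seq1.
have LW p : L (word _ W p) = word _ V p.
  by apply: LG; exists [:: p]; rewrite !big_seq1.
exists L; split=> //; split.
  by apply: bopP => h; exact: (LW ([::], h)).
move=> i; apply: (bop_eq_dense (mid_total W)) => _ [[a h] _ <-].
rewrite !bcompE /=; have /= -> := LW (a, h).
exact: (LW (i :: a, h)).
Qed.

End Dilations.

(** * The extremal test polynomials *)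

Section NcPolynomials.
Context {R : realType} (n : nat).

(** Lists of monomials, with repeated words allowed, make the closure properties immediate;
    [is_ncpoly_eval] collects the coefficients into a finitely supported family. *)
Definition is_ncpoly (Phi : forall K : hilbertType R, op_tuple n K -> bop K K) :=
  exists L : seq (seq 'I_n * R[i]), forall K X,
    Phi K X = \sum_(q <- L) q.2 *: word_op X q.1.

Lemma is_ncpoly_id : is_ncpoly (fun K X => bid K).
Proof. by exists [:: ([::], 1)] => K X; rewrite big_seq1 scale1r. Qed.

Lemma is_ncpolyD Phi Psi : is_ncpoly Phi -> is_ncpoly Psi ->
  is_ncpoly (fun K X => Phi K X + Psi K X).
Proof.
by move=> [L LE] [M ME]; exists (L ++ M) => K X; rewrite big_cat LE ME.
Qed.

Lemma is_ncpolyZ a Phi : is_ncpoly Phi -> is_ncpoly (fun K X => a *: Phi K X).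
Proof.
move=> [L LE]; exists [seq (q.1, a * q.2) | q <- L] => K X.
rewrite LE big_map scaler_sumr; apply: eq_bigr => q _.
by rewrite scalerA.
Qed.

Lemma is_ncpolyX i Phi : is_ncpoly Phi -> is_ncpoly (fun K X => X i *B Phi K X).
Proof.
move=> [L LE]; exists [seq (i :: q.1, q.2) | q <- L] => K X.
apply: bopP => x; rewrite bcompE LE !bop_sum_apply bop_sum big_map.
by apply: eq_bigr => q _; rewrite !bopZ_apply bop_scale.
Qed.

Lemma is_ncpoly_sum (I : Type) (r : seq I) Phi :
  (forall i, is_ncpoly (Phi i)) -> is_ncpoly (fun K X => \sum_(i <- r) Phi i K X).
Proof.
move=> hP; elim: r => [|i r IH].
  by exists [::] => K X; rewrite !big_nil.
have [L LE] := is_ncpolyD (hP i) IH.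
by exists L => K X; rewrite -LE big_cons.
Qed.

Lemma is_ncpoly_eval Phi : is_ncpoly Phi ->
  exists p : ncpoly n 1, forall K X, nc_eval p X 0 0 = Phi K X.
Proof.
move=> [L LE]; pose c a : 'M[R[i]]_1 := const_mx (\sum_(q <- L | q.1 == a) q.2).
pose S := [fset q.1 | q in L]%fset.
pose p : ncpoly n 1 := [fsfun a in S => c a].
exists p => K X.
have -> : nc_eval p X 0 0 = \sum_(a <- finsupp p) p a 0 0 *: word_op X a.
  by rewrite /nc_eval summxE; apply: eq_bigr => a _; rewrite mxE.
rewrite (big_fset_incl _ (finsupp_sub _ _ _)) => [|a aS]; last first.
  by rewrite memNfinsupp => /eqP ->; rewrite mxE scale0r.
rewrite LE (eq_big_seq (fun a => \sum_(q <- L | q.1 == a) q.2 *: word_op X a)).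
  rewrite (exchange_big_dep xpredT) //= [LHS]big_seq [RHS]big_seq.
  apply: eq_bigr => q qL; have qS : q.1 \in S by apply/imfsetP; exists q.
  under eq_bigl do rewrite eq_sym.
  by rewrite -big_filter filter_pred1_uniq ?fset_uniq // big_seq1.
move=> a aS; rewrite fsfun_fun aS mxE scaler_suml.
by [].
Qed.

End NcPolynomials.

Section TestPolynomials.
Context {R : realType} (n : nat) (z w : 'rV[R[i]]_n).

(* Chosen so that [|test_b X N h|^2 <= Re '[test_p X N h, h]] for row contractions,
   with equality for the isometric dilation of a scalar tuple. The test vectors
   approach the solution of [x = h - S h + T x], where
   [S = \sum_i conj(z_i) X_i] and [T = \sum_i conj(w_i) X_i]. *)
Fixpoint test_b (K : hilbertType R) (X : op_tuple n K) (N : nat) : bop K K :=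
  if N is N'.+1 then
    bid K + \sum_i X i *B (Num.conj (w 0 i) *: test_b X N' + (- Num.conj (z 0 i)) *: bid K)
  else bid K.

Fixpoint test_p (K : hilbertType R) (X : op_tuple n K) (N : nat) : bop K K :=
  if N is N'.+1 then
    (1 + (sqn z)%:C) *: bid K + (sqn w)%:C *: test_p X N'
    + (- 2 * cdot z w) *: test_b X N'
    + 2 *: \sum_i X i *B (Num.conj (w 0 i) *: test_b X N' + (- Num.conj (z 0 i)) *: bid K)
  else bid K.

Lemma test_b_ncpoly N : is_ncpoly (fun K X => @test_b K X N).
Proof.
elim: N => [|N IH] /=; first exact: is_ncpoly_id.
apply: is_ncpolyD; first exact: is_ncpoly_id.
apply: is_ncpoly_sum => i; apply: is_ncpolyX.
by apply: is_ncpolyD; apply: is_ncpolyZ => //; exact: is_ncpoly_id.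
Qed.

Lemma test_p_ncpoly N : is_ncpoly (fun K X => @test_p K X N).
Proof.
elim: N => [|N IH] /=; first exact: is_ncpoly_id.
apply: is_ncpolyD; last first.
  apply: is_ncpolyZ; apply: is_ncpoly_sum => i; apply: is_ncpolyX.
  apply: is_ncpolyD; apply: is_ncpolyZ; first exact: test_b_ncpoly.
  exact: is_ncpoly_id.
apply: is_ncpolyD; last by apply: is_ncpolyZ; exact: test_b_ncpoly.
by apply: is_ncpolyD; apply: is_ncpolyZ => //; exact: is_ncpoly_id.
Qed.

Lemma sum_beta_rnorm2 (K : hilbertType R) (x h : K) :
  \sum_i rnorm (Num.conj (w 0 i) *: x + (- Num.conj (z 0 i)) *: h) ^+ 2 =
  sqn w * rnorm x ^+ 2 - 2 * complex.Re (cdot z w * '[x, h]) + sqn z * rnorm h ^+ 2.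
Proof.
rewrite (eq_bigr (fun i => complex.Re `|w 0 i| ^+ 2 * rnorm x ^+ 2 -
   2 * complex.Re (z 0 i * Num.conj (w 0 i) * '[x, h]) +
   complex.Re `|z 0 i| ^+ 2 * rnorm h ^+ 2)).
  by rewrite big_split sumrB /= -!mulr_suml -mulr_sumr -Re_sum -mulr_suml.
move=> i _; rewrite rnorm2D !rnorm2Z normrN !norm_conjC -mulrN; congr (_ + 2 * _ + _).
rewrite /rdot hdotZl hdotZr rmorphN /= conjCK mulNr mulrN ReN mulrA.
by rewrite (mulrC (z 0 i)).
Qed.

(** In the expansion of |h + \sum_i X_i beta_i|^2 the last square is bounded by \sum_i |beta_i|^2,
    and in that sum |[test_b] h|^2 is bounded by the induction hypothesis. What remains is linear in
    the polynomials. *)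
Lemma test_p_ge (K : hilbertType R) (X : op_tuple n K) N h : closed_ball_op X ->
  rnorm (test_b X N h) ^+ 2 <= complex.Re '[test_p X N h, h].
Proof.
move=> /closed_ball_opP X1; elim: N => [|N IH] /=; first by rewrite hdotxx.
pose beta i := Num.conj (w 0 i) *: test_b X N h + (- Num.conj (z 0 i)) *: h.
have SE : (\sum_i X i *B (Num.conj (w 0 i) *: test_b X N + (- Num.conj (z 0 i)) *: bid K)) h =
    \sum_i X i (beta i) by rewrite bop_sum_apply.
rewrite SE rnorm2D.
rewrite !hdotDl !hdotZl !ReD hdotxx -!mulrA ReMl.
have := X1 beta; rewrite {2}/beta sum_beta_rnorm2.
have -> : complex.Re ((1 + (sqn z)%:C) * (rnorm h ^+ 2)%:C) = (1 + sqn z) * rnorm h ^+ 2.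
  by rewrite ReM /= mulr0 subr0.
have -> : complex.Re (- 2 * (cdot z w * '[test_b X N h, h])) =
   - 2 * complex.Re (cdot z w * '[test_b X N h, h]).
  by rewrite (_ : - 2 = (- 2 : R)%:C) ?ReMl // rmorphN rmorph_nat.
have -> : complex.Re (2 * '[\sum_i X i (beta i), h]) = 2 * rdot h (\sum_i X i (beta i)).
  by rewrite (_ : 2 = (2 : R)%:C) ?ReMl ?rmorph_nat // rdotC.
have := ler_wpM2l (sqn_ge0 w) IH.
lra.
Qed.

Fixpoint val_b (v : 'rV[R[i]]_n) (N : nat) : R[i] :=
  if N is N'.+1 then 1 + (cdot v w * val_b v N' - cdot v z) else 1.

Fixpoint val_p (v : 'rV[R[i]]_n) (N : nat) : R[i] :=
  if N is N'.+1 then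
    1 + (sqn z)%:C + (sqn w)%:C * val_p v N' - 2 * cdot z w * val_b v N'
    + 2 * (cdot v w * val_b v N' - cdot v z)
  else 1.

Lemma test_scalar (H : hilbertType R) (v : 'rV[R[i]]_n) N :
  test_b (scalar_tuple H v) N = val_b v N *: bid H /\
  test_p (scalar_tuple H v) N = val_p v N *: bid H.
Proof.
elim: N => [|N [IHb IHp]] /=; first by rewrite scale1r.
have SE : \sum_i scalar_tuple H v i *B (Num.conj (w 0 i) *: test_b (scalar_tuple H v) N
      + (- Num.conj (z 0 i)) *: bid H) =
    (cdot v w * val_b v N - cdot v z) *: bid H.
  rewrite IHb; apply: bopP => x; rewrite bop_sum_apply bopZ_apply mulr_suml -sumrB scaler_suml.
  apply: eq_bigr => i _; rewrite /scalar_tuple bcompE !bopZ_apply bopD_apply !bopZ_apply.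
  rewrite !bidE !scalerA -scalerDl scalerA; congr (_ *: _); ring.
rewrite SE IHb IHp; split.
  by rewrite -[X in X + _]scale1r -scalerDl.
by rewrite !scalerA -!scalerDl mulNr mulNr.
Qed.

Lemma harnack_le_val (H : hilbertType R) (h : H) (c : R) (xi : 'rV[R[i]]_n) N :
  h != 0 -> harnack_le c (scalar_tuple H xi) (scalar_tuple H z) ->
  complex.Re (val_p xi N) <= c ^+ 2 * complex.Re (val_p z N).
Proof.
move=> h0 [_ _ _ hA]; have [p pE] := is_ncpoly_eval (test_p_ncpoly N).
have formE K (X : op_tuple n K) x :
    mxform (nc_eval p X) x = '[test_p X N (x 0), x 0].
  by rewrite /mxform !big_ord1 pE.
have pp : nc_re_nonneg p.
  move=> K X iK X1; apply/mxop_ge0E => x; rewrite formE.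
  by apply: le_trans (test_p_ge N _ (open_closed_ball X1)); rewrite sqr_ge0.
have := (mxop_leE _ _ _).1 (hA _ p pp) (fun=> h).
rewrite !formE !(test_scalar _ _ _).2 !bopZ_apply !bidE !hdotZl hdotxx.
rewrite ![_ * _%:C]mulrC !ReMl mulrCA ler_pM2l //.
by rewrite exprn_gt0 // rnorm_gt0.
Qed.

Section TestVectors.
Context (H : hilbertType R) (v : 'rV[R[i]]_n) (V : min_iso_dilation (scalar_tuple H v)).
Context (h : H).

(** The recursion of [test_b] for the isometries of the dilation, started at the embedded vector h.
    Here the estimate of [test_p_ge] is an equality. *)
Fixpoint test_vec (N : nat) : mid_space V :=
  if N is N'.+1 then
    mid_emb V h + \sum_i mid_op V i (Num.conj (w 0 i) *: test_vec N' +
                     (- Num.conj (z 0 i)) *: mid_emb V h)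
  else mid_emb V h.

Lemma test_vec_step x : '[\sum_i mid_op V i (Num.conj (w 0 i) *: x +
     (- Num.conj (z 0 i)) *: mid_emb V h), mid_emb V h] =
  cdot v w * '[x, mid_emb V h] - cdot v z * '[h, h].
Proof.
rewrite hdot_suml !mulr_suml -sumrB; apply: eq_bigr => i _.
rewrite mid_op_emb /scalar_tuple adjZ adj_id bopZ_apply bidE bop_scale hdotZr conjCK.
by rewrite hdotDl !hdotZl emb_hdot; ring.
Qed.

Lemma test_vec_emb N : '[test_vec N, mid_emb V h] = val_b v N * '[h, h].
Proof.
elim: N => [|N IH] /=; first by rewrite emb_hdot mul1r.
by rewrite hdotDl test_vec_step IH emb_hdot; ring.
Qed.

Lemma test_vec_rnorm2 N :
  rnorm (test_vec N) ^+ 2 = complex.Re (val_p v N) * rnorm h ^+ 2.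
Proof.
elim: N => [|N IH] /=; first by rewrite mid_emb_isometric mul1r.
rewrite rnorm2D mid_op_rnorm2 sum_beta_rnorm2 IH (rdotC (mid_emb V h)) /rdot.
rewrite test_vec_step test_vec_emb mid_emb_isometric hdotxx.
rewrite !(ReD, ReN) -!mulrA ReMl.
have ReMr (a : R[i]) (r : R) : complex.Re (a * r%:C) = complex.Re a * r.
  by rewrite mulrC ReMl mulrC.
have Re2 (a : R[i]) : complex.Re (2 * a) = 2 * complex.Re a.
  by rewrite (_ : 2 = (2 : R)%:C) ?ReMl ?rmorph_nat.
rewrite !Re2 ReD ReN !mulrA !ReMr /=; ring.
Qed.

End TestVectors.

(** An intertwiner that fixes the embedded space carries the test vectors of z to those of xi, whose
    norms are known exactly. *)
Lemma harnack_op_val (H : hilbertType R) (h : H) (xi : 'rV[R[i]]_n)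
    (W : min_iso_dilation (scalar_tuple H z)) (V : min_iso_dilation (scalar_tuple H xi))
    (L : bop (mid_space W) (mid_space V)) N :
  h != 0 -> is_harnack_op L ->
  complex.Re (val_p xi N) <= opnorm L ^+ 2 * complex.Re (val_p z N).
Proof.
move=> h0 [Le LW]; have LE M : L (test_vec W h M) = test_vec V h M.
  have Leh : L (mid_emb W h) = mid_emb V h by rewrite -bcompE Le.
  elim: M => [//|M IH] /=; rewrite bop_add Leh bop_sum; congr (_ + _).
  apply: eq_bigr => i _; rewrite -bcompE LW bcompE bop_add !bop_scale IH Leh.
  by [].
have : rnorm (test_vec V h N) ^+ 2 <= opnorm L ^+ 2 * rnorm (test_vec W h N) ^+ 2.
  rewrite -LE -exprMn ler_sqr ?nnegrE ?rnorm_ge0 ?mulr_ge0 ?opnorm_ge0 ?rnorm_ge0 //.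
  exact: opnormP.
by rewrite !test_vec_rnorm2 mulrA ler_pM2r // exprn_gt0 // rnorm_gt0.
Qed.

End TestPolynomials.

(** * Limits of the test values and the lower bound for both constants *)

Section LowerBound.
Context {R : realType} (n : nat).
Implicit Types v w z xi : 'rV[R[i]]_n.
Local Notation modc a := (complex.Re `|a|).

Lemma modcM (a b : R[i]) : modc (a * b) = modc a * modc b.
Proof. by rewrite normrM ReM [in LHS](normcRe a) /= mul0r subr0. Qed.

Lemma modcD (a b : R[i]) : modc (a + b) <= modc a + modc b.
Proof. by rewrite -lecR rmorphD /= -!normcRe ler_normD. Qed.

Lemma Re_le_modc (a : R[i]) : `|complex.Re a| <= modc a.
Proof.
rewrite -ler_sqr ?nnegrE ?Re_normc_ge0 // Re_normc2 real_normK ?num_real //.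
by rewrite lerDl sqr_ge0.
Qed.

Lemma cdot_CauchySchwarz v w : modc (cdot v w) ^+ 2 <= sqn v * sqn w.
Proof.
have [w0|w0] := eqVneq (sqn w) 0.
  rewrite (sqn_eq0 w0) /cdot big1 => [|i _]; last by rewrite mxE rmorph0 mulr0.
  by rewrite normr0 expr0n mulr_ge0 ?sqn_ge0.
have wp : 0 < sqn w by rewrite lt_neqAle eq_sym w0 sqn_ge0.
have := sqn_ge0 ((- cdot v w) *: w + (sqn w)%:C *: v).
rewrite sqn_lin sqnZ cdotZr conj_real (cdotC w v) normrN !Re_normc2 /=.
case: (cdot v w) => a b /= h.
have : 0 <= sqn w * (sqn v * sqn w - (a ^+ 2 + b ^+ 2)) by move: h; lra.
by rewrite pmulr_rge0 // subr_ge0.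
Qed.

Lemma cdot_lt1 v w : sqn v < 1 -> sqn w < 1 -> modc (cdot v w) < 1.
Proof.
move=> v1 w1; rewrite -(@expr_lt1 _ 2) ?Re_normc_ge0 //.
by apply: le_lt_trans (cdot_CauchySchwarz _ _) _; rewrite mulr_ilt1 ?sqn_ge0.
Qed.

Lemma modcV (a : R[i]) : modc a^-1 = (modc a)^-1.
Proof. by rewrite normfV [in LHS]normcRe -fmorphV. Qed.

(** The error of p contracts by tau and is driven by that of b, which contracts by al. The common
    rate th is strictly above tau, because equal rates would produce an extra factor N. *)
Lemma linear_recurrence_cvg (tau : R) (al k beta pi : R[i]) (b p : nat -> R[i]) :
  0 <= tau -> tau < 1 -> modc al < 1 ->
  (forall N, b N.+1 - beta = al * (b N - beta)) ->
  (forall N, p N.+1 - pi = tau%:C * (p N - pi) + k * (b N - beta)) ->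
  complex.Re (p N) @[N --> \oo] --> complex.Re pi.
Proof.
move=> t0 t1 al1 bS pS.
pose r := modc al; have r0 : 0 <= r := Re_normc_ge0 al.
pose th := (1 + Num.max tau r) / 2.
have m1 : Num.max tau r < 1 by rewrite gt_max t1 al1.
have tauth : tau < th.
  have : tau <= Num.max tau r by rewrite le_max lexx.
  by rewrite /th; lra.
have rth : r <= th.
  have : r <= Num.max tau r by rewrite le_max lexx orbT.
  by rewrite /th; lra.
have th0 : 0 <= th by apply: le_trans rth.
have th1 : th < 1 by rewrite /th; lra.
pose B := modc (b 0%N - beta); have B0 : 0 <= B := Re_normc_ge0 _.
have bN N : modc (b N - beta) <= B * th ^+ N.
  elim: N => [|N IH]; first by rewrite expr0 mulr1.
  rewrite bS modcM exprS mulrCA; apply: ler_pM => //; exact: Re_normc_ge0.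
(* M satisfies tau M + |k| B <= th M, so that M th^N dominates the error of p by induction. *)
pose M := modc (p 0%N - pi) + modc k * B / (th - tau).
have d0 : 0 < th - tau by rewrite subr_gt0.
have kB0 : 0 <= modc k * B by rewrite mulr_ge0 ?Re_normc_ge0.
have M0 : 0 <= M by rewrite addr_ge0 ?Re_normc_ge0 // divr_ge0 // ltW.
have kBM : modc k * B <= M * (th - tau).
  by rewrite mulrDl divfK ?gt_eqF // lerDr mulr_ge0 ?Re_normc_ge0 // ltW.
have pN N : modc (p N - pi) <= M * th ^+ N.
  elim: N => [|N IH]; first by rewrite expr0 mulr1 lerDl divr_ge0 // ltW.
  rewrite pS (le_trans (modcD _ _)) // !modcM.
  have -> : modc tau%:C = tau.
    by rewrite normc_def /= expr0n addr0 sqrtr_sqr ger0_norm.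
  have h1 : tau * modc (p N - pi) <= tau * (M * th ^+ N) by rewrite ler_wpM2l.
  have h2 : modc k * modc (b N - beta) <= modc k * (B * th ^+ N).
    by rewrite ler_wpM2l ?Re_normc_ge0.
  have h3 : modc k * B * th ^+ N <= M * (th - tau) * th ^+ N.
    by rewrite ler_wpM2r ?exprn_ge0.
  by rewrite exprS; lra.
apply/cvgrPdist_le => e e0.
have e1 : 0 < e / (M + 1) by rewrite divr_gt0 // ltr_wpDl.
have := @cvg_expr R th; rewrite ger0_norm // => /(_ th1) /cvgrPdist_le /(_ _ e1).
case=> N0 _ h; exists N0 => // N /= NN.
have := h N NN; rewrite /= sub0r normrN ger0_norm ?exprn_ge0 // ler_pdivlMr ?ltr_wpDl // => hN.
rewrite distrC -ReN -ReD (le_trans (Re_le_modc _)) // (le_trans (pN N)) //.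
by apply: le_trans hN; rewrite mulrC ler_wpM2l ?exprn_ge0 // lerDl.
Qed.

(** [beta] and the displayed limit are the fixed points of the recursions of [val_b] and [val_p].
    For v = z the limit reduces to (1 - |z|^2) / (1 - |w|^2). *)
Lemma val_p_cvg z w v : sqn w < 1 -> modc (cdot v w) < 1 ->
  complex.Re (val_p z w v N) @[N --> \oo] -->
  complex.Re (((1 - sqn w)^-1)%:C *
    (2 * (1 - cdot z w) * ((1 - cdot v z) / (1 - cdot v w)) - (1 - sqn z)%:C)).
Proof.
move=> w1 vw1; set beta := (1 - cdot v z) / (1 - cdot v w).
have vw0 : 1 - cdot v w != 0.
  apply: contraTneq vw1 => /eqP; rewrite subr_eq0 => /eqP <-.
  by rewrite normr1 /= ltxx.
have tw : (1 - (sqn w)%:C : R[i]) != 0.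
  by rewrite subr_eq0 eq_sym eq_complex /= eqxx andbT lt_eqF.
have bE : beta * (1 - cdot v w) = 1 - cdot v z by rewrite divfK.
apply: (@linear_recurrence_cvg (sqn w) (cdot v w) (2 * (cdot v w - cdot z w)) beta _
  (val_b z w v)) => // [|N|N].
- exact: sqn_ge0.
- have -> : val_b z w v N.+1 = (1 - cdot v z) + cdot v w * val_b z w v N.
    by rewrite /=; ring.
  by rewrite -bE; ring.
have -> : ((1 - sqn w)^-1)%:C = (1 - (sqn w)%:C)^-1 :> R[i].
  by rewrite fmorphV rmorphB rmorph1.
have -> : (1 - sqn z)%:C = 1 - (sqn z)%:C :> R[i] by rewrite rmorphB rmorph1.
rewrite /=; have -> : cdot v z = 1 - beta * (1 - cdot v w) by rewrite bE; ring.
by field.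
Qed.

Lemma seq_cvg_le (u v : nat -> R) (a b c : R) :
  u N @[N --> \oo] --> a -> v N @[N --> \oo] --> b ->
  (forall N, u N <= c * v N) -> a <= c * b.
Proof.
by move=> ua vb uv; apply: (ler_cvg_to ua (cvgM (cvg_cst c) vb)); apply: nearW.
Qed.

(** As N grows, the factor 1 / (1 - |w|^2) cancels from the hypothesis, which then compares 2 Re ((1
    - <z, w>) (1 - <xi, z>) / (1 - <xi, w>)) - (1 - |z|^2) with C (1 - |z|^2). The remaining freedom
    is the choice of w. *)
Lemma harnack_const_le z xi C : sqn z < 1 -> sqn xi < 1 ->
  (forall w N, sqn w < 1 ->
     complex.Re (val_p z w xi N) <= C * complex.Re (val_p z w z N)) ->
  harnack_const z xi <= C.
Proof.
move=> z1 xi1 hC; pose rho := norm2 (ball_aut z xi).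
have conj1B (x : R[i]) : Num.conj (1 - x) = 1 - Num.conj x.
  by rewrite rmorphB rmorph1.
have cB (x : R) : (1 - x)%:C = 1 - x%:C :> R[i] by rewrite rmorphB rmorph1.
have /andP[r0 r1] := rho_bounds z1 xi1; rewrite -/rho in r0 r1.
have D0 := pole_gt0 z1 xi1.
(* At N = 0 the test value is 1 at both points. *)
have C1 : 1 <= C.
  have s0 : sqn (0 : 'rV[R[i]]_n) < 1.
    by rewrite /sqn big1 // => i _; rewrite mxE normr0 expr0n.
  by have := hC 0 0%N s0; rewrite /= mulr1.
pose q := 1 - sqn z; have q0 : 0 < q by rewrite subr_gt0.
have qq : q * (1 - sqn xi) = (1 - rho ^+ 2) * pole z xi.
  have -> : 1 - rho ^+ 2 = (1 - sqn z) * (1 - sqn xi) / pole z xi.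
    by rewrite (rho2E z1 xi1); ring.
  by rewrite divfK // gt_eqF.
have key t : 0 <= t -> t * rho < 1 -> 1 + t * rho ^+ 2 <= C * (1 - t * rho ^+ 2).
  move=> t0 tr.
  (* w = u / e makes (1 - <z,w>)(1 - <xi,z>) / (1 - <xi,w>) the real number
     (1 - |z|^2) / (1 - t rho^2); the bound is attained as t rho tends to 1. *)
  pose D := 1 - cdot xi z; pose e := (1 - t)%:C * D + (t * q)%:C.
  have DD : D * Num.conj D = (pole z xi)%:C by rewrite normc2.
  have D2 : complex.Re D ^+ 2 + complex.Im D ^+ 2 = pole z xi.
    by rewrite /pole Re_normc2.
  pose u := ((1 - t)%:C * D) *: z + (t * q)%:C *: xi.
  have xz : cdot xi z = 1 - D by rewrite /D opprB addrC subrK.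
  have zx : cdot z xi = 1 - Num.conj D by rewrite cdotC xz rmorphB rmorph1.
  (* By this identity w lies in the ball as soon as t rho < 1; t itself may exceed 1. The
     coefficients of z and xi in u add up to e, so w is an affine combination of the two points. *)
  have eu : modc e ^+ 2 - sqn u = q * pole z xi * (1 - t ^+ 2 * rho ^+ 2).
    rewrite /u sqn_lin sqnZ cdotZr conj_real zx /e !Re_normc2.
    have -> : sqn z = 1 - q by rewrite /q; ring.
    have : t ^+ 2 * q * (q * (1 - sqn xi)) = t ^+ 2 * q * ((1 - rho ^+ 2) * pole z xi).
      by rewrite qq.
    rewrite -D2; case: D {D2 DD xz zx e u} => d1 d2 /=.
    by move: (sqn xi) => sx; lra.
  have tr2 : t * rho ^+ 2 < 1.
    apply: le_lt_trans tr; rewrite expr2 mulrA ler_piMr ?mulr_ge0 //.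
    exact: ltW.
  have t2r2 : t ^+ 2 * rho ^+ 2 < 1 by rewrite -exprMn expr_lt1 // mulr_ge0.
  have eu0 : 0 < modc e ^+ 2 - sqn u.
    by rewrite eu; apply: mulr_gt0; [exact: mulr_gt0|rewrite subr_gt0].
  have e2 : 0 < modc e ^+ 2 by have := sqn_ge0 u; lra.
  have e0 : e != 0.
    by apply: contraTneq e2 => ->; rewrite normr0 expr0n ltxx.
  pose w := e^-1 *: u.
  have w1 : sqn w < 1.
    rewrite /w sqnZ modcV exprVn mulrC ltr_pdivrMr // mul1r; lra.
  pose kap := 1 - t * rho ^+ 2; have kap0 : 0 < kap by rewrite subr_gt0.
  have sz : (sqn z)%:C = 1 - q%:C :> R[i].
    by rewrite /q cB subKr.
  have eE : e = (1 - t%:C) * D + t%:C * q%:C.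
    by rewrite /e cB rmorphM.
  have wz : 1 - cdot w z = D * q%:C / e.
    rewrite /w cdotZl /u cdotDl !cdotZl cdotxx xz sz cB rmorphM.
    by apply: (mulIf e0); rewrite divfK // mulrBl mulrAC mulVf // !mul1r eE; ring.
  have wx : 1 - cdot w xi = (pole z xi * kap)%:C / e.
    rewrite /w cdotZl /u cdotDl !cdotZl cdotxx zx cB.
    apply: (mulIf e0); rewrite divfK // mulrBl mulrAC mulVf // !mul1r eE.
    have -> : (pole z xi * kap)%:C = (1 - t%:C) * (D * Num.conj D) +
        t%:C * (q%:C * (1 - (sqn xi)%:C)).
      have -> : q%:C * (1 - (sqn xi)%:C) = ((1 - rho ^+ 2) * pole z xi)%:C :> R[i].
        by rewrite -qq -(cB (sqn xi)) -rmorphM.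
      rewrite DD -(cB t) -!rmorphM -rmorphD.
      by congr (_%:C); rewrite /kap; ring.
    by rewrite rmorphM; ring.
  have D00 : D != 0.
    by apply: contraTneq D0 => D_0; rewrite -D2 D_0 /= expr0n addr0 ltxx.
  have pk0 : pole z xi * kap != 0 by rewrite gt_eqF // mulr_gt0.
  have ratio : (1 - cdot z w) * ((1 - cdot xi z) / (1 - cdot xi w)) = (q / kap)%:C.
    have -> : 1 - cdot z w = Num.conj (D * q%:C / e).
      by rewrite -wz conj1B -cdotC.
    have -> : 1 - cdot xi w = Num.conj ((pole z xi * kap)%:C / e).
      by rewrite -wx conj1B -cdotC.
    rewrite -/D (rmorphM _ (D * _)) (rmorphM _ D) (rmorphM _ (pole z xi * kap)%:C).
    rewrite !fmorphV /= !conj_real.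
    have ce0 : Num.conj e != 0 by rewrite fmorph_eq0.
    have pkc : (pole z xi * kap)%:C != 0 :> R[i] by rewrite fmorph_eq0.
    have -> : (q / kap)%:C = (q * pole z xi)%:C / (pole z xi * kap)%:C :> R[i].
      rewrite -fmorphV -rmorphM; congr (_%:C); field.
      by apply/andP; split; rewrite gt_eqF.
    have -> : (q * pole z xi)%:C = q%:C * (D * Num.conj D) :> R[i].
      by rewrite DD -rmorphM.
    by move: (_%:C) pkc => P P0; field; rewrite ce0 P0.
  have zw0 : 1 - cdot z w != 0.
    have := cdot_lt1 z1 w1; apply: contraTneq => /eqP; rewrite subr_eq0 => /eqP <-.
    by rewrite normr1 /= ltxx.
  have h1 := @val_p_cvg z w xi w1 (cdot_lt1 xi1 w1).
  have h2 := @val_p_cvg z w z w1 (cdot_lt1 z1 w1).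
  have := seq_cvg_le h1 h2 (fun N => hC w N w1).
  rewrite -[2 * _ * _]mulrA ratio -[2 * _ * (_ / (1 - cdot z w))]mulrA.
  rewrite [(1 - cdot z w) * _]mulrC divfK // cdotxx sz subKr -/q.
  rewrite !ReMl !ReD !ReN.
  have Re2 (a : R[i]) : complex.Re (2 * a) = 2 * complex.Re a.
    by rewrite (_ : 2 = (2 : R)%:C) ?ReMl ?rmorph_nat.
  rewrite !Re2 /=.
  have i0 : 0 < (1 - sqn w)^-1 by rewrite invr_gt0 subr_gt0.
  rewrite [C * (_ * (_ - _))]mulrCA ler_pM2l //.
  have -> : 2 * (q / kap) - q = q * ((1 + t * rho ^+ 2) / kap).
    by rewrite /kap; field; rewrite gt_eqF.
  have -> : C * (2 * q - q) = q * C by ring.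
  by rewrite ler_pM2l // ler_pdivrMr.
rewrite /harnack_const -/rho ler_pdivrMr ?subr_gt0 //.
have [->|rho0] := eqVneq rho 0; first by rewrite addr0 subr0 mulr1.
have rp : 0 < rho by rewrite lt_neqAle eq_sym rho0.
rewrite leNgt; apply/negP => hlt.
have p0 : 0 < rho * (1 + C) by rewrite mulr_gt0 // ltr_wpDl // (lt_le_trans ltr01).
(* The value of t rho at which [key] becomes an equality. If C were too small, s0 would be less than
   1, and [key] would fail at the midpoint s of s0 and 1. *)
pose s0 := (C - 1) / (rho * (1 + C)).
have s0E : s0 * (rho * (1 + C)) = C - 1 by rewrite divfK // gt_eqF.
have s00 : 0 <= s0 by rewrite divr_ge0 ?subr_ge0 // ltW.
have s01 : s0 < 1 by rewrite ltr_pdivrMr // mul1r; lra.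
pose s := (1 + s0) / 2.
have s1 : s < 1 by rewrite /s; lra.
have sg : s0 < s by rewrite /s; lra.
have s00' : 0 <= s by apply: le_trans (ltW sg).
have sr0 : 0 <= s / rho by rewrite divr_ge0.
have := key _ sr0; rewrite divfK // => /(_ s1).
have -> : s / rho * rho ^+ 2 = s * rho by field.
have : s0 * (rho * (1 + C)) < s * (rho * (1 + C)) by rewrite ltr_pM2r.
rewrite s0E; lra.
Qed.

End LowerBound.

(** * The upper bounds for F(z), F(xi) meet the lower bounds for z, xi *)

Lemma sqrtr_le (R : realType) (c C : R) : 0 <= c -> C <= c ^+ 2 -> Num.sqrt C <= c.
Proof. by move=> c0 h; rewrite -[leRHS]ger0_norm // -sqrtr_sqr ler_wsqrtr. Qed.

Theorem theorem6p2 (R : realType) (n m : nat) (n_gt0 : (0 < n)%N)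
    (m_gt0 : (0 < m)%N) (H E : hilbertType R) (H_neq0 : exists x : H, x != 0)
    (HE : hilbert_tensor H E) (F : 'I_m -> free_hol n E)
    (F_contractive : contractive F) (z xi : 'rV[R[i]]_n)
    (z_ball : unit_ball z) (xi_ball : unit_ball xi) :
  let Z : op_tuple n H := scalar_tuple H z in
  let Xi : op_tuple n H := scalar_tuple H xi in
  let FZ : op_tuple m HE := fh_eval_tuple HE F Z in
  let FXi : op_tuple m HE := fh_eval_tuple HE F Xi in
  [/\ harnack_equiv FZ FXi,
      forall (WF : min_iso_dilation FZ) (VF : min_iso_dilation FXi)
             (W : min_iso_dilation Z) (V : min_iso_dilation Xi),
        exists (LF : bop (mid_space WF) (mid_space VF))
               (L : bop (mid_space W) (mid_space V)),
          [/\ is_harnack_op LF, is_harnack_op L,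
              opnorm LF <= opnorm L &
              opnorm L = Num.sqrt ((1 + norm2 (ball_aut z xi)) /
                                   (1 - norm2 (ball_aut z xi)))] &
      hyperbolic_dist FZ FXi <= hyperbolic_dist Z Xi].
Proof.
have z1 : sqn z < 1 := (unit_ball_sqn z).1 z_ball.
have xi1 : sqn xi < 1 := (unit_ball_sqn xi).1 xi_ball.
move=> Z Xi FZ FXi; pose C := harnack_const z xi.
have C1 : 1 <= C := harnack_const_ge1 z1 xi1.
have C0 : 0 < C := lt_le_trans ltr01 C1.
have sC1 : 1 <= Num.sqrt C by rewrite -[leLHS]sqrtr1 ler_sqrt // ltW.
have CC : C = harnack_const xi z := harnack_constC z1 xi1.
have dF : dominated C FZ FXi by apply: dominated_fh.
have dF' : dominated C FXi FZ by rewrite CC; apply: dominated_fh.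
have dZ : dominated C Z Xi by apply: dominated_scalar.
have dZ' : dominated C Xi Z by rewrite CC; apply: dominated_scalar.
have bFZ : closed_ball_op FZ by apply: (closed_ball_fh z1 xi1).
have bFXi : closed_ball_op FXi by apply: (closed_ball_fh xi1 z1).
have bZ : closed_ball_op Z by apply: (closed_ball_scalar z1 xi1).
have bXi : closed_ball_op Xi by apply: (closed_ball_scalar xi1 z1).
have eF : harnack_equiv_with (Num.sqrt C) FZ FXi.
  by split; apply: dominated_harnack_le.
have eZ : harnack_equiv_with (Num.sqrt C) Z Xi.
  by split; apply: dominated_harnack_le.
have [h h0] := H_neq0.
split.
- exists (Num.sqrt C); split; [exact: sC1|exact: eF].
- move=> WF VF W V.
  have [LF [hLF nLF]] := harnack_op_exists WF VF (ltW C0) dF.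
  have [L [hL nL]] := harnack_op_exists W V (ltW C0) dZ.
  have eL : opnorm L = Num.sqrt C.
    apply: le_anti; apply/andP; split; first exact: nL.
    apply: sqrtr_le; first exact: opnorm_ge0.
    apply: (harnack_const_le z1 xi1) => w N w1.
    exact: harnack_op_val h0 hL.
  exists LF, L; split; [exact: hLF|exact: hL| |exact: eL].
  by rewrite eL; exact: nLF.
- rewrite /hyperbolic_dist.
set SF := [set c : R | _]; set SZ := [set c : R | _].
have SFC : SF (Num.sqrt C) := conj sC1 eF.
have SZC : SZ (Num.sqrt C) := conj sC1 eZ.
(* The bound 1 keeps the infimum positive, where ln is increasing. *)
have lbF : lbound SF 1 by move=> c [].
have lbZ : lbound SZ (Num.sqrt C).
  move=> c [c1 [_ cZ]]; have c0 : 0 <= c by apply: le_trans c1.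
  apply: (sqrtr_le c0); apply: (harnack_const_le z1 xi1) => w N w1.
  exact: harnack_le_val h0 cZ.
have infF : inf SF <= Num.sqrt C by apply: (@ge_inf _ SF) SFC; exists 1.
have infF1 : 1 <= inf SF.
  by apply: lb_le_inf lbF; exists (Num.sqrt C); exact: SFC.
have infZ : Num.sqrt C <= inf SZ.
  by apply: lb_le_inf lbZ; exists (Num.sqrt C); exact: SZC.
move: (inf SF) (inf SZ) infF infF1 infZ => f g fC f1 Cg.
have f0 : 0 < f by apply: lt_le_trans f1.
have fg : f <= g by apply: le_trans Cg.
have g0 : 0 < g := lt_le_trans f0 fg.
by rewrite ler_ln; [exact: fg|exact: f0|exact: g0].
Qed.
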